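(* Let $(\mathcal{E},d)$ be a bicovariant differential calculus on a Hopf algebra $\mathcal{A}$, $\sigma$ the corresponding braiding map and $\Omega$ a normalised dual $2$-cocycle on $\mathcal{A}$. Suppose ${}_0\sigma$ is diagonalisable and $g$ is a bi-invariant pseudo-Riemannian metric on $\mathcal{E}$. Then: (i) If $\nabla$ is a bicovariant Levi-Civita connection for the triple $(\mathcal{E},d,g)$, then $\nabla$ deforms to a bicovariant Levi-Civita connection $\nabla_\Omega$ for $(\mathcal{E}_\Omega,d_\Omega,g_\Omega)$. (ii) In the setting of (i), if moreover $\nabla$ is the unique Levi-Civita connection for $(\mathcal{E},d,g)$, then $\nabla_\Omega$ is the unique bicovariant Levi-Civita connection for $(\mathcal{E}_\Omega,d_\Omega,g_\Omega)$.
   Context: Bimodules. All vector spaces are over $\mathbb{C}$. $\mathcal{A}$ is a Hopf algebra with coproduct $\Delta$ and counit $\epsilon$; Sweedler notation $\Delta(a)=a_{(1)}\otimes a_{(2)}$, left coactions $m\mapsto m_{(-1)}\otimes m_{(0)}$, right coactions $m\mapsto m_{(0)}\otimes m_{(1)}$. A left-covariant $\mathcal{A}$-bimodule is an $\mathcal{A}$-bimodule $M$ with a left comodule coaction $\Delta_M:M\to\mathcal{A}\otimes_{\mathbb{C}}M$ such that $\Delta_M(am)=\Delta(a)\Delta_M(m)$ and $\Delta_M(ma)=\Delta_M(m)\Delta(a)$; right-covariant bimodules are defined in the same way with a right coaction ${}_M\Delta:M\to M\otimes_{\mathbb{C}}\mathcal{A}$; a bicovariant bimodule has both, with $(\mathrm{id}\otimes{}_M\Delta)\Delta_M=(\Delta_M\otimes\mathrm{id}){}_M\Delta$.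 A linear map $T:M\to N$ is left-covariant if $(\mathrm{id}\otimes T)\Delta_M=\Delta_NT$, right-covariant if $(T\otimes\mathrm{id}){}_M\Delta={}_N\Delta T$, bicovariant if both. ${}_0M=\{m:\Delta_M(m)=1\otimes m\}$, $M_0=\{m:{}_M\Delta(m)=m\otimes1\}$. $M\otimes_{\mathcal{A}}N$ carries the diagonal coactions. Recalled facts (Woronowicz, Schauenburg): multiplication $\widetilde{u}^M:{}_0M\otimes_{\mathbb{C}}\mathcal{A}\to M$ is an isomorphism, and ${}_0(M\otimes_{\mathcal{A}}N)={}_0M\otimes_{\mathbb{C}}{}_0N$. Calculi. A first order differential calculus over $\mathcal{A}$ is an $\mathcal{A}$-bimodule $\mathcal{E}$ with a linear $d:\mathcal{A}\to\mathcal{E}$, $d(ab)=(da)b+a\,db$, such that every element of $\mathcal{E}$ is of the form $\sum_ka_kdb_k$. It is bicovariant if $\sum_ka_kdb_k=0$ implies $\sum_k\Delta(a_k)(\mathrm{id}\otimes d)\Delta(b_k)=0$ and $\sum_k\Delta(a_k)(d\otimes\mathrm{id})\Delta(b_k)=0$; then $\mathcal{E}$ is a bicovariant bimodule with $\Delta_{\mathcal{E}}d=(\mathrm{id}\otimes d)\Delta$, ${}_{\mathcal{E}}\Delta d=(d\otimes\mathrm{id})\Delta$. Standing assumption: ${}_0\mathcal{E}$, $\mathcal{E}_0$ are finite-dimensional. $\sigma$ is Woronowicz's canonical braiding: the unique bimodule endomorphism of $\mathcal{E}\otimes_{\mathcal{A}}\mathcal{E}$ with $\sigma(\omega\otimes\eta)=\eta\otimes\omega$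 for $\omega\in{}_0\mathcal{E}$, $\eta\in\mathcal{E}_0$; it is invertible, bicovariant and satisfies the braid equation; ${}_0\sigma$ is its restriction to ${}_0\mathcal{E}\otimes_{\mathbb{C}}{}_0\mathcal{E}={}_0(\mathcal{E}\otimes_{\mathcal{A}}\mathcal{E})$. $\Omega^2(\mathcal{A}):=(\mathcal{E}\otimes_{\mathcal{A}}\mathcal{E})/\mathrm{Ker}(\sigma-1)$ with quotient map $\wedge$; $d$ extends to $d:\mathcal{E}\to\Omega^2(\mathcal{A})$, $d(\sum a_kdb_k)=\sum da_k\wedge db_k$. When ${}_0\sigma$ is diagonalisable, ${}_0P_{\mathrm{sym}}$ denotes the idempotent on ${}_0\mathcal{E}\otimes_{\mathbb{C}}{}_0\mathcal{E}$ with range $\mathrm{Ker}({}_0\sigma-1)$ and kernel the sum of the eigenspaces of ${}_0\sigma$ for eigenvalues $\neq1$. Metrics and connections. A pseudo-Riemannian metric on $\mathcal{E}$ is a right $\mathcal{A}$-linear map $g:\mathcal{E}\otimes_{\mathcal{A}}\mathcal{E}\to\mathcal{A}$ with $g\circ\sigma=g$ and such that $g(\rho\otimes\nu)=0$ for all $\nu$ implies $\rho=0$. It is bi-invariant if $(\mathrm{id}\otimes\epsilon g)\Delta_{\mathcal{E}\otimes_{\mathcal{A}}\mathcal{E}}=g$ and $(\epsilon g\otimes\mathrm{id}){}_{\mathcal{E}\otimes_{\mathcal{A}}\mathcal{E}}\Delta=g$ (equivalently $g$ is a bicovariant map); then $g$ is scalar-valued on ${}_0\mathcal{E}\otimes_{\mathbb{C}}{}_0\mathcal{E}$.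 A (right) connection is a linear $\nabla:\mathcal{E}\to\mathcal{E}\otimes_{\mathcal{A}}\mathcal{E}$ with $\nabla(\rho a)=\nabla(\rho)a+\rho\otimes da$; it is torsionless if $\wedge\circ\nabla+d=0$ on $\mathcal{E}$; it is left-covariant/bicovariant if it is so as a map $\mathcal{E}\to\mathcal{E}\otimes_{\mathcal{A}}\mathcal{E}$. A left-covariant $\nabla$ maps ${}_0\mathcal{E}$ to ${}_0\mathcal{E}\otimes_{\mathbb{C}}{}_0\mathcal{E}$. Define $\widetilde{\Pi^0_g}(\nabla)=2(\mathrm{id}\otimes g)(\sigma\otimes\mathrm{id})(\nabla\otimes\mathrm{id}){}_0P_{\mathrm{sym}}:{}_0\mathcal{E}\otimes_{\mathbb{C}}{}_0\mathcal{E}\to{}_0\mathcal{E}$ and $\widetilde{\Pi_g}(\nabla):\mathcal{E}\otimes_{\mathcal{A}}\mathcal{E}\to\mathcal{E}$ by $\widetilde{\Pi_g}(\nabla)(\omega_1\otimes\omega_2a)=\widetilde{\Pi^0_g}(\nabla)(\omega_1\otimes\omega_2)a+g(\omega_1\otimes\omega_2)da$ for $\omega_i\in{}_0\mathcal{E}$, $a\in\mathcal{A}$. $\nabla$ is compatible with $g$ if $\widetilde{\Pi_g}(\nabla)=dg$, where $dg(e\otimes f)=d(g(e\otimes f))$. A Levi-Civita connection for $(\mathcal{E},d,g)$ is a left-covariant connection that is torsionless and compatible with $g$. Cocycle deformation. Let $\widehat{\mathcal{A}}$ be the restricted dual Hopf algebra of $\mathcal{A}$. A normalised dual $2$-cocycle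 is an invertible $\Omega=\sum_ih_i\otimes k_i\in\widehat{\mathcal{A}}\otimes\widehat{\mathcal{A}}$ with $(\widehat\epsilon\otimes\mathrm{id})(\Omega)=1=(\mathrm{id}\otimes\widehat\epsilon)(\Omega)$ and $(\Omega\otimes1)[(\widehat\Delta\otimes\mathrm{id})(\Omega)]=(1\otimes\Omega)[(\mathrm{id}\otimes\widehat\Delta)(\Omega)]$. Put $\gamma(a\otimes b)=\sum_ih_i(a)k_i(b)$, with convolution inverse $\overline\gamma$. $\mathcal{A}_\Omega$ is $\mathcal{A}$ with the same coproduct and product $a*_\Omega b=\gamma(a_{(1)}\otimes b_{(1)})a_{(2)}b_{(2)}\overline\gamma(a_{(3)}\otimes b_{(3)})$. For a bicovariant $\mathcal{A}$-bimodule $M$, $M_\Omega$ is the bicovariant $\mathcal{A}_\Omega$-bimodule with the same space and coactions and actions $a*_\Omega m=\gamma(a_{(1)}\otimes m_{(-1)})a_{(2)}m_{(0)}\overline\gamma(a_{(3)}\otimes m_{(1)})$, $m*_\Omega a=\gamma(m_{(-1)}\otimes a_{(1)})m_{(0)}a_{(2)}\overline\gamma(m_{(1)}\otimes a_{(3)})$. A bicovariant linear map $T:M\to N$ gives $T_\Omega:M_\Omega\to N_\Omega$, equal to $T$ as a linear map. There is a bicovariant $\mathcal{A}_\Omega$-bimodule isomorphism $\xi:\mathcal{E}_\Omega\otimes_{\mathcal{A}_\Omega}\mathcal{E}_\Omega\to(\mathcal{E}\otimes_{\mathcal{A}}\mathcal{E})_\Omega$, $\xi(m\otimes n)=\gamma(m_{(-1)}\otimes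 n_{(-1)})m_{(0)}\otimes n_{(0)}\overline\gamma(m_{(1)}\otimes n_{(1)})$. $(\mathcal{E}_\Omega,d_\Omega)$, with $d_\Omega=d$ as a linear map, is a bicovariant differential calculus over $\mathcal{A}_\Omega$, whose canonical braiding is $\sigma_\Omega$ (i.e. $\xi^{-1}\sigma\xi$) and for which ${}_0(\sigma_\Omega)$ is again diagonalisable; all notions above are applied to it. $g_\Omega$ denotes $g\circ\xi$, which is a bi-invariant pseudo-Riemannian metric on $\mathcal{E}_\Omega$, and for a bicovariant connection $\nabla$, $\nabla_\Omega$ denotes $\xi^{-1}\circ\nabla$. *)

(* Defs.v *)
From HB Require Import structures.
From mathcomp Require Import all_boot all_order all_algebra.
From mathcomp Require Import finmap monalg boolp classical_sets.

Set Implicit Arguments.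
Unset Strict Implicit.
Unset Printing Implicit Defensive.

Import GRing.Theory.
Local Open Scope classical_set_scope.
Local Open Scope ring_scope.
Local Open Scope quotient_scope.

(* One and the same vector space carries the product of A and the product of
   its cocycle deformation, and likewise for the actions on a bimodule.  Hence
   only the underlying vector spaces are canonical instances (lmodType K);
   products, actions and coactions are explicit operations, and the axioms are
   predicates on them. *)

Section Span.
Context {K : fieldType} {V : lmodType K}.
Implicit Types S : set V.

(* The smallest linear subspace containing S. *)
Definition span S : set V := fun x =>
  forall P : set V, P 0 -> (forall a u v, P u -> P v -> P (a *: u + v)) ->
  (forall u, S u -> P u) -> P x.

Lemma span0 S : span S 0. Proof. by move=> P P0 _ _. Qed.

Lemma spanP S a u v : span S u -> span S v -> span S (a *: u + v).
Proof. by move=> Su Sv P P0 PL PS; exact: PL (Su P P0 PL PS) (Sv P P0 PL PS). Qed.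

Lemma spanS S u : S u -> span S u.
Proof. by move=> Su P _ _ PS; apply: PS. Qed.

Definition spanp S : {pred V} := [pred x | `[< span S x >]].

Lemma spanpP S x : reflect (span S x) (x \in spanp S).
Proof. exact: asboolP. Qed.

Fact spanp_zmod_closed S : zmod_closed (spanp S).
Proof.
split=> [|x y /spanpP Sx /spanpP Sy]; first by apply/spanpP; apply: span0.
by apply/spanpP; rewrite addrC -scaleN1r; apply: spanP.
Qed.

HB.instance Definition _ S := GRing.isZmodClosed.Build V (spanp S)
  (spanp_zmod_closed S).

End Span.

(* V / span S *)
Section Lquot.
Context {K : fieldType} {V : lmodType K} (S : set V).

Definition lquot : Type := Quotient.quot (spanp S : zmodClosed V).

HB.instance Definition _ := GRing.Zmodule.on lquot.
HB.instance Definition _ := EqQuotient.on lquot.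

Definition lproj (x : V) : lquot := \pi_lquot x.
Definition lrepr (x : lquot) : V := repr x.

Lemma lreprK x : lproj (lrepr x) = x. Proof. exact: reprK. Qed.

Lemma lproj_eq x y : lproj x = lproj y <-> span S (x - y).
Proof.
split=> [/eqmodP|xy].
  by rewrite /= /Quotient.equiv => /spanpP.
by apply/eqmodP; rewrite /= /Quotient.equiv; apply/spanpP.
Qed.

Lemma lprojD x y : lproj (x + y) = lproj x + lproj y.
Proof. by rewrite /lproj /= raddfD. Qed.

Definition lquot_scale (a : K) (x : lquot) : lquot := lproj (a *: lrepr x).

Lemma lprojZ_subproof a x : lquot_scale a (lproj x) = lproj (a *: x).
Proof.
apply/lproj_eq; rewrite -scalerBr -[X in span _ X]addr0.
by apply: spanP; [apply/lproj_eq; rewrite lreprK|apply: span0].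
Qed.

Fact lquot_scaleA a b x :
  lquot_scale a (lquot_scale b x) = lquot_scale (a * b) x.
Proof. by rewrite -[x]lreprK !lprojZ_subproof scalerA. Qed.

Fact lquot_scale1 : left_id 1 lquot_scale.
Proof. by move=> x; rewrite /lquot_scale scale1r lreprK. Qed.

Fact lquot_scaleDr : right_distributive lquot_scale +%R.
Proof.
move=> a x y; rewrite -[x]lreprK -[y]lreprK -lprojD !lprojZ_subproof.
by rewrite scalerDr lprojD.
Qed.

Fact lquot_scaleDl x : {morph lquot_scale^~ x : a b / a + b}.
Proof. by move=> a b; rewrite /lquot_scale scalerDl lprojD. Qed.

HB.instance Definition _ := GRing.Zmodule_isLmodule.Build K lquot
  lquot_scaleA lquot_scale1 lquot_scaleDr lquot_scaleDl.

Fact lproj_is_linear : linear lproj.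
Proof. by move=> a x y; rewrite lprojD -lprojZ_subproof. Qed.

HB.instance Definition _ := GRing.isLinear.Build K V lquot _ lproj
  lproj_is_linear.

End Lquot.

Section Tensor.
Context {K : fieldType}.

Definition bilin (U V W : lmodType K) (f : U -> V -> W) : Prop :=
  (forall u, linear (f u)) /\ (forall v, linear (f^~ v)).

(* The tensor product of M and N balanced over the actions r and l of B: the
   free vector space on M * N modulo the K-bilinearity and balancing
   relations. *)
Section Balanced.
Context {M N : lmodType K} {B : Type} (r : M -> B -> M) (l : B -> N -> N).

Definition tgen (m : M) (n : N) : {malg K[(M * N)%type]} :=
  << (1 : K) *g (m, n) >>.

Definition tensor_rel : set {malg K[(M * N)%type]} := fun x =>
  [\/ exists c m m' n, x = tgen (c *: m + m') n - (c *: tgen m n + tgen m' n),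
      exists c m n n', x = tgen m (c *: n + n') - (c *: tgen m n + tgen m n')
    | exists m b n, x = tgen (r m b) n - tgen m (l b n)].

Definition btensor : lmodType K := lquot tensor_rel.

Definition btens (m : M) (n : N) : btensor := lproj tensor_rel (tgen m n).

(* The linear map induced by f, i.e. m (x) n |-> f m n; it is defined for every
   f, and meaningful when f is bilinear and balanced (tliftE, tlift_linear).
   Applied to a coproduct or a coaction this is Sweedler notation:
   tlift f (cop a) is f a_(1) a_(2). *)
Definition tlift (X : lmodType K) (f : M -> N -> X) (t : btensor) : X :=
  \sum_(k <- msupp (lrepr t)) (lrepr t)@_k *: f k.1 k.2.

Section TliftTheory.
Context {X : lmodType K} (f : M -> N -> X).
Hypothesis f_bilin : bilin f.
Hypothesis f_bal : forall m b n, f (r m b) n = f m (l b n).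

Let ev (x : {malg K[(M * N)%type]}) : X :=
  \sum_(k <- msupp x) x@_k *: f k.1 k.2.

Let evw (d : {fset (M * N)%type}) (x : {malg K[(M * N)%type]}) :
  (msupp x `<=` d)%fset -> ev x = \sum_(k <- d) x@_k *: f k.1 k.2.
Proof.
move=> xd; rewrite /ev (big_fset_incl _ xd) // => k kd kx.
by rewrite mcoeff_outdom // scale0r.
Qed.

Let ev_linear : linear ev.
Proof.
move=> a x y; pose d := (msupp x `|` msupp y `|` msupp (a *: x + y))%fset.
have xd : (msupp x `<=` d)%fset by rewrite /d -fsetUA fsubsetUl.
have yd : (msupp y `<=` d)%fset by rewrite /d fsetUAC fsubsetUr.
rewrite !(@evw d) ?fsubsetUr // scaler_sumr -big_split /=.
apply: eq_bigr => k _.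
by rewrite mcoeffD mcoeffZ scalerDl scalerA.
Qed.

Let ev_gen m n : ev (tgen m n) = f m n.
Proof. by rewrite (evw msuppU_le) big_seq_fset1 mcoeffUU scale1r. Qed.

Let evB x y : ev (x - y) = ev x - ev y.
Proof. by rewrite -[- y]scaleN1r [x + _]addrC ev_linear scaleN1r addrC. Qed.

Let ev0 x : span tensor_rel x -> ev x = 0.
Proof.
move=> /(_ [set x | ev x = 0]); apply=> [|a u v /= eu ev'|u] /=.
- by have := evB 0 0; rewrite !subrr.
- by rewrite ev_linear eu ev' scaler0 addr0.
case=> [[c [m [m' [n ->]]]]|[c [m [n [n' ->]]]]|[m [b [n ->]]]].
- by rewrite evB ev_linear !ev_gen (f_bilin.2 n c m m') subrr.
- by rewrite evB ev_linear !ev_gen f_bilin.1 subrr.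
- by rewrite evB !ev_gen f_bal subrr.
Qed.

Let ev_proj x : tlift f (lproj _ x) = ev x.
Proof.
rewrite -[LHS]/(ev (lrepr (lproj tensor_rel x))); apply/eqP; rewrite -subr_eq0.
by rewrite -evB; apply/eqP/ev0/lproj_eq; rewrite lreprK.
Qed.

Lemma tliftE m n : tlift f (btens m n) = f m n.
Proof. by rewrite ev_proj ev_gen. Qed.

Lemma tlift_linear : linear (tlift f).
Proof.
move=> a x y; rewrite -[x]lreprK -[y]lreprK -linearP.
by rewrite !ev_proj ev_linear.
Qed.

End TliftTheory.

Lemma btens_bilin : bilin btens.
Proof.
split=> [m c n n'|n c m m']; rewrite -linearP; apply/lproj_eq; apply: spanS.
  by apply: Or32; exists c, m, n, n'.
by apply: Or31; exists c, m, m', n.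
Qed.

Lemma btens_bal m b n : btens (r m b) n = btens m (l b n).
Proof. by apply/lproj_eq; apply: spanS; apply: Or33; exists m, b, n. Qed.

Lemma btens_gen (t : btensor) :
  exists s : seq (M * N), t = \sum_(p <- s) btens p.1 p.2.
Proof.
rewrite -[t]lreprK; move: (lrepr t) => x.
exists [seq (x@_k *: k.1, k.2) | k <- msupp x].
rewrite [in LHS](monalgE x) raddf_sum big_map; apply: eq_bigr => -[m n] _ /=.
have bZ c m' : btens (c *: m') n = c *: btens m' n.
  have b0 : btens 0 n = 0.
    by have := btens_bilin.2 n (-1) 0 0; rewrite scaler0 addr0 scaleN1r addNr.
  by have := btens_bilin.2 n c m' 0; rewrite b0 !addr0.
rewrite bZ /btens -linearZ; congr (lproj _ _); apply/malgP => k.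
by rewrite mcoeffZ !mcoeffU mulrnAr mulr1.
Qed.
End Balanced.

Definition tensor (M N : lmodType K) : lmodType K :=
  btensor (fun (m : M) (c : K) => c *: m) (fun (c : K) (n : N) => c *: n).

Definition tens (M N : lmodType K) (m : M) (n : N) : tensor M N := btens _ _ m n.

Local Notation "m \ox n" := (tens m n) (at level 40, left associativity).

Section Maps.
Implicit Types M N P : lmodType K.

(* f (x) g *)
Definition tmap M N M' N' (f : M -> M') (g : N -> N') :
  tensor M N -> tensor M' N' := tlift (fun m n => f m \ox g n).

Definition tassoc M N P : tensor (tensor M N) P -> tensor M (tensor N P) :=
  tlift (fun t p => tlift (fun m n => m \ox (n \ox p)) t).

(* (m (x) n, m' (x) n') |-> f m m' (x) g n n' *)
Definition tprod M N M' N' M'' N'' (f : M -> M' -> M'') (g : N -> N' -> N'')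
    (s : tensor M N) (t : tensor M' N') : tensor M'' N'' :=
  tlift (fun m n => tlift (fun m' n' => f m m' \ox g n n') t) s.

End Maps.

(* The inverse of f where it exists, and 0 elsewhere. *)
Definition finv (U V : lmodType K) (f : U -> V) (y : V) : U :=
  xget 0 [set x | f x = y].

Definition findim (V : lmodType K) (P : set V) : Prop :=
  exists (n : nat) (e : 'I_n -> V), forall v,
    P v <-> exists c : 'I_n -> K, v = \sum_i c i *: e i.

Definition diagonalisable (V : lmodType K) (f : V -> V) : Prop :=
  exists (n : nat) (e : 'I_n -> V) (c : 'I_n -> K),
    (forall v, exists! x : {ffun 'I_n -> K}, v = \sum_i x i *: e i) /\
    (forall i, f (e i) = c i *: e i).

(* P is the idempotent with range Ker(s - 1) and kernel the sum of the
   eigenspaces of s for the eigenvalues other than 1. *)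
Definition is_psym (V : lmodType K) (s P : V -> V) : Prop :=
  [/\ linear P,
      forall v, P (P v) = P v,
      forall v, (exists u, P u = v) <-> s v = v
    & forall v, P v = 0 <->
        span [set u | exists2 c : K, c != 1 & s u = c *: u] v].

Definition psym (V : lmodType K) (s : V -> V) : V -> V :=
  xget (id : {classic V -> V}) [set P | is_psym s P].

(* The coinvariants {v | D v = one (x) v}, as a vector space. *)
Section Coinvariants.
Context {H V : lmodType K} (one : H) (D : {linear V -> tensor H V}).

Definition coinvp : {pred V} := [pred v | D v == one \ox v].

Fact coinvp_submod_closed : submod_closed coinvp.
Proof.
have [tensr _] := btens_bilin (fun (m : H) (c : K) => c *: m)
                    (fun (c : K) (n : V) => c *: n).
split=> [|a u v]; rewrite !inE.
  have := tensr one (-1) 0 0.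
  by rewrite (linear0 D) scaler0 addr0 scaleN1r addNr => <-.
by move=> /eqP Du /eqP Dv; rewrite linearP Du Dv; apply/eqP/esym/tensr.
Qed.

HB.instance Definition _ := GRing.isSubmodClosed.Build K V coinvp
  coinvp_submod_closed.

Record coinv : Type := Coinv { coinv_val :> V; _ : coinv_val \in coinvp }.

HB.instance Definition _ := [isSub for coinv_val].
HB.instance Definition _ := [Choice of coinv by <:].
HB.instance Definition _ := [SubChoice_isSubLmodule of coinv by <:].

End Coinvariants.

End Tensor.

Notation "m \ox n" := (tens m n) (at level 40, left associativity) : ring_scope.

Section HopfAlgebra.
Context {K : fieldType}.

Record bialg_data := BialgData {
  bcar :> lmodType K;
  bmul : bcar -> bcar -> bcar;
  bone : bcar;
  cop : {linear bcar -> tensor bcar bcar};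
  eps : {scalar bcar}
}.

Variable A : bialg_data.
Implicit Types a b c : A.
Local Notation "a *A b" := (bmul a b) (at level 40, left associativity).
Local Notation "1A" := (bone A).

Definition algebra_axioms : Prop :=
  [/\ bilin (@bmul A),
      forall a b c, a *A (b *A c) = (a *A b) *A c,
      forall a, 1A *A a = a
    & forall a, a *A 1A = a].

Definition coalgebra_axioms : Prop :=
  [/\ forall a, tassoc (tmap (cop A) id (cop A a)) = tmap id (cop A) (cop A a),
      forall a, tlift (fun a1 a2 => eps A a1 *: a2) (cop A a) = a
    & forall a, tlift (fun a1 a2 => eps A a2 *: a1) (cop A a) = a].

Definition bialgebra_axioms : Prop :=
  [/\ forall a b, cop A (a *A b) = tprod (@bmul A) (@bmul A) (cop A a) (cop A b),
      cop A 1A = 1A \ox 1A,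
      forall a b, eps A (a *A b) = eps A a * eps A b
    & eps A 1A = 1].

Definition antipode (S : {linear A -> A}) : Prop :=
  (forall a, tlift (fun a1 a2 => S a1 *A a2) (cop A a) = eps A a *: 1A) /\
  (forall a, tlift (fun a1 a2 => a1 *A S a2) (cop A a) = eps A a *: 1A).

Definition hopf_algebra : Prop :=
  [/\ algebra_axioms, coalgebra_axioms, bialgebra_axioms
    & exists S, antipode S].

(* Value on a of the map a_(1) (x) a_(2) (x) a_(3) |-> F a_(1) a_(2) a_(3). *)
Definition sweedler3 (X : lmodType K) (a : A) (F : A -> A -> A -> X) : X :=
  tlift (fun a1 a' => tlift (fun a2 a3 => F a1 a2 a3) (cop A a')) (cop A a).

(* The restricted dual: the functionals f such that f o mult lies in the
   algebraic tensor square of the full dual. *)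
Definition restricted_dual (f : {scalar A}) : Prop :=
  exists (n : nat) (h k : 'I_n -> {scalar A}),
    forall a b, f (a *A b) = \sum_i h i a * k i b.

(* Elements of the n-th tensor power of the restricted dual are identified with
   the multilinear functionals on A^n which they induce (the pairing is
   faithful over a field), here n = 2. *)
Definition in_dual_tensor2 (F : A -> A -> K) : Prop :=
  exists (n : nat) (h k : 'I_n -> {scalar A}),
    (forall i, restricted_dual (h i) /\ restricted_dual (k i)) /\
    (forall a b, F a b = \sum_i h i a * k i b).

(* The products of the tensor square and cube of the dual algebra, dual to the
   coproducts of the tensor square and cube of A. *)
Definition conv2 (F G : A -> A -> K) (a b : A) : K :=
  tlift (fun a1 a2 => tlift (fun b1 b2 => F a1 b1 * G a2 b2 : K^o)
    (cop A b)) (cop A a).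

Definition conv3 (F G : A -> A -> A -> K) (a b c : A) : K :=
  tlift (fun a1 a2 => tlift (fun b1 b2 => tlift (fun c1 c2 =>
    F a1 b1 c1 * G a2 b2 c2 : K^o) (cop A c)) (cop A b)) (cop A a).

(* om is a normalised dual 2-cocycle with inverse om'.  The unit of the dual is
   eps, its counit is evaluation at 1, its coproduct is (Delta h) a b = h (a b). *)
Definition dual_2cocycle (om om' : A -> A -> K) : Prop :=
  [/\ in_dual_tensor2 om /\ in_dual_tensor2 om',
      forall a b, conv2 om om' a b = eps A a * eps A b /\
                  conv2 om' om a b = eps A a * eps A b,
      forall a, om 1A a = eps A a /\ om a 1A = eps A a
    & forall a b c,
        conv3 (fun x y z => om x y * eps A z) (fun x y z => om (x *A y) z) a b c
      = conv3 (fun x y z => eps A x * om y z) (fun x y z => om x (y *A z)) a b c].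

End HopfAlgebra.

Section Calculus.
Context {K : fieldType}.

Record calculus_data (A : @bialg_data K) := CalculusData {
  ccar :> lmodType K;
  lact : A -> ccar -> ccar;
  ract : ccar -> A -> ccar;
  lcoact : {linear ccar -> tensor A ccar};
  rcoact : {linear ccar -> tensor ccar A};
  diff : {linear A -> ccar}
}.

Context {A : @bialg_data K} (E : calculus_data A).
Implicit Types (a b : A) (m n : E).
Local Notation "a *A b" := (bmul a b) (at level 40, left associativity).
Local Notation "1A" := (bone A).
Local Notation "a *> m" := (lact a m) (at level 38, right associativity).
Local Notation "m <* a" := (ract m a) (at level 39, left associativity).
Local Notation d := (diff E).

Definition bimodule_axioms : Prop :=
  [/\ bilin (@lact A E) /\ bilin (@ract A E),
      forall m, 1A *> m = m /\ m <* 1A = m,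
      forall a b m, a *> (b *> m) = (a *A b) *> m,
      forall a b m, (m <* a) <* b = m <* (a *A b)
    & forall a b m, (a *> m) <* b = a *> (m <* b)].

Definition left_covariant_bimodule : Prop :=
  [/\ forall m, tassoc (tmap (cop A) id (lcoact E m))
              = tmap id (lcoact E) (lcoact E m),
      forall m, tlift (fun a m0 => eps A a *: m0) (lcoact E m) = m,
      forall a m, lcoact E (a *> m)
                = tprod (@bmul K A) (@lact A E) (cop A a) (lcoact E m)
    & forall a m, lcoact E (m <* a)
                = tprod (@bmul K A) (@ract A E) (lcoact E m) (cop A a)].

Definition right_covariant_bimodule : Prop :=
  [/\ forall m, tassoc (tmap (rcoact E) id (rcoact E m))
              = tmap id (cop A) (rcoact E m),
      forall m, tlift (fun m0 a => eps A a *: m0) (rcoact E m) = m,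
      forall a m, rcoact E (a *> m)
                = tprod (@lact A E) (@bmul K A) (cop A a) (rcoact E m)
    & forall a m, rcoact E (m <* a)
                = tprod (@ract A E) (@bmul K A) (rcoact E m) (cop A a)].

Definition bicovariant_bimodule : Prop :=
  [/\ bimodule_axioms, left_covariant_bimodule, right_covariant_bimodule
    & forall m, tmap id (rcoact E) (lcoact E m)
              = tassoc (tmap (lcoact E) id (rcoact E m))].

Definition first_order_calculus : Prop :=
  [/\ bimodule_axioms,
      forall a b, d (a *A b) = d a <* b + a *> d b
    & forall m, exists s : seq (A * A), m = \sum_(p <- s) p.1 *> d p.2].

Definition bicovariant_condition : Prop :=
  forall s : seq (A * A), \sum_(p <- s) p.1 *> d p.2 = 0 ->
    \sum_(p <- s) tprod (@bmul K A) (@lact A E) (cop A p.1)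
                    (tmap id d (cop A p.2)) = 0 /\
    \sum_(p <- s) tprod (@lact A E) (@bmul K A) (cop A p.1)
                    (tmap d id (cop A p.2)) = 0.

(* The last two clauses say that the coactions of E are the ones induced by d. *)
Definition bicovariant_calculus : Prop :=
  [/\ first_order_calculus, bicovariant_condition, bicovariant_bimodule,
      forall a, lcoact E (d a) = tmap id d (cop A a)
    & forall a, rcoact E (d a) = tmap d id (cop A a)].

Definition linv : lmodType K := coinv 1A (lcoact E).

Definition is_linv m : Prop := lcoact E m = 1A \ox m.
Definition is_rinv m : Prop := rcoact E m = m \ox 1A.

Definition tensA : lmodType K := btensor (@ract A E) (@lact A E).

Definition tA m n : tensA := btens _ _ m n.

Definition lact2 a : tensA -> tensA := tlift (fun m n => tA (a *> m) n).
Definition ract2 (x : tensA) a : tensA := tlift (fun m n => tA m (n <* a)) x.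

Definition lcoact2 : tensA -> tensor A tensA :=
  tlift (fun m n => tprod (@bmul K A) tA (lcoact E m) (lcoact E n)).
Definition rcoact2 : tensA -> tensor tensA A :=
  tlift (fun m n => tprod tA (@bmul K A) (rcoact E m) (rcoact E n)).

Definition canonical_braiding (sigma : tensA -> tensA) : Prop :=
  [/\ linear sigma,
      forall a x, sigma (lact2 a x) = lact2 a (sigma x),
      forall a x, sigma (ract2 x a) = ract2 (sigma x) a
    & forall w h, is_linv w -> is_rinv h -> sigma (tA w h) = tA h w].

Definition Omega2 (sigma : tensA -> tensA) : lmodType K :=
  lquot [set x : tensA | sigma x = x].

Definition wedge (sigma : tensA -> tensA) (x : tensA) : Omega2 sigma :=
  lproj _ x.

(* For a bicovariant calculus, iota is a bijection from 0E (x) 0E onto the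
   left-invariants of E (x)_A E, which sigma preserves, so finv iota is there
   its inverse and sigma0 is the restriction of sigma. *)
Definition linv2 : lmodType K := tensor linv linv.

Definition iota : linv2 -> tensA := tlift (fun w1 w2 : linv => tA w1 w2).

Definition sigma0 (sigma : tensA -> tensA) (t : linv2) : linv2 :=
  finv iota (sigma (iota t)).

(* Bijective for a bicovariant calculus: this is u~ for E (x)_A E, precomposed
   with iota (x) id. *)
Definition umul : tensor linv2 A -> tensA := tlift (fun t a => ract2 (iota t) a).

Definition pseudo_riemannian_metric (sigma : tensA -> tensA) (g : tensA -> A) :
    Prop :=
  [/\ linear g,
      forall x a, g (ract2 x a) = g x *A a,
      forall x, g (sigma x) = g x
    & forall m, (forall n, g (tA m n) = 0) -> m = 0].

Definition bi_invariant (g : tensA -> A) : Prop :=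
  (forall x, tlift (fun a x0 => eps A (g x0) *: a) (lcoact2 x) = g x) /\
  (forall x, tlift (fun x0 a => eps A (g x0) *: a) (rcoact2 x) = g x).

Section Connection.
Variable nabla : E -> tensA.

Definition connection : Prop :=
  linear nabla /\ forall m a, nabla (m <* a) = ract2 (nabla m) a + tA m (d a).

Definition left_covariant : Prop :=
  forall m, tmap id nabla (lcoact E m) = lcoact2 (nabla m).

Definition right_covariant : Prop :=
  forall m, tmap nabla id (rcoact E m) = rcoact2 (nabla m).

(* wedge o nabla + d = 0, where d : E -> Omega^2(A) takes the value
   sum_k da_k ^ db_k on sum_k a_k db_k. *)
Definition torsionless (sigma : tensA -> tensA) : Prop :=
  forall s : seq (A * A),
    wedge sigma (nabla (\sum_(p <- s) p.1 *> d p.2))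
    + \sum_(p <- s) wedge sigma (tA (d p.1) (d p.2)) = 0.

(* nabla as a map 0E -> 0E (x) 0E *)
Definition nabla0 (w : linv) : linv2 := finv iota (nabla w).

(* id (x) g on 0E (x) 0E (x) 0E *)
Definition id_tens_g (g : tensA -> A) : tensor linv2 linv -> E :=
  tlift (fun (t : linv2) (w3 : linv) =>
    tlift (fun w1 w2 : linv => w1 <* g (tA w2 w3)) t).

Definition Pi0 (sigma : tensA -> tensA) (g : tensA -> A) (t : linv2) : E :=
  2%:R *: id_tens_g g (tmap (sigma0 sigma) id (tmap nabla0 id
            (psym (sigma0 sigma) t))).

Definition Pi_g (sigma : tensA -> tensA) (g : tensA -> A) (x : tensA) : E :=
  tlift (fun t a => Pi0 sigma g t <* a + g (iota t) *> d a) (finv umul x).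

Definition compatible (sigma : tensA -> tensA) (g : tensA -> A) : Prop :=
  forall x, Pi_g sigma g x = d (g x).

(* sigma is the canonical braiding of E, which is unique. *)
Definition levi_civita (g : tensA -> A) : Prop :=
  exists sigma, [/\ canonical_braiding sigma, connection, left_covariant,
                    torsionless sigma & compatible sigma g].

Definition bicovariant_levi_civita (g : tensA -> A) : Prop :=
  levi_civita g /\ right_covariant.

End Connection.

(* Value on m of the map m_(-1) (x) m_(0) (x) m_(1) |-> F m_(-1) m_(0) m_(1). *)
Definition bisweedler (X : lmodType K) m (F : A -> E -> A -> X) : X :=
  tlift (fun m' a1 => tlift (fun a m0 => F a m0 a1) (lcoact E m')) (rcoact E m).

End Calculus.

Section Deformation.
Context {K : fieldType} {A : @bialg_data K}.
Variables om om' : A -> A -> K.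

Definition deform_mul (a b : A) : A :=
  sweedler3 a (fun a1 a2 a3 => sweedler3 b (fun b1 b2 b3 =>
    (om a1 b1 * om' a3 b3) *: bmul a2 b2)).

Definition deform_alg : @bialg_data K :=
  @BialgData K (bcar A) deform_mul (bone A) (cop A) (eps A).

Variable E : calculus_data A.

Definition deform_lact (a : A) (m : E) : E :=
  sweedler3 a (fun a1 a2 a3 => bisweedler m (fun x m0 y =>
    (om a1 x * om' a3 y) *: lact a2 m0)).

Definition deform_ract (m : E) (a : A) : E :=
  sweedler3 a (fun a1 a2 a3 => bisweedler m (fun x m0 y =>
    (om x a1 * om' y a3) *: ract m0 a2)).

Definition deform_calculus : calculus_data deform_alg :=
  @CalculusData K deform_alg (ccar E) deform_lact deform_ract
    (lcoact E) (rcoact E) (diff E).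

Definition xi : tensA deform_calculus -> tensA E :=
  tlift (fun m n : E => bisweedler m (fun x m0 y => bisweedler n (fun z n0 t =>
    (om x z * om' y t) *: tA m0 n0))).

Definition deform_metric (g : tensA E -> A) : tensA deform_calculus -> deform_alg :=
  g \o xi.

(* For a 2-cocycle om with inverse om', xi is bijective. *)
Definition deform_connection (nabla : E -> tensA E) :
    deform_calculus -> tensA deform_calculus :=
  finv xi \o nabla.

End Deformation.

Arguments is_linv {K A} E m.
Arguments is_rinv {K A} E m.
Arguments xi {K A} om om' {E}.
Arguments deform_metric {K A} om om' {E} g.
Arguments deform_connection {K A} om om' {E} nabla.

(* Main.v *)
Require Import Defs.
From HB Require Import structures.
From mathcomp Require Import all_boot all_algebra.
From mathcomp Require Import boolp classical_sets.
From mathcomp Require Import reals complex.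

Set Implicit Arguments.
Unset Strict Implicit.
Unset Printing Implicit Defensive.

Import GRing.Theory.
Local Open Scope ring_scope.

Local Notation iota := Defs.iota.

(** The deformation replaces each bilinear operation f by its twist
    (m, n) |-> om(m_(-1), n_(-1)) f(m_(0), n_(0)) om'(m_(1), n_(1)).
    Twists compose by convolution, so twisting is invertible, and by the cocycle
    identity it turns associativity and balancing of the original operations
    into those of the deformed ones.  Hence xi is an isomorphism which carries
    each operation on the deformed tensor square to the twist of the original
    one.  For N = xi o N' bicovariant, the Leibniz rule and the torsion equation
    for N' are the twists of those for N, and twisting is injective.

    Compatibility with g is the vanishing of Pi0.  On left-invariants xi is the
    twist theta by om' along the right coaction, and the cocycle identity with
    the right invariance of g gives Pi0_Omega = Pi0 o theta.  So N' is a
    bicovariant Levi-Civita connection if and only if N is, which yields (i) and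
    (ii).

    That compatibility reduces to Pi0 uses the isomorphism of 0E (x) 0E (x) A
    with the tensor square given by right multiplication.  The antipode is not
    assumed bijective; finite-dimensionality of 0E replaces this, through the
    invertibility of the Drinfeld map w |-> w_(0) <| S(w_(1)) on 0E. *)

(** * Multilinear maps and Sweedler sums *)

Section Multilinear.
Context {K : fieldType}.
Implicit Types U V W X : lmodType K.

(** The deformed algebra is only shown to be a bialgebra; its antipode is never constructed.
    Whatever that antipode would supply for the deformed calculus (spanning by left-invariants,
    uniqueness of the braiding, injectivity of [iota], bijectivity of [umul]) is carried over from
    E, by untwisting an action or along [xi].

    A right coaction is read as a left coaction of the co-opposite coalgebra. There convolution is
    reversed, which is exactly what lets [om'] on the right play the part of [om] on the left: one
    theory of one-sided twists is applied twice, and one convolution identity inverts both halves of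
    a twist.

    The definition of a Levi-Civita connection quantifies over its braiding. For (ii) a competitor
    on the deformed side brings a braiding of its own, which has to be identified with the conjugate
    of [sigma] before anything can be transported back. The bicovariance of the competitor is then
    what lets the twists in the Leibniz rule and in [Pi0] pass through it. *)

Definition lin U V (f : U -> V) : Prop := linear f.

Definition trilin U V W X (f : U -> V -> W -> X) : Prop :=
  (forall u, bilin (f u)) /\ (forall v w, lin (fun u => f u v w)).

Lemma linZD U V (f : U -> V) : lin f -> forall a u v, f (a *: u + v) = a *: f u + f v.
Proof. by []. Qed.

Lemma linD U V (f : U -> V) : lin f -> {morph f : x y / x + y}.
Proof. by move=> Lf x y; have := Lf 1 x y; rewrite !scale1r. Qed.

Lemma lin_zero U V (f : U -> V) : lin f -> f 0 = 0.
Proof. by move=> Lf; apply: (addrI (f 0)); rewrite -linD // !addr0. Qed.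

Lemma linZ U V (f : U -> V) : lin f -> forall a x, f (a *: x) = a *: f x.
Proof. by move=> Lf a x; have := Lf a x 0; rewrite (lin_zero Lf) !addr0. Qed.

Lemma lin_sum U V (f : U -> V) : lin f -> forall I (s : seq I) F,
  f (\sum_(i <- s) F i) = \sum_(i <- s) f (F i).
Proof.
by move=> Lf I s F; rewrite (big_morph f (linD Lf) (lin_zero Lf)).
Qed.

Lemma eq_lin U V (f g : U -> V) : (forall x, f x = g x) -> lin g -> lin f.
Proof. by move=> fg Lg a u v; rewrite !fg Lg. Qed.

Lemma eq_bilin U V W (f g : U -> V -> W) :
  (forall x y, f x y = g x y) -> bilin g -> bilin f.
Proof.
move=> fg [g2 g1]; split=> [u|v]; last by apply: eq_lin (g1 v) => u; apply: fg.
by apply: eq_lin (g2 u) => v; apply: fg.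
Qed.

Lemma lin_id U : lin (fun x : U => x). Proof. by []. Qed.

Lemma lin_comp U V W (f : V -> W) (g : U -> V) :
  lin f -> lin g -> lin (fun x => f (g x)).
Proof. by move=> Lf Lg a u v; rewrite Lg Lf. Qed.

Lemma lin_add U V (f g : U -> V) : lin f -> lin g -> lin (fun x => f x + g x).
Proof. by move=> Lf Lg a u v; rewrite Lf Lg scalerDr addrACA. Qed.

Lemma lin_opp U V (f : U -> V) : lin f -> lin (fun x => - f x).
Proof. by move=> Lf a u v; rewrite Lf opprD scalerN. Qed.

Lemma lin_scale U V (c : K) (f : U -> V) : lin f -> lin (fun x => c *: f x).
Proof. by move=> Lf a u v; rewrite Lf scalerDr !scalerA mulrC. Qed.

Lemma lin_scalel U V (s : U -> K) (v : V) :
  lin (s : U -> K^o) -> lin (fun x => s x *: v).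
Proof. by move=> Ls a u w; rewrite Ls scalerDl scalerA. Qed.

Lemma lin_mulr U (s : U -> K) (c : K) :
  lin (s : U -> K^o) -> lin ((fun x => c * s x) : U -> K^o).
Proof. by move=> Ls a u w; rewrite Ls mulrDr mulrCA. Qed.

Lemma lin_mull U (s : U -> K) (c : K) :
  lin (s : U -> K^o) -> lin ((fun x => s x * c) : U -> K^o).
Proof. by move=> Ls a u w; rewrite Ls mulrDl -mulrA. Qed.

Lemma lin_big U V I (s : seq I) (f : I -> U -> V) :
  (forall i, lin (f i)) -> lin (fun x => \sum_(i <- s) f i x).
Proof.
move=> Lf a u v; rewrite scaler_sumr -big_split /=.
by apply: eq_bigr => i _; rewrite Lf.
Qed.

Lemma lin_linear U V (f : {linear U -> V}) : lin f.
Proof. exact: linearP. Qed.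

Lemma lin_scalar U (f : {scalar U}) : lin (f : U -> K^o).
Proof. by move=> a u v; rewrite linearP. Qed.

Lemma bilin_lin1 U V W (f : U -> V -> W) : bilin f -> forall v, lin (fun u => f u v).
Proof. by case. Qed.

Lemma bilin_lin2 U V W (f : U -> V -> W) : bilin f -> forall u, lin (f u).
Proof. by case. Qed.

Lemma bilinI U V W (f : U -> V -> W) :
  (forall u, lin (f u)) -> (forall v, lin (fun u => f u v)) -> bilin f.
Proof. by []. Qed.

Lemma bilin_tens U V : bilin (@tens K U V).
Proof. exact: btens_bilin. Qed.

Lemma trilin_lin1 U V W X (f : U -> V -> W -> X) : trilin f ->
  forall v w, lin (fun u => f u v w).
Proof. by case. Qed.

Lemma trilin_lin2 U V W X (f : U -> V -> W -> X) : trilin f ->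
  forall u w, lin (fun v => f u v w).
Proof. by case=> fb _ u; case: (fb u). Qed.

Lemma trilin_lin3 U V W X (f : U -> V -> W -> X) : trilin f ->
  forall u v, lin (f u v).
Proof. by case=> fb _ u; case: (fb u). Qed.

Definition rep U V (t : tensor U V) : seq (U * V) := sval (cid (btens_gen t)).

End Multilinear.

(* A Sweedler sum: t = \sum u (x) v for a chosen list of pairs, and
   ev t f = \sum f u v.  It does not depend on the list when f is bilinear. *)
HB.lock Definition ev (K : fieldType) (U V X : lmodType K) (t : tensor U V)
    (f : U -> V -> X) : X := \sum_(p <- rep t) f p.1 p.2.

Section SweedlerSums.
Context {K : fieldType}.
Implicit Types U V W X : lmodType K.

Lemma repE U V (t : tensor U V) : t = \sum_(p <- rep t) p.1 \ox p.2.
Proof. exact: (svalP (cid (btens_gen t))). Qed.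

Lemma bilin_bal U V X (f : U -> V -> X) : bilin f ->
  forall u c v, f (c *: u) v = f u (c *: v).
Proof. by case=> f2 f1 u c v; rewrite (linZ (f2 u)) (linZ (f1 v)). Qed.

Lemma tlift_tens U V X (f : U -> V -> X) : bilin f ->
  forall u v, tlift f (u \ox v) = f u v.
Proof. by move=> bf u v; apply: tliftE => //; apply: bilin_bal. Qed.

Lemma tlift_lin U V X (f : U -> V -> X) : bilin f ->
  lin (tlift f : tensor U V -> X).
Proof. by move=> bf; apply: tlift_linear => //; apply: bilin_bal. Qed.

Lemma tlift_ev U V X (f : U -> V -> X) (t : tensor U V) :
  bilin f -> tlift f t = ev t f.
Proof.
move=> bf; rewrite ev.unlock {1}[t]repE (lin_sum (tlift_lin bf)).
by apply: eq_bigr => p _; apply: tlift_tens.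
Qed.

Lemma eq_ev U V X (t : tensor U V) (f g : U -> V -> X) :
  (forall u v, f u v = g u v) -> ev t f = ev t g.
Proof. by move=> fg; rewrite ev.unlock; apply: eq_bigr. Qed.

Lemma ev_tens U V X (f : U -> V -> X) u v : bilin f -> ev (u \ox v) f = f u v.
Proof. by move=> bf; rewrite -tlift_ev // tlift_tens. Qed.

Lemma lin_ev_arg U V W X (t : W -> tensor U V) (f : U -> V -> X) :
  lin t -> bilin f -> lin (fun x => ev (t x) f).
Proof.
move=> Lt bf a u v; rewrite -!tlift_ev // Lt.
by rewrite (linZD (tlift_lin bf)).
Qed.

Lemma lin_ev_fun U V W X (t : tensor U V) (f : W -> U -> V -> X) :
  (forall u v, lin (fun x => f x u v)) -> lin (fun x => ev t (f x)).
Proof.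
move=> Lf a u v; rewrite ev.unlock scaler_sumr -big_split /=.
by apply: eq_bigr => p _; apply: Lf.
Qed.

Lemma lin_ev U V X (Y : lmodType K) (g : X -> Y) (t : tensor U V) (f : U -> V -> X) :
  lin g -> g (ev t f) = ev t (fun u v => g (f u v)).
Proof. by move=> Lg; rewrite ev.unlock (lin_sum Lg). Qed.

Lemma exch_ev U V U' V' X (t : tensor U V) (s : tensor U' V') f :
  ev t (fun u v => ev s (fun u' v' => f u v u' v')) =
  ev s (fun u' v' => ev t (fun u v => f u v u' v')) :> X.
Proof. by rewrite ev.unlock exchange_big. Qed.

Lemma scaler_ev U V X (c : K) (t : tensor U V) (f : U -> V -> X) :
  c *: ev t f = ev t (fun u v => c *: f u v).
Proof. by rewrite ev.unlock scaler_sumr. Qed.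

Lemma ev_scalel U V X (t : tensor U V) (s : U -> V -> K) (v : X) :
  (ev t (s : U -> V -> K^o) : K) *: v = ev t (fun x y => s x y *: v).
Proof. by rewrite ev.unlock scaler_suml. Qed.

Lemma ev_ind U V X (Q : X -> Prop) (t : tensor U V) (f : U -> V -> X) :
  Q 0 -> (forall x y, Q x -> Q y -> Q (x + y)) -> (forall u v, Q (f u v)) ->
  Q (ev t f).
Proof. by move=> Q0 QD Qf; rewrite ev.unlock; apply: big_ind. Qed.

Lemma ev_id U V (t : tensor U V) : ev t (@tens K U V) = t.
Proof. by rewrite ev.unlock -repE. Qed.

(** Taking f to be the tensor itself recovers s and t. This is the universal property in the form in
    which identities between coactions are checked below: both sides are evaluated on an arbitrary
    bilinear map. *)
Lemma tensor_ext U V (s t : tensor U V) :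
  (forall (X : lmodType K) (f : U -> V -> X), bilin f -> ev s f = ev t f) -> s = t.
Proof. by move=> st; rewrite -[s]ev_id -[t]ev_id; apply/st/bilin_tens. Qed.

End SweedlerSums.

Create HintDb lin discriminated.

Tactic Notation "lin_apply" uconstr(X) := solve [ simple refine X
  | simple refine (X _); assumption | simple refine (X _ _); assumption
  | simple refine (X _ _ _); assumption | simple refine (X _ _ _ _); assumption ].

Ltac lin_fact :=
  match goal with
  | H : lin ?f |- lin ?g => constr_eq f g; exact H
  | H : bilin ?f |- bilin ?g => constr_eq f g; exact H
  | H : trilin ?f |- trilin ?g => constr_eq f g; exact H
  | |- lin (@GRing.Linear.sort _ _ _ _ _) => first [exact: lin_linear | exact: lin_scalar]
  | |- lin (fun x => @GRing.Linear.sort _ _ _ _ _ x) => first [exact: lin_linear |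
    exact: lin_scalar]
  | |- bilin (@tens _ _ _) => exact: bilin_tens
  | |- _ => solve [repeat match goal with
      | H : bilin _ |- _ => clear H | H : trilin _ |- _ => clear H
      | H : lin _ |- _ => clear H end; eauto 3 with lin nocore]
  end.

(* [lin] follows the syntax of the abstracted term; elementary facts are taken
   from the context or from the hint database [lin]. *)
Ltac lin_step :=
  match goal with
  | H : lin ?f |- lin ?g => constr_eq f g; exact H
  | H : bilin ?f |- bilin ?g => constr_eq f g; exact H
  | H : trilin ?f |- trilin ?g => constr_eq f g; exact H
  | |- @bilin _ _ _ ?W ?f => first [lin_fact | refine (@bilinI _ _ _ W f _ _); intros
    ?; cbv beta]
  | |- trilin _ => first [lin_fact | split=> [?|? ?]; cbv beta]
  | |- linear ?f => change (lin f)
  | |- GRing.linear_for _ ?f => change (lin f)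
  | |- lin (fun x => x) => exact: lin_id
  | |- @lin _ _ ?W (fun x => ev ?t (@?b x)) => refine (@lin_ev_fun _ _ _ _ W t b _);
    intros ? ?; cbv beta
  | |- @lin _ _ ?W (fun x => ev (@?t x) ?f) => refine (@lin_ev_arg _ _ _ _ W t f _ _)
  | |- @lin _ _ ?W (fun x => GRing.scale ?c (@?b x)) => refine (@lin_scale _ _ W c b _)
  | |- @lin _ _ ?W (fun x => GRing.scale (@?s x) ?v) => refine (@lin_scalel _ _ W s v _)
  | |- lin (fun x => GRing.mul ?c (@?b x)) => refine (@lin_mulr _ _ b c _)
  | |- lin (fun x => GRing.mul (@?b x) ?c) => refine (@lin_mull _ _ b c _)
  | |- @lin _ _ ?W (fun x => GRing.add (@?b x) (@?c x)) => refine (@lin_add _ _ W b c _ _)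
  | |- @lin _ _ ?W (fun x => GRing.opp (@?b x)) => refine (@lin_opp _ _ W b _)
  | |- lin (fun x => ?f x) => change (lin f)
  | |- @lin _ _ ?W (fun x => ?f (@?b x)) => refine (@lin_comp _ _ _ W f b _ _)
  | |- @lin _ _ ?W (fun x => ?f (@?b x) ?c) =>
      refine (@lin_comp _ _ _ W (fun y => f y c) b _ _);
      [ refine (@bilin_lin1 _ _ _ W f _ c); lin_fact | ]
  | |- @lin _ _ ?W (fun x => ?f ?u (@?b x) ?c) =>
      refine (@lin_comp _ _ _ W (fun y => f u y c) b _ _);
      [ refine (@trilin_lin2 _ _ _ _ W f _ u c); lin_fact | ]
  | |- @lin _ _ ?W (fun x => ?f (@?b x) ?c ?d) =>
      refine (@lin_comp _ _ _ W (fun y => f y c d) b _ _);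
      [ refine (@trilin_lin1 _ _ _ _ W f _ c d); lin_fact | ]
  | |- @lin _ _ ?W (?f ?c) => refine (@bilin_lin2 _ _ _ W f _ c); lin_fact
  | |- @lin _ _ ?W (?f ?c ?d) => refine (@trilin_lin3 _ _ _ _ W f _ c d); lin_fact
  | |- lin _ => lin_fact
  end.
Ltac lin := repeat lin_step.

(** * Maps of tensor products, and coassociativity in Sweedler form *)

Section TensorMaps.
Context {K : fieldType}.
Implicit Types U V W X M N P C : lmodType K.

Lemma ev_ev U V U' V' X (t : tensor U V) (f : U -> V -> tensor U' V')
    (h : U' -> V' -> X) :
  bilin h -> ev (ev t f) h = ev t (fun u v => ev (f u v) h).
Proof. by move=> bh; apply: (@lin_ev _ _ _ _ _ (fun s => ev s h)); lin. Qed.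

Lemma tmap_ev M N M' N' (f : M -> M') (g : N -> N') t : lin f -> lin g ->
  tmap f g t = ev t (fun m n => f m \ox g n).
Proof. by move=> Lf Lg; rewrite /tmap tlift_ev //; lin. Qed.

Lemma ev_tmap M N M' N' X (f : M -> M') (g : N -> N') (h : M' -> N' -> X) t :
  lin f -> lin g -> bilin h -> ev (tmap f g t) h = ev t (fun m n => h (f m) (g n)).
Proof.
move=> Lf Lg bh; rewrite tmap_ev // ev_ev //.
by apply: eq_ev => u v; rewrite ev_tens.
Qed.

Lemma tmap_lin M N M' N' (f : M -> M') (g : N -> N') :
  lin f -> lin g -> lin (tmap f g).
Proof. by move=> Lf Lg; apply: tlift_lin; lin. Qed.

Lemma tprod_ev M N M' N' M'' N'' (f : M -> M' -> M'') (g : N -> N' -> N'') s t :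
  bilin f -> bilin g ->
  tprod f g s t = ev s (fun m n => ev t (fun m' n' => f m m' \ox g n n')).
Proof.
move=> bf bg; rewrite /tprod tlift_ev; last first.
  apply: (@eq_bilin _ _ _ _ _ (fun m n => ev t (fun m' n' => f m m' \ox g n n'))).
    by move=> m n; rewrite tlift_ev //; lin.
  by lin.
by apply: eq_ev => m n; rewrite tlift_ev //; lin.
Qed.

Lemma ev_tprod M N M' N' M'' N'' X (f : M -> M' -> M'') (g : N -> N' -> N'')
    (h : M'' -> N'' -> X) s t : bilin f -> bilin g -> bilin h ->
  ev (tprod f g s t) h
  = ev s (fun m n => ev t (fun m' n' => h (f m m') (g n n'))).
Proof.
move=> bf bg bh; rewrite tprod_ev // ev_ev //.
apply: eq_ev => m n; rewrite ev_ev //.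
by apply: eq_ev => m' n'; rewrite ev_tens.
Qed.

Lemma tprod_bilin M N M' N' M'' N'' (f : M -> M' -> M'') (g : N -> N' -> N'') :
  bilin f -> bilin g -> bilin (tprod f g).
Proof.
move=> bf bg; apply: (eq_bilin (fun s t => tprod_ev s t bf bg)).
by lin.
Qed.

Lemma tassoc_ev M N P (t : tensor (tensor M N) P) :
  tassoc t = ev t (fun s p => ev s (fun m n => m \ox (n \ox p))).
Proof.
rewrite /tassoc tlift_ev; last first.
  apply: (@eq_bilin _ _ _ _ _ (fun s p => ev s (fun m n => m \ox (n \ox p)))).
    by move=> s p; rewrite tlift_ev //; lin.
  by lin.
by apply: eq_ev => s p; rewrite tlift_ev //; lin.
Qed.

Lemma ev_tassoc M N P X (t : tensor (tensor M N) P) (F : M -> N -> P -> X) :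
  trilin F ->
  ev (tassoc t) (fun m s => ev s (fun n p => F m n p))
  = ev t (fun s p => ev s (fun m n => F m n p)).
Proof.
move=> tF; rewrite tassoc_ev ev_ev; last by lin.
apply: eq_ev => s p; rewrite ev_ev; last by lin.
by apply: eq_ev => m n; rewrite ev_tens ?ev_tens //; lin.
Qed.

Definition tswap M N (t : tensor M N) : tensor N M := ev t (fun m n => n \ox m).

Lemma tswap_lin M N : lin (@tswap M N).
Proof. by rewrite /tswap; lin. Qed.

Lemma ev_tswap M N X (t : tensor M N) (f : N -> M -> X) : bilin f ->
  ev (tswap t) f = ev t (fun m n => f n m).
Proof.
move=> bf; rewrite /tswap ev_ev //.
by apply: eq_ev => m n; rewrite ev_tens.
Qed.

(** Tested on trilinear maps, so that no reassociation of triple tensors appears. [D] is kept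
    arbitrary to cover the coproduct and its opposite alike. *)
Definition coassociative C M (D : C -> tensor C C) (l : M -> tensor C M) : Prop :=
  forall X (F : C -> C -> M -> X), trilin F -> forall m,
    ev (l m) (fun x m0 => ev (l m0) (fun y m1 => F x y m1))
    = ev (l m) (fun x m0 => ev (D x) (fun x1 x2 => F x1 x2 m0)).

Lemma coassociativeP C M (D : C -> tensor C C) (l : M -> tensor C M) :
  lin D -> lin l ->
  (forall m, tassoc (tmap D id (l m)) = tmap id l (l m)) -> coassociative D l.
Proof.
move=> LD Ll H X F tF m.
have /esym := congr1 (fun t => ev t (fun x s => ev s (fun y m => F x y m))) (H m).
rewrite ev_tmap; try lin.
by rewrite ev_tassoc // ev_tmap; lin.
Qed.

(** Swapping the legs makes a right comodule a left comodule over the co-opposite coalgebra, so that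
    the results on twists need be proved for left coactions only. *)
Lemma coassociativeP_right C M (D : C -> tensor C C) (r : M -> tensor M C) :
  lin D -> lin r ->
  (forall m, tassoc (tmap r id (r m)) = tmap id D (r m)) ->
  coassociative (fun c => tswap (D c)) (fun m => tswap (r m)).
Proof.
move=> LD Lr H X F tF m.
have := congr1 (fun t => ev t (fun m s => ev s (fun x y => F y x m))) (H m).
have Ls := tswap_lin.
rewrite ev_tassoc; last by split=> [?|? ?]; lin.
rewrite !ev_tmap; try lin.
rewrite ev_tswap; last by lin.
rewrite ev_tswap; last by lin.
move=> E; apply: etrans (etrans E _); last first.
  by apply: eq_ev => m0 c; rewrite ev_tswap //; lin.
by apply: eq_ev => m0 c; rewrite ev_tswap //; lin.
Qed.

End TensorMaps.
#[global] Hint Extern 0 (lin (tswap (M := _) (N := _))) => lin_apply tswap_lin : lin.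

(** * Bicovariant bimodules *)

(** The part of the Hopf structure that is re-established for the deformed algebra; lemmas that need
    an antipode take it as a separate hypothesis. *)
Definition bialgebra (K : fieldType) (A : @bialg_data K) : Prop :=
  [/\ algebra_axioms A, coalgebra_axioms A & bialgebra_axioms A].

Section HopfTheory.
Context {K : fieldType} {A : @bialg_data K}.
Hypothesis HA : bialgebra A.
Local Notation "a *A b" := (bmul a b) (at level 40, left associativity).
Local Notation "1A" := (bone A).
Implicit Types (a b c : A) (X : lmodType K).

Lemma bmul_bilin : bilin (@bmul K A).
Proof. by case: HA => [[]]. Qed.
Hint Extern 0 (bilin (@bmul _ _)) => lin_apply bmul_bilin : lin.

Lemma bmulA a b c : a *A (b *A c) = a *A b *A c.
Proof. by case: HA => [[]]. Qed.

Lemma bmul1 a : 1A *A a = a.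
Proof. by case: HA => [[]]. Qed.

Lemma bmulr1 a : a *A 1A = a.
Proof. by case: HA => [[]]. Qed.

Lemma eps_mul a b : eps A (a *A b) = eps A a * eps A b.
Proof. by case: HA => [_ _ []]. Qed.

Lemma eps1 : eps A 1A = 1.
Proof. by case: HA => [_ _ []]. Qed.

Lemma cop_coassociative : coassociative (cop A) (cop A).
Proof. by case: HA => [_ [? _ _] _]; apply: coassociativeP => //; lin. Qed.

Lemma cop_coassoc X (F : A -> A -> A -> X) a : trilin F ->
  ev (cop A a) (fun x b => ev (cop A b) (fun y z => F x y z))
  = ev (cop A a) (fun b z => ev (cop A b) (fun x y => F x y z)).
Proof. by move=> tF; apply: cop_coassociative. Qed.

Lemma cop_counitl X (f : A -> X) a : lin f ->
  ev (cop A a) (fun x y => eps A x *: f y) = f a.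
Proof.
move=> Lf; case: HA => [_ [_ e _] _].
rewrite -[in RHS](e a) tlift_ev; last by lin.
by rewrite lin_ev //; apply: eq_ev => x y; rewrite linZ.
Qed.

Lemma cop_counitr X (f : A -> X) a : lin f ->
  ev (cop A a) (fun x y => eps A y *: f x) = f a.
Proof.
move=> Lf; case: HA => [_ [_ _ e] _].
rewrite -[in RHS](e a) tlift_ev; last by lin.
by rewrite lin_ev //; apply: eq_ev => x y; rewrite linZ.
Qed.

Lemma ev_cop_mul X (f : A -> A -> X) a b : bilin f ->
  ev (cop A (a *A b)) f
  = ev (cop A a) (fun a1 a2 => ev (cop A b) (fun b1 b2 => f (a1 *A b1) (a2 *A b2))).
Proof.
by move=> bf; case: HA => [_ _ [-> _ _ _]]; rewrite ev_tprod //; lin.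
Qed.

Lemma ev_cop1 X (f : A -> A -> X) : bilin f -> ev (cop A 1A) f = f 1A 1A.
Proof. by move=> bf; case: HA => [_ _ [_ -> _ _]]; rewrite ev_tens. Qed.

Variable S : {linear A -> A}.
Hypothesis HS : antipode S.

Lemma antipodel X (f : A -> X) a : lin f ->
  ev (cop A a) (fun x y => f (S x *A y)) = eps A a *: f 1A.
Proof.
move=> Lf; case: HS => [e _]; rewrite -linZ // -e tlift_ev ?lin_ev //.
by lin.
Qed.

Lemma antipoder X (f : A -> X) a : lin f ->
  ev (cop A a) (fun x y => f (x *A S y)) = eps A a *: f 1A.
Proof.
move=> Lf; case: HS => [_ e]; rewrite -linZ // -e tlift_ev ?lin_ev //.
by lin.
Qed.

Lemma antipode1 : S 1A = 1A.
Proof.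
have := @antipodel A id 1A (@lin_id _ _); rewrite ev_cop1; last by lin.
by rewrite eps1 scale1r bmulr1.
Qed.

(** Uniqueness of the convolution inverse of the product. [H] is S(a_1 b_1) a_2 b_2 S(b_3) S(a_3):
    collapsing its last factors leaves S(ab), collapsing its first factors leaves S(b) S(a). *)
Lemma antipode_mul a b : S (a *A b) = S b *A S a.
Proof.
pose H a1 a2 a3 b1 b2 b3 := S (a1 *A b1) *A (a2 *A (b2 *A S b3) *A S a3).
transitivity (ev (cop A a) (fun a1 a' => ev (cop A b) (fun b1 b' =>
  ev (cop A a') (fun a2 a3 => ev (cop A b') (fun b2 b3 => H a1 a2 a3 b1 b2 b3))))).
  rewrite -[LHS](cop_counitr (f := fun a => S (a *A b))); last by lin.
  apply: eq_ev => a1 a'.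
  rewrite -[S _](cop_counitr (f := fun b => S (a1 *A b))); last by lin.
  rewrite scaler_ev; apply: eq_ev => b1 b'; rewrite /H.
  under eq_ev => a2 a3.
    rewrite (antipoder (f := fun u => S (a1 *A b1) *A (a2 *A u *A S a3))); last by lin.
    rewrite bmulr1; over.
  rewrite -scaler_ev (antipoder (f := fun u => S (a1 *A b1) *A u)); last by lin.
  by rewrite bmulr1 !scalerA mulrC.
transitivity (ev (cop A a) (fun a' a3 => ev (cop A b) (fun b' b3 =>
  ev (cop A a') (fun a1 a2 => ev (cop A b') (fun b1 b2 => H a1 a2 a3 b1 b2 b3))))).
  under eq_ev => a1 a' do rewrite exch_ev.
  rewrite cop_coassoc; last by rewrite /H; lin.
  apply: eq_ev => a' a3.
  under eq_ev => a1 a2.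
    rewrite cop_coassoc; last by rewrite /H; lin.
    over.
  by rewrite exch_ev.
have HE a' b' a3 b3 : ev (cop A a') (fun a1 a2 => ev (cop A b') (fun b1 b2 =>
    H a1 a2 a3 b1 b2 b3)) = eps A a' *: (eps A b' *: (S b3 *A S a3)).
  transitivity (ev (cop A (a' *A b')) (fun x y => S x *A y *A (S b3 *A S a3))).
    rewrite ev_cop_mul; last by lin.
    by do 2!apply: eq_ev => ? ?; rewrite /H !bmulA.
  rewrite (antipodel (f := fun u => u *A (S b3 *A S a3))); last by lin.
  by rewrite bmul1 eps_mul -scalerA.
under eq_ev => a' a3.
  under eq_ev => b' b3 do rewrite HE.
  rewrite -scaler_ev (cop_counitl (f := fun b => S b *A S a3)); last by lin.
  over.
by rewrite (cop_counitl (f := fun a => S b *A S a)); last by lin.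
Qed.

(** Uniqueness of a convolution inverse again, now of the coproduct: Delta(S(a_1)) Delta(a_2)
    (S(a_4) (x) S(a_3)) is collapsed from the right and from the left. The helper [h] is
    multiplication by the last factor, followed by f. *)
Lemma ev_cop_antipode X (f : A -> A -> X) a : bilin f ->
  ev (cop A (S a)) f = ev (cop A a) (fun x y => f (S y) (S x)).
Proof.
move=> bf.
pose h c p q := ev (cop A c) (fun c1 c2 => f (p *A S c2) (q *A S c1)).
have th : trilin h by rewrite /h; lin.
have hE (X' : lmodType K) (g : A -> A -> X') c : bilin g -> ev (cop A c) (fun b c => ev
  (cop A b) (fun b1 b2 =>
    ev (cop A c) (fun c1 c2 => g (b1 *A S c2) (b2 *A S c1)))) = eps A c *: g 1A 1A.
  move=> bg; rewrite -cop_coassoc; last by lin.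
  under eq_ev => b1 d.
    rewrite cop_coassoc; last by lin.
    under eq_ev => e c2.
      rewrite (antipoder (f := fun u => g (b1 *A S c2) u)); last by lin.
      over.
    rewrite (cop_counitl (f := fun c => g (b1 *A S c) 1A)); last by lin.
    over.
  by rewrite (antipoder (f := fun u => g u 1A)); last by lin.
transitivity (ev (cop A a) (fun a1 a' => ev (cop A a') (fun b c =>
    ev (cop A (S a1)) (fun p q => ev (cop A b) (fun b1 b2 => h c (p *A b1) (q *A b2)))))).
  rewrite -[LHS](cop_counitr (f := fun u => ev (cop A (S u)) f)); last by lin.
  apply: eq_ev => a1 a'; rewrite scaler_ev exch_ev; apply: eq_ev => p q.
  rewrite /h -[p in LHS]bmulr1 -[q in LHS]bmulr1.
  rewrite -(hE _ (fun u v => f (p *A u) (q *A v))); last by lin.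
  by do 3!apply: eq_ev => ? ?; rewrite !bmulA.
rewrite cop_coassoc; last by lin.
have hE' e c : ev (cop A e) (fun a1 b => ev (cop A (S a1)) (fun p q =>
    ev (cop A b) (fun b1 b2 => h c (p *A b1) (q *A b2)))) = eps A e *: h c 1A 1A.
  rewrite -(ev_cop1 (f := h c)); last by lin.
  rewrite -(antipodel (f := fun u => ev (cop A u) (h c))); last by lin.
  by apply: eq_ev => a1 b; rewrite ev_cop_mul; last by lin.
under eq_ev => e c do rewrite hE'.
rewrite (cop_counitl (f := fun c => h c 1A 1A)); last by lin.
by rewrite /h; apply: eq_ev => x y; rewrite !bmul1.
Qed.

End HopfTheory.
#[global] Hint Extern 0 (bilin (@bmul _ _)) => lin_apply bmul_bilin : lin.

Section Bimodule.
Context {K : fieldType} {A : @bialg_data K} {E : calculus_data A}.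
Hypothesis HA : bialgebra A.
Hypothesis HE : bicovariant_bimodule E.
Local Notation "a *A b" := (bmul a b) (at level 40, left associativity).
Local Notation "1A" := (bone A).
Local Notation "a *> m" := (lact a m) (at level 38, right associativity).
Local Notation "m <* a" := (ract m a) (at level 39, left associativity).
Local Notation l := (lcoact E).
Local Notation r := (rcoact E).
Implicit Types (a b c : A) (m n : E) (X : lmodType K).

Lemma lact_bilin : bilin (@lact K A E).
Proof. by case: HE => [[[]]]. Qed.

Lemma ract_bilin : bilin (@ract K A E).
Proof. by case: HE => [[[]]]. Qed.
Hint Extern 0 (bilin (@lact _ _ _)) => lin_apply lact_bilin : lin.
Hint Extern 0 (bilin (@ract _ _ _)) => lin_apply ract_bilin : lin.

Lemma lact1 m : 1A *> m = m.
Proof. by case: HE => [[_ /(_ m) []]]. Qed.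

Lemma ract1 m : m <* 1A = m.
Proof. by case: HE => [[_ /(_ m) []]]. Qed.

Lemma lactA a b m : a *> b *> m = (a *A b) *> m.
Proof. by case: HE => [[]]. Qed.

Lemma ractA m a b : m <* a <* b = m <* (a *A b).
Proof. by case: HE => [[]]. Qed.

Lemma lractA a m b : (a *> m) <* b = a *> (m <* b).
Proof. by case: HE => [[]]. Qed.

Lemma lcoact_coassociative : coassociative (cop A) l.
Proof. by case: HE => [_ [? _ _ _] _ _]; apply: coassociativeP => //; lin. Qed.

Lemma rcoact_coassociative :
  coassociative (fun a => tswap (cop A a)) (fun m => tswap (r m)).
Proof. by case: HE => [_ _ [? _ _ _] _]; apply: coassociativeP_right => //; lin. Qed.

Lemma rcoact_coassoc X (F : E -> A -> A -> X) m : trilin F ->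
  ev (r m) (fun m0 y => ev (r m0) (fun m1 x => F m1 x y))
  = ev (r m) (fun m0 y => ev (cop A y) (fun y1 y2 => F m0 y1 y2)).
Proof.
move=> tF; case: HE => [_ _ [H _ _ _] _].
have := congr1 (fun t => ev t (fun m s => ev s (fun x y => F m x y))) (H m).
by rewrite ev_tassoc // !ev_tmap //; lin.
Qed.

Lemma lcoact_counit X (f : E -> X) m : lin f ->
  ev (l m) (fun x m0 => eps A x *: f m0) = f m.
Proof.
move=> Lf; case: HE => [_ [_ e _ _] _ _].
rewrite -[in RHS](e m) tlift_ev; last by lin.
by rewrite lin_ev //; apply: eq_ev => x y; rewrite linZ.
Qed.

Lemma rcoact_counit X (f : E -> X) m : lin f ->
  ev (r m) (fun m0 y => eps A y *: f m0) = f m.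
Proof.
move=> Lf; case: HE => [_ _ [_ e _ _] _].
rewrite -[in RHS](e m) tlift_ev; last by lin.
by rewrite lin_ev //; apply: eq_ev => x y; rewrite linZ.
Qed.

Lemma ev_lcoact_lact X (f : A -> E -> X) a m : bilin f ->
  ev (l (a *> m)) f
  = ev (cop A a) (fun a1 a2 => ev (l m) (fun x m0 => f (a1 *A x) (a2 *> m0))).
Proof. by move=> bf; case: HE => [_ [_ _ -> _] _ _]; rewrite ev_tprod //; lin. Qed.

Lemma ev_lcoact_ract X (f : A -> E -> X) m a : bilin f ->
  ev (l (m <* a)) f
  = ev (l m) (fun x m0 => ev (cop A a) (fun a1 a2 => f (x *A a1) (m0 <* a2))).
Proof. by move=> bf; case: HE => [_ [_ _ _ ->] _ _]; rewrite ev_tprod //; lin. Qed.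

Lemma ev_rcoact_lact X (f : E -> A -> X) a m : bilin f ->
  ev (r (a *> m)) f
  = ev (cop A a) (fun a1 a2 => ev (r m) (fun m0 y => f (a1 *> m0) (a2 *A y))).
Proof. by move=> bf; case: HE => [_ _ [_ _ -> _] _]; rewrite ev_tprod //; lin. Qed.

Lemma ev_rcoact_ract X (f : E -> A -> X) m a : bilin f ->
  ev (r (m <* a)) f
  = ev (r m) (fun m0 y => ev (cop A a) (fun a1 a2 => f (m0 <* a1) (y *A a2))).
Proof. by move=> bf; case: HE => [_ _ [_ _ _ ->] _]; rewrite ev_tprod //; lin. Qed.

Lemma coact_comm X (F : A -> E -> A -> X) m : trilin F ->
  ev (l m) (fun x m0 => ev (r m0) (fun m1 y => F x m1 y))
  = ev (r m) (fun m0 y => ev (l m0) (fun x m1 => F x m1 y)).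
Proof.
move=> tF; case: HE => [_ _ _ H].
have := congr1 (fun t => ev t (fun x s => ev s (fun m y => F x m y))) (H m).
by rewrite ev_tassoc // !ev_tmap //; lin.
Qed.

Lemma ev_linv X (f : A -> E -> X) v : is_linv E v -> bilin f ->
  ev (l v) f = f 1A v.
Proof. by move=> -> bf; rewrite ev_tens. Qed.

Lemma ev_rinv X (f : E -> A -> X) h : is_rinv E h -> bilin f ->
  ev (r h) f = f h 1A.
Proof. by move=> -> bf; rewrite ev_tens. Qed.

Variable S : {linear A -> A}.
Hypothesis HS : antipode S.

Definition lproj_inv m : E := ev (l m) (fun x m0 => S x *> m0).
Definition rproj_inv m : E := ev (r m) (fun m0 y => m0 <* S y).
Local Notation P := lproj_inv.
Local Notation P' := rproj_inv.

Lemma lproj_inv_lin : lin P. Proof. by rewrite /P; lin. Qed.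
Lemma rproj_inv_lin : lin P'. Proof. by rewrite /P'; lin. Qed.
Hint Extern 0 (lin lproj_inv) => lin_apply lproj_inv_lin : lin.
Hint Extern 0 (lin rproj_inv) => lin_apply rproj_inv_lin : lin.

(** The coaction of S(x) m_0 is Delta(S(x_1)) (x_2 (x) m_0). Inserting x_3 S(x_4) in the second leg
    makes it Delta(S(x_1)) Delta(x_2) (1 (x) S(x_3) m_0), and the first two factors collapse to 1
    (x) 1. *)
Lemma lproj_inv_linv m : is_linv E (P m).
Proof.
apply: tensor_ext => X f bf; rewrite ev_tens //.
rewrite [f 1A _](lin_ev (g := f 1A)); last by lin.
pose h z m0 p q := f p (q *> (S z *> m0)).
transitivity (ev (l m) (fun x m0 => ev (cop A x) (fun x1 x' =>
  ev (cop A x') (fun x2 x3 => ev (cop A (S x1)) (fun p q =>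
    ev (cop A x2) (fun u v => h x3 m0 (p *A u) (q *A v))))))).
  rewrite {1}/P (lin_ev (g := fun n => ev (l n) f)); last by lin.
  under eq_ev => x m0.
    rewrite ev_lcoact_lact // exch_ev; over.
  rewrite lcoact_coassociative; last by split=> [?|? ?]; lin.
  do 2!apply: eq_ev => ? ?; rewrite [RHS]exch_ev; apply: eq_ev => p q.
  rewrite /h -cop_coassoc //; last by lin.
  under [RHS]eq_ev => u d.
    under eq_ev => v z do rewrite lactA -bmulA //.
    rewrite (antipoder HA HS (f := fun w => f (p *A u) ((q *A w) *> _))); last by lin.
    rewrite bmulr1 //; over.
  by rewrite (cop_counitr HA (f := fun w => f (p *A w) _)); last by lin.
apply: eq_ev => x m0; rewrite cop_coassoc //; last by rewrite /h; lin.
have hE e c : ev (cop A e) (fun a1 b => ev (cop A (S a1)) (fun p q =>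
    ev (cop A b) (fun b1 b2 => h c m0 (p *A b1) (q *A b2)))) = eps A e *: h c m0 1A 1A.
  rewrite -(ev_cop1 HA (f := h c m0)); last by rewrite /h; lin.
  rewrite -(antipodel HA HS (f := fun u => ev (cop A u) (h c m0))); last by rewrite /h;
    lin.
  by apply: eq_ev => a1 b; rewrite ev_cop_mul //; rewrite /h; lin.
under eq_ev => e c do rewrite hE.
rewrite (cop_counitl HA (f := fun c => h c m0 1A 1A)); last by rewrite /h; lin.
by rewrite /h lact1.
Qed.

Lemma lproj_inv_lact a m : P (a *> m) = eps A a *: P m.
Proof.
rewrite /P ev_lcoact_lact; last by lin.
rewrite exch_ev scaler_ev; apply: eq_ev => x m0.
under eq_ev => a1 a2 do rewrite lactA (antipode_mul HA HS) -bmulA //.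
rewrite (antipodel HA HS (f := fun w => (S x *A w) *> m0)); last by lin.
by rewrite bmulr1.
Qed.

Lemma lproj_invK X (f : E -> X) m : lin f ->
  ev (l m) (fun x m0 => f (x *> P m0)) = f m.
Proof.
move=> Lf; rewrite /P; under eq_ev => x m0.
  rewrite (lin_ev (g := fun n => f (x *> n))); last by lin.
  over.
rewrite lcoact_coassociative; last by lin.
under eq_ev => x m0.
  under eq_ev => x1 x2 do rewrite lactA.
  rewrite (antipoder HA HS (f := fun w => f (w *> m0))); last by lin.
  rewrite lact1; over.
exact: lcoact_counit.
Qed.

Lemma lproj_inv_id v : is_linv E v -> P v = v.
Proof. by move=> Iv; rewrite /P ev_linv //; [rewrite (antipode1 HA HS) lact1 | lin]. Qed.

(** Write m = x P(m_0); P sees the left factor x only through its counit. Consequently v <| a = P(v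
    a) is a right action on the left-invariants. *)
Lemma lproj_inv_ract m a : P (m <* a) = P (P m <* a).
Proof.
rewrite -[in LHS](lproj_invK (f := id) m) //.
rewrite (lin_ev (g := fun n => P (n <* a))); last by lin.
under eq_ev => x m0 do rewrite lractA lproj_inv_lact.
by rewrite (lcoact_counit (f := fun n => P (P n <* a))); last by lin.
Qed.

(** The two coactions commute, so the right coaction sends a left-invariant element into 0E (x) A,
    where P acts as the identity. *)
Lemma ev_rcoact_linv X (f : E -> A -> X) v : is_linv E v -> bilin f ->
  ev (r v) (fun v0 y => f (P v0) y) = ev (r v) f.
Proof.
move=> Iv bf; rewrite /P; under eq_ev => v0 y.
  rewrite (lin_ev (g := fun n => f n y)); last by lin.
  over.
rewrite -coact_comm; last by lin.
rewrite ev_linv //; last by lin.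
by apply: eq_ev => v0 y; rewrite (antipode1 HA HS) lact1.
Qed.

Lemma rproj_inv_rinv m : is_rinv E (P' m).
Proof.
apply: tensor_ext => X f bf; rewrite ev_tens //.
rewrite [f _ 1A](lin_ev (g := f^~ 1A)); last by lin.
pose h z m0 p q := f (m0 <* S z <* p) q.
transitivity (ev (r m) (fun m0 x => ev (cop A x) (fun x' x3 =>
  ev (cop A x') (fun x1 x2 => ev (cop A (S x3)) (fun p q =>
    ev (cop A x2) (fun u v => h x1 m0 (u *A p) (v *A q))))))).
  rewrite {1}/P' (lin_ev (g := fun n => ev (r n) f)); last by lin.
  under eq_ev => m0 x do rewrite ev_rcoact_ract //.
  rewrite rcoact_coassoc; last by lin.
  apply: eq_ev => m0 x; apply: eq_ev => x' x3.
  rewrite [RHS]exch_ev; apply: eq_ev => p q.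
  rewrite /h cop_coassoc //; last by lin.
  under [RHS]eq_ev => d v.
    under eq_ev => z u do rewrite !ractA bmulA //.
    rewrite (antipodel HA HS (f := fun w => f (m0 <* (w *A p)) (v *A q))); last by lin.
    rewrite bmul1 //; over.
  by rewrite (cop_counitl HA (f := fun w => f _ (w *A q))); last by lin.
apply: eq_ev => m0 x; rewrite -cop_coassoc //; last by rewrite /h; lin.
have hE e c : ev (cop A e) (fun b a1 => ev (cop A (S a1)) (fun p q =>
    ev (cop A b) (fun b1 b2 => h c m0 (b1 *A p) (b2 *A q)))) = eps A e *: h c m0 1A 1A.
  rewrite -(ev_cop1 HA (f := h c m0)); last by rewrite /h; lin.
  rewrite -(antipoder HA HS (f := fun u => ev (cop A u) (h c m0))); last by rewrite /h;
    lin.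
  apply: eq_ev => a1 b; rewrite ev_cop_mul //; last by rewrite /h; lin.
  by rewrite exch_ev.
under eq_ev => c e do rewrite hE.
rewrite (cop_counitr HA (f := fun c => h c m0 1A 1A)); last by rewrite /h; lin.
by rewrite /h ract1.
Qed.

Lemma rproj_invK X (f : E -> X) m : lin f ->
  ev (r m) (fun m0 y => f (P' m0 <* y)) = f m.
Proof.
move=> Lf; rewrite /P'; under eq_ev => m0 y.
  rewrite (lin_ev (g := fun n => f (n <* y))); last by lin.
  over.
rewrite rcoact_coassoc; last by lin.
under eq_ev => m0 y.
  under eq_ev => y1 y2 do rewrite ractA.
  rewrite (antipodel HA HS (f := fun w => f (m0 <* w))); last by lin.
  rewrite ract1; over.
exact: rcoact_counit.
Qed.

Lemma ev_lcoact_rinv X (f : A -> E -> X) h : is_rinv E h -> bilin f ->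
  ev (l h) (fun x h0 => f x (P' h0)) = ev (l h) f.
Proof.
move=> Ih bf; rewrite /P'; under eq_ev => x h0.
  rewrite (lin_ev (g := f x)); last by lin.
  over.
rewrite coact_comm; last by lin.
rewrite ev_rinv //; last by lin.
by apply: eq_ev => v0 y; rewrite (antipode1 HA HS) ract1.
Qed.

End Bimodule.
#[global] Hint Extern 0 (bilin (@lact _ _ _)) => lin_apply lact_bilin : lin.
#[global] Hint Extern 0 (bilin (@ract _ _ _)) => lin_apply ract_bilin : lin.
#[global] Hint Extern 0 (lin (lproj_inv _)) => lin_apply lproj_inv_lin : lin.
#[global] Hint Extern 0 (lin (rproj_inv _)) => lin_apply rproj_inv_lin : lin.

(** * The Drinfeld map of the left-invariants *)

Section Fitting.
Context {K : fieldType} {V : lmodType K}.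

Lemma iter_lin (f : V -> V) n : lin f -> lin (iter n f).
Proof. by move=> Lf; elim: n => [|n IHn] //=; apply: (lin_comp Lf IHn). Qed.

(** Cayley-Hamilton: if the characteristic polynomial is X^m (s X + c) with c nonzero, then M^m = N
    M^(m+1) for N = -c^-1 s(M). The map g is the same polynomial in f, hence defined and linear on
    all of V, commuting with f, and preserving Q. *)
Lemma fitting (Q : set V) (f : V -> V) : findim Q -> lin f ->
    (forall v, Q v -> Q (f v)) ->
  exists n g, [/\ lin g, forall v, Q v -> Q (g v), forall v, g (f v) = f (g v)
    & forall v, Q v -> iter n f v = iter n.+1 f (g v)].
Proof.
move=> [[|n] [e Qe]] Lf Qf.
  (* Without generators Q contains only 0; the matrix ring used below needs a positive size. *)
  exists 0, id; split=> // v /Qe [c ->]; rewrite big_ord0 /=.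
  by rewrite (lin_zero Lf).
pose phi (x : 'rV[K]_n.+1) := \sum_i x 0 i *: e i.
have Lphi : lin phi.
  by apply: lin_big => i a x y; rewrite !mxE scalerDl scalerA.
have Qphi x : Q (phi x) by apply/Qe; exists (fun i => x 0 i).
have phiP v : Q v -> exists x, v = phi x.
  move=> /Qe [c ->]; exists (\row_i c i).
  by apply: eq_bigr => i _; rewrite mxE.
have Q_e i : Q (e i).
  apply/Qe; exists (fun j => (j == i)%:R); rewrite (bigD1 i) //= eqxx scale1r.
  by rewrite big1 ?addr0 // => j /negbTE ->; rewrite scale0r.
(* The family e spans Q but may be dependent, so M is merely a chosen matrix with f(phi x) = phi(x
   M). *)
have /boolp.choice [M0 M0E] : forall i, exists x, f (e i) = phi x.
  by move=> i; apply: phiP; apply: Qf.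
pose M := \matrix_(i, j) M0 i 0 j.
have fphi x : f (phi x) = phi (x *m M).
  rewrite /phi (lin_sum Lf).
  under eq_bigr => i _ do rewrite (linZ Lf) M0E /phi scaler_sumr.
  rewrite exchange_big; apply: eq_bigr => j _ /=.
  rewrite mxE scaler_suml; apply: eq_bigr => i _.
  by rewrite mxE scalerA.
have fphin k x : iter k f (phi x) = phi (x *m M ^+ k).
  elim: k => [|k IHk] /=; first by rewrite expr0 mulmx1.
  by rewrite IHk fphi exprSr mulmxA.
have [m [q q0 pE]] := multiplicity_XsubC (char_poly M) 0.
have {}q0 : ~~ root q 0 by move: q0; rewrite monic_neq0 // char_poly_monic.
move: q0 pE; elim/poly_ind: q => [|s c _]; first by rewrite root0.
rewrite rootE !hornerE => c0; rewrite subr0 => pE.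
have := Cayley_Hamilton M; rewrite pE.
rewrite rmorphM rmorphXn rmorphD rmorphM /= horner_mx_X horner_mx_C.
move=> CH; pose N := - c^-1 *: horner_mx M s.
have MN : M ^+ m = N * M ^+ m.+1.
  move/eqP: CH; rewrite mulrDl addrC addr_eq0 => /eqP CH.
  rewrite /N exprS -scalerAl mulrA scaleNr -scalerN -CH.
  by rewrite -mulmxE mul_scalar_mx scalerA mulVf // scale1r.
have sM : horner_mx M s = \sum_(i < size s) s`_i *: M ^+ i.
  rewrite -[s in LHS]coefK poly_def raddf_sum /=; apply: eq_bigr => i _ /=.
  by rewrite linearZ /= rmorphXn /= horner_mx_X.
pose g v := \sum_(i < size s) (- c^-1 * s`_i) *: iter i f v.
have gphi x : g (phi x) = phi (x *m N).
  rewrite /g; under eq_bigr => i _ do rewrite fphin -(linZ Lphi).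
  rewrite -(lin_sum Lphi); congr phi.
  under eq_bigr => i _ do rewrite scalemxAr.
  rewrite -mulmx_sumr; congr (_ *m _); rewrite /N sM scaler_sumr.
  by apply: eq_bigr => i _; rewrite scalerA.
exists m, g; split.
- by apply: lin_big => i; apply/lin_scale/iter_lin.
- by move=> v /phiP [x ->]; rewrite gphi.
- move=> v; rewrite /g (lin_sum Lf); apply: eq_bigr => i _.
  by rewrite (linZ Lf) -iterS -iterSr.
by move=> v /phiP [x ->]; rewrite gphi -iterS !fphin -mulmxA [in LHS]MN mulmxE.
Qed.
End Fitting.

Section DrinfeldMap.
Context {K : fieldType} {A : @bialg_data K} {E : calculus_data A}.
Hypothesis HA : bialgebra A.
Hypothesis HE : bicovariant_bimodule E.
Variable S : {linear A -> A}.
Hypothesis HS : antipode S.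
Local Notation "a *A b" := (bmul a b) (at level 40, left associativity).
Local Notation "a *> m" := (lact a m) (at level 38, right associativity).
Local Notation "m <* a" := (ract m a) (at level 39, left associativity).
Local Notation r := (rcoact E).
Local Notation P := (lproj_inv (E := E) S).
Local Notation P' := (rproj_inv (E := E) S).
Implicit Types (a b c : A) (m n v w : E) (X : lmodType K).

Lemma lproj_ractA v a b : P (P (v <* a) <* b) = P (v <* (a *A b)).
Proof. by rewrite -(lproj_inv_ract HA HE HS) (ractA HE). Qed.

Lemma lproj_linv m : is_linv E (P m).
Proof. exact: (lproj_inv_linv HA HE HS). Qed.
Hint Resolve lproj_linv : core.

(* The Yetter-Drinfeld condition on the left-invariants, with the right action
   v <| a = P (v <* a). *)
Lemma yetter_drinfeld X (f : E -> A -> X) w a : is_linv E w -> bilin f ->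
  ev (r w) (fun w0 y => ev (cop A a) (fun a1 a2 => f (P (w0 <* a1)) (y *A a2)))
  = ev (cop A a) (fun a1 a2 => ev (r (P (w <* a2))) (fun m0 y => f m0 (a1 *A y))).
Proof.
move=> Iw bf; pose g m y := f (P m) y.
have bg : bilin g by rewrite /g; lin.
(* Both sides compute the right coaction of w a with P applied to its first leg: once directly, once
   after writing w a = a_1 P(w a_2). *)
transitivity (ev (r (w <* a)) g); first by rewrite (ev_rcoact_ract HA HE).
rewrite -(lproj_invK HA HE HS (f := fun n => ev (r n) g)); last by lin.
rewrite (ev_lcoact_ract HA HE); last by lin.
rewrite (ev_linv Iw); last by lin.
have H a1 n : ev (r (a1 *> P n)) g = ev (r (P n)) (fun m0 y => f m0 (a1 *A y)).
  rewrite (ev_rcoact_lact HA HE) // exch_ev.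
  rewrite -(ev_rcoact_linv HA HE HS (f := fun m0 y => f m0 (a1 *A y))) //; last by lin.
  apply: eq_ev => m0 y; rewrite /g.
  under eq_ev => b1 b2.
    rewrite (lproj_inv_lact HA HE HS) (linZ (f := f^~ _)); last by lin.
    over.
  by rewrite (cop_counitl HA (f := fun b => f (P m0) (b *A y))); last by lin.
by apply: eq_ev => a1 a2; rewrite (bmul1 HA) H.
Qed.

Definition drinfeld_map m : E := P (P' m).
Local Notation F := drinfeld_map.

Lemma drinfeld_map_lin : lin F. Proof. by rewrite /F; lin. Qed.
Hint Extern 0 (lin drinfeld_map) => lin_apply drinfeld_map_lin : lin.

Lemma drinfeld_map_linv m : is_linv E (F m).
Proof. exact: lproj_linv. Qed.
Hint Resolve drinfeld_map_linv : core.

(** The left-hand side applies S to a_1 y, with y the coefficient of the coaction of w <| a_2. The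
    Yetter-Drinfeld condition rewrites it as (w_0 <| a_1) <| S(w_1 a_2), where a_1 S(a_2)
    collapses. *)
Lemma drinfeld_map_cancel w a : is_linv E w ->
  ev (cop A a) (fun a1 a2 => P (F (P (w <* a2)) <* S a1)) = eps A a *: F w.
Proof.
move=> Iw.
transitivity (ev (cop A a) (fun a1 a2 => ev (r (P (w <* a2)))
    (fun m0 y => P (m0 <* S (a1 *A y))))).
  apply: eq_ev => a1 a2; rewrite -(lproj_inv_ract HA HE HS) /rproj_inv.
  rewrite (lin_ev (g := fun n => P (n <* S a1))); last by lin.
  by apply: eq_ev => m0 y; rewrite (ractA HE) (antipode_mul HA HS).
rewrite -(yetter_drinfeld a Iw (f := fun m y => P (m <* S y))); last by lin.
rewrite {1}/F /rproj_inv (lin_ev (g := P)) ?scaler_ev; last by lin.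
apply: eq_ev => w0 y.
under eq_ev => a1 a2.
  rewrite lproj_ractA (antipode_mul HA HS) (bmulA HA); over.
rewrite (antipoder HA HS (f := fun u => P (w0 <* (u *A S y)))); last by lin.
by rewrite (bmul1 HA).
Qed.

(** Evaluate F(w <| a_3) <| S(a_2) S^2(a_1) in two ways: S(a_2) S^2(a_1) = S(S(a_1) a_2) collapses,
    and so does F(w <| a_3) <| S(a_2) by [drinfeld_map_cancel]. *)
Lemma drinfeld_map_ract w a : is_linv E w ->
  F (P (w <* a)) = P (F w <* S (S a)).
Proof.
move=> Iw; transitivity (ev (cop A a) (fun a1 a' => ev (cop A a') (fun a2 a3 =>
    P (P (F (P (w <* a3)) <* S a2) <* S (S a1))))).
  rewrite cop_coassoc //; last by lin.
  under eq_ev => a' a3.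
    under eq_ev => a1 a2 do rewrite lproj_ractA -(antipode_mul HA HS).
    rewrite (antipodel HA HS (f := fun u => P (F (P (w <* a3)) <* S u))); last by lin.
    rewrite (antipode1 HA HS) (ract1 HE) (lproj_inv_id HA HE HS) //; over.
  by rewrite (cop_counitl HA (f := fun a => F (P (w <* a)))); last by lin.
under eq_ev => a1 a'.
  rewrite -(lin_ev (g := fun n => P (n <* S (S a1)))); last by lin.
  rewrite drinfeld_map_cancel // (linZ (f := fun n => P (n <* S (S a1)))); last by lin.
  over.
by rewrite (cop_counitr HA (f := fun a => P (F w <* S (S a)))); last by lin.
Qed.

(** P applied to the reconstruction P'(w_0) w_1 = w. It shows that the image of F generates 0E under
    the action <|. *)
Lemma drinfeld_map_coact w : is_linv E w ->
  ev (r w) (fun w0 y => P (F (P w0) <* y)) = w.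
Proof.
move=> Iw.
rewrite (ev_rcoact_linv HA HE HS (f := fun w0 y => P (F w0 <* y))) //; last by lin.
under eq_ev => w0 y do rewrite -(lproj_inv_ract HA HE HS).
rewrite (rproj_invK HA HE HS (f := P)); last by lin.
exact: (lproj_inv_id HA HE HS).
Qed.

End DrinfeldMap.

Section SquaredAntipode.
Context {K : fieldType} {A : @bialg_data K}.
Hypothesis HA : bialgebra A.
Variable S : {linear A -> A}.
Hypothesis HS : antipode S.
Local Notation "a *A b" := (bmul a b) (at level 40, left associativity).
Local Notation "1A" := (bone A).
Implicit Types (a b c : A) (X : lmodType K).

Definition antipode_iter k a : A := iter k (fun b => S (S b)) a.
Local Notation T := antipode_iter.

Lemma antipode_iter_lin k : lin (T k).
Proof. by apply: iter_lin; lin. Qed.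
Hint Extern 0 (lin (antipode_iter _)) => lin_apply antipode_iter_lin : lin.

Lemma antipode_iterS k a : T k.+1 a = T k (S (S a)).
Proof. exact: iterSr. Qed.

Lemma antipode_iter_mul k a b : T k (a *A b) = T k a *A T k b.
Proof. by elim: k => //= k ->; rewrite !(antipode_mul HA HS). Qed.

Lemma antipode_iter1 k : T k 1A = 1A.
Proof. by elim: k => //= k ->; rewrite !(antipode1 HA HS). Qed.

Lemma antipode_iterC k a : S (T k a) = T k (S a).
Proof. by elim: k => //= k ->. Qed.

Lemma ev_cop_antipode_iter k X (f : A -> A -> X) a : bilin f ->
  ev (cop A (T k a)) f = ev (cop A a) (fun x y => f (T k x) (T k y)).
Proof.
move=> bf; elim: k X f bf a => //= k IHk X f bf a.
rewrite (ev_cop_antipode HA HS) // (ev_cop_antipode HA HS); last by lin.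
by rewrite IHk //; lin.
Qed.

End SquaredAntipode.
#[global] Hint Extern 0 (lin (antipode_iter _ _)) => lin_apply antipode_iter_lin : lin.
#[global] Hint Extern 0 (lin (drinfeld_map _)) => lin_apply drinfeld_map_lin : lin.

Section DrinfeldMapInvertible.
Context {K : fieldType} {A : @bialg_data K} {E : calculus_data A}.
Hypothesis HA : bialgebra A.
Hypothesis HE : bicovariant_bimodule E.
Variable S : {linear A -> A}.
Hypothesis HS : antipode S.
Local Notation "a *A b" := (bmul a b) (at level 40, left associativity).
Local Notation "1A" := (bone A).
Local Notation "a *> m" := (lact a m) (at level 38, right associativity).
Local Notation "m <* a" := (ract m a) (at level 39, left associativity).
Local Notation l := (lcoact E).
Local Notation r := (rcoact E).
Local Notation P := (lproj_inv (E := E) S).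
Local Notation F := (drinfeld_map (E := E) S).
Local Notation T := (antipode_iter S).
Implicit Types (a b c : A) (m v w : E) (X : lmodType K).

Lemma iter_drinfeld_map_linv k v : is_linv E v -> is_linv E (iter k F v).
Proof. by move=> Iv; elim: k => //= k _; apply: (drinfeld_map_linv HA HE HS). Qed.

Lemma iter_drinfeld_map_ract k w a : is_linv E w ->
  iter k F (P (w <* a)) = P (iter k F w <* T k a).
Proof.
move=> Iw; elim: k => //= k ->.
by rewrite (drinfeld_map_ract HA HE HS) //; apply: iter_drinfeld_map_linv.
Qed.

(* The antipode need not be bijective, but on a finite-dimensional 0E the
   Drinfeld map is.  By Fitting, 0E = Im F^n + Ker F^n; the kernel is a
   submodule, and the induced action on the image I agrees with the one on 0E
   because a = S^2(a_2) S(a_1) a_3.  So I is a submodule, and it generates 0E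
   since w = F(w_0) <| w_1. *)
Lemma drinfeld_map_inverse : findim (is_linv E) ->
  exists G, [/\ lin G, forall v, is_linv E v -> is_linv E (G v),
    forall v, is_linv E v -> F (G v) = v & forall v, is_linv E v -> G (F v) = v].
Proof.
move=> fdE.
have LF : lin F by lin.
have [|n [G [LG GI FG FnG]]] := fitting fdE LF.
  by move=> v _; apply: (drinfeld_map_linv HA HE HS).
pose Phi := iter n F; pose Gam := iter n G.
have LPhi : lin Phi by apply: iter_lin.
have LGam : lin Gam by apply: iter_lin.
have GkI k v : is_linv E v -> is_linv E (iter k G v).
  by move=> Iv; elim: k => //= k; apply: GI.
have PhiI v : is_linv E v -> is_linv E (Phi v) by apply: iter_drinfeld_map_linv.
have GamI v : is_linv E v -> is_linv E (Gam v) by apply: GkI.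
have GiterF k v : G (iter k F v) = iter k F (G v).
  by elim: k => //= k IHk; rewrite FG IHk.
have GPhi v : Gam (Phi v) = Phi (Gam v).
  by rewrite /Gam; elim: (n) => //= k ->; rewrite GiterF.
have PhiG k v : is_linv E v -> Phi v = iter k F (Phi (iter k G v)).
  elim: k => // k IHk Iv; rewrite {1}(IHk Iv) iterSr; congr (iter k F _).
  by rewrite /Phi [LHS]FnG //; apply: GkI.
have PhiPhi v : is_linv E v -> Phi (Phi (Gam v)) = Phi v.
  by move=> Iv; rewrite [RHS](PhiG n).
(* On 0E this is the Fitting projection onto I = Im F^n along Ker F^n; the goal is to show that it
   is the identity. *)
pose pi v := Gam (Phi v).
have Lpi : lin pi by rewrite /pi; lin.
have piI v : is_linv E v -> is_linv E (pi v) by move=> /PhiI/GamI.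
have piPhi v : is_linv E v -> pi (Phi v) = Phi v.
  by move=> Iv; rewrite /pi 2!GPhi PhiPhi.
have Phipi v : is_linv E v -> Phi (pi v) = Phi v.
  by move=> Iv; rewrite /pi GPhi PhiPhi.
have pipi v : is_linv E v -> pi (pi v) = pi v.
  by move=> Iv; rewrite /pi Phipi.
have IP m : is_linv E (P m) by apply: (lproj_inv_linv HA HE HS).
have PA := lproj_ractA HA HE HS.
have PhiP v a : is_linv E v -> Phi (P (v <* a)) = P (Phi v <* T n a).
  exact: iter_drinfeld_map_ract.
have pi_ract v a : is_linv E v -> pi (P (v <* a)) = pi (P (pi v <* a)).
  by move=> Iv; rewrite /pi !PhiP ?Phipi //; apply: piI.
have pi_iter v a : is_linv E v -> pi v = v -> pi (P (v <* T n a)) = P (v <* T n a).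
  move=> Iv piv.
  have -> : P (v <* T n a) = Phi (P (Gam v <* a)).
    by rewrite PhiP ?PhiPhi //; [rewrite -GPhi -/(pi v) piv | apply: GamI].
  exact: piPhi.
(* If I is a submodule, then y v a = eps(a) v for v in I. This identity is proved first, in [yE],
   and implies in [pi_mod] that I is a submodule. *)
pose y v a := ev (cop A a) (fun a1 a2 => P (pi (P (v <* S a1)) <* a2)).
have by' : bilin y by rewrite /y; lin.
have yT k v b a : (k <= n)%N -> is_linv E v -> pi v = v ->
    y v (T (n - k) b *A a) = eps A b *: y v a.
  move=> + Iv piv; elim: k b a => [|k IHk] b a kn.
    rewrite subn0 /y ev_cop_mul //; last by lin.
    rewrite (ev_cop_antipode_iter HA HS); last by lin.
    rewrite exch_ev scaler_ev; apply: eq_ev => a1 a2.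
    have Ipi : is_linv E (pi (P (v <* S a1))) by apply: piI.
    under eq_ev => b1 b2.
      rewrite (antipode_mul HA HS) -[P (v <* _)]PA pi_ract // antipode_iterC pi_iter
        ?pipi //.
      rewrite PA bmulA // -antipode_iter_mul //; over.
    rewrite (antipodel HA HS (f := fun u => P (_ <* (T n u *A a2)))); last by lin.
    by rewrite antipode_iter1 // bmul1.
  have nk : (n - k = (n - k.+1).+1)%N by rewrite subnSK.
  move: (n - k.+1)%N nk => j nk.
  transitivity (ev (cop A b) (fun b1 b' => ev (cop A b') (fun b2 b3 =>
      y v (T j (S (S b2)) *A (T j (S b1 *A b3) *A a))))).
    transitivity (ev (cop A b) (fun b' b3 => ev (cop A b') (fun b1 b2 =>
        y v (T j (S (S b2) *A (S b1 *A b3)) *A a)))).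
      under eq_ev => b' b3.
        under eq_ev => b1 b2 do rewrite bmulA // -antipode_mul //.
        rewrite (antipoder HA HS (f := fun u => y v (T j (S u *A b3) *A a))); last by lin.
        rewrite (antipode1 HA HS) bmul1 //; over.
      by rewrite (cop_counitl HA (f := fun u => y v (T j u *A a))); last by lin.
    rewrite -cop_coassoc //; last by lin.
    by do 2!apply: eq_ev => ? ?; rewrite !antipode_iter_mul // !bmulA.
  under eq_ev => b1 b'.
    under eq_ev => b2 b3 do rewrite -antipode_iterS -nk IHk 1?ltnW //.
    rewrite (cop_counitl HA (f := fun b3 => y v (T j (S b1 *A b3) *A a))); last by lin.
    over.
  rewrite (antipodel HA HS (f := fun u => y v (T j u *A a))); last by lin.
  by rewrite antipode_iter1 // bmul1.
have yE v b : is_linv E v -> pi v = v -> y v b = eps A b *: v.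
  move=> Iv piv; have := yT n v b 1A (leqnn n) Iv piv.
  rewrite subnn /= bmulr1 // => ->; congr (_ *: _).
  rewrite /y ev_cop1 //; last by lin.
  by rewrite (antipode1 HA HS) !(ract1 HE) !(lproj_inv_id HA HE HS) //; apply: piI.
have pi_mod v a : is_linv E v -> pi v = v -> pi (P (v <* a)) = P (v <* a).
  move=> Iv piv.
  transitivity (ev (cop A a) (fun a1 a' => y (pi (P (v <* a1))) a')).
    under eq_ev => a1 a'.
      rewrite yE ?pipi //; last exact: piI.
      over.
    by rewrite (cop_counitr HA (f := fun a => pi (P (v <* a)))); last by lin.
  rewrite /y; under eq_ev => a1 a'.
    under eq_ev => a2 a3 do rewrite -pi_ract // PA; over.
  rewrite cop_coassoc //; last by lin.
  under eq_ev => a' a3.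
    rewrite (antipoder HA HS (f := fun u => P (pi (P (v <* u)) <* a3))); last by lin.
    rewrite (ract1 HE) (lproj_inv_id HA HE HS Iv) piv; over.
  by rewrite (cop_counitl HA (f := fun a => P (v <* a))); last by lin.
(* Iterating w = F(w_0) <| w_1 writes every left-invariant element as a sum of terms F^k(w) <| a. *)
have gen k v (Q : E -> Prop) : Q 0 -> (forall u w, Q u -> Q w -> Q (u + w)) ->
    (forall w a, is_linv E w -> Q (P (iter k F w <* a))) -> is_linv E v -> Q v.
  move=> Q0 QD; elim: k => [|k IHk] QF Iv.
    by have := QF v 1A Iv; rewrite /= (ract1 HE) (lproj_inv_id HA HE HS Iv).
  apply: IHk => // w a Iw.
  rewrite -{1}(drinfeld_map_coact HA HE HS Iw).
  rewrite (lin_ev (g := fun w => P (iter k F w <* a))); last first.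
    by have LFk := iter_lin k LF; lin.
  apply: ev_ind => // u c.
  rewrite iter_drinfeld_map_ract ?PA -?iterSr; first by apply: QF; apply: IP.
  exact: (drinfeld_map_linv HA HE HS).
have pi_id v : is_linv E v -> pi v = v.
  apply: (gen n v (fun v => pi v = v)).
  - exact: lin_zero.
  - by move=> u w pu pw; rewrite (linD Lpi) pu pw.
  by move=> w a Iw; apply: pi_mod; [apply: PhiI | apply: piPhi].
have FGE v : is_linv E v -> F (G v) = v.
  move=> Iv; rewrite -[RHS](pi_id v Iv) /pi GPhi {1}/Phi FnG; last exact: GamI.
  by rewrite iterS -GiterF -/(Phi _) -GPhi -/(pi v) pi_id.
by exists G; split=> // v Iv; rewrite FG FGE.
Qed.

End DrinfeldMapInvertible.

(** * The tensor square and its left-invariants *)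

Section TensorInd.
Context {K : fieldType}.

Lemma tensor_ind (U V : lmodType K) (Q : tensor U V -> Prop) :
  (forall s t, Q s -> Q t -> Q (s + t)) -> (forall u v, Q (u \ox v)) ->
  forall t, Q t.
Proof.
move=> QD Qt t; rewrite [t]repE; elim/big_ind: _ => //.
by rewrite -(lin_zero (bilin_lin2 (bilin_tens U V) 0)); apply: Qt.
Qed.

Lemma tensor_lin_ext (U V W : lmodType K) (f g : tensor U V -> W) :
  lin f -> lin g -> (forall u v, f (u \ox v) = g (u \ox v)) -> forall t, f t = g t.
Proof.
move=> Lf Lg fg; apply: tensor_ind => // s t fs ft.
by rewrite (linD Lf) (linD Lg) fs ft.
Qed.

Lemma finvE (U V : lmodType K) (f : U -> V) x : injective f -> Defs.finv f (f x) = x.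
Proof.
by move=> fI; rewrite /Defs.finv; case: xgetP => [y _ /= /fI|/(_ x) []].
Qed.

Lemma finv_eq (U V : lmodType K) (f : U -> V) (g : V -> U) :
  cancel f g -> cancel g f -> Defs.finv f =1 g.
Proof. by move=> fK gK y; rewrite -{1}[y]gK finvE //; apply: can_inj fK. Qed.

End TensorInd.

Section TensA.
Context {K : fieldType} {A : @bialg_data K} {E : calculus_data A}.
Local Notation "a *> m" := (lact a m) (at level 38, right associativity).
Local Notation "m <* a" := (ract m a) (at level 39, left associativity).
Implicit Types (X : lmodType K).

Lemma tA_bilin : bilin (@tA K A E).
Proof. exact: btens_bilin. Qed.

Lemma tA_bal (m : E) a (n : E) : tA (m <* a) n = tA m (a *> n).
Proof. exact: btens_bal. Qed.

Lemma tA_ind (Q : tensA E -> Prop) :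
  (forall s t, Q s -> Q t -> Q (s + t)) -> (forall m n, Q (tA m n)) ->
  forall t, Q t.
Proof.
move=> QD Qt t; have [s ->] := btens_gen t; elim/big_ind: _ => // [|p _].
  by rewrite -(lin_zero (bilin_lin2 tA_bilin 0)); apply: Qt.
exact: Qt.
Qed.

Definition balanced X (f : E -> E -> X) : Prop :=
  bilin f /\ forall m a n, f (m <* a) n = f m (a *> n).

Lemma tlift_tA X (f : E -> E -> X) m n : balanced f -> tlift f (tA m n) = f m n.
Proof. by case=> bf ff; apply: tliftE. Qed.

Lemma tlift_tA_lin X (f : E -> E -> X) : balanced f -> lin (tlift f : tensA E -> X).
Proof. by case=> bf ff; apply: tlift_linear. Qed.

Lemma tA_lin_ext X (f g : tensA E -> X) :
  lin f -> lin g -> (forall m n, f (tA m n) = g (tA m n)) -> forall t, f t = g t.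
Proof.
move=> Lf Lg fg; apply: tA_ind => // s t fs ft.
by rewrite (linD Lf) (linD Lg) fs ft.
Qed.

Lemma linv_val_lin : lin (fun w : linv E => w : E).
Proof. by move=> a u v. Qed.

End TensA.
#[global] Hint Extern 0 (bilin (@tA _ _ _)) => lin_apply tA_bilin : lin.
#[global] Hint Extern 0 (lin (coinv_val (one := _) (D := _))) => lin_apply linv_val_lin
  : lin.

Section BalancedOperations.
Context {K : fieldType} {A : @bialg_data K} {E : calculus_data A}.
Hypothesis HA : bialgebra A.
Hypothesis HE : bicovariant_bimodule E.
Local Notation "a *A b" := (bmul a b) (at level 40, left associativity).
Local Notation "1A" := (bone A).
Local Notation "a *> m" := (lact a m) (at level 38, right associativity).
Local Notation "m <* a" := (ract m a) (at level 39, left associativity).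
Local Notation l := (lcoact E).
Local Notation r := (rcoact E).
Implicit Types (a b c : A) (m v w : E) (X : lmodType K).

Lemma lact2_bal a : balanced (fun m n : E => tA (a *> m) n).
Proof.
split; first by lin.
by move=> m b n; rewrite -(lractA HE) tA_bal.
Qed.

Lemma lact2E a m n : lact2 a (tA m n) = tA (a *> m) n.
Proof. by rewrite /lact2 tlift_tA //; apply: lact2_bal. Qed.

Lemma lact2_bilin : bilin (@lact2 K A E).
Proof.
split=> [a|x]; first by apply: tlift_tA_lin; apply: lact2_bal.
move: x; apply: tA_ind => [s t Ls Lt|m n].
  have D c : lact2 c (s + t) = lact2 c s + lact2 c t.
    exact: (linD (tlift_tA_lin (lact2_bal c))).
  move=> a u v; rewrite !D [lact2 _ s](Ls a u v) [lact2 _ t](Lt a u v).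
  by rewrite scalerDr addrACA.
by apply: (eq_lin (fun a => lact2E a m n)); lin.
Qed.

Lemma ract2_bal a : balanced (fun m n : E => tA m (n <* a)).
Proof.
split; first by lin.
by move=> m b n; rewrite (lractA HE) tA_bal.
Qed.

Lemma ract2E m n a : ract2 (tA m n) a = tA m (n <* a).
Proof. by rewrite /ract2 tlift_tA //; apply: ract2_bal. Qed.

Lemma ract2_bilin : bilin (@ract2 K A E).
Proof.
split=> [x|a]; last by apply: tlift_tA_lin; apply: ract2_bal.
move: x; apply: tA_ind => [s t Ls Lt|m n].
  have D c : ract2 (s + t) c = ract2 s c + ract2 t c.
    exact: (linD (tlift_tA_lin (ract2_bal c))).
  move=> a u v; rewrite !D (Ls a u v) (Lt a u v).
  by rewrite scalerDr addrACA.
by apply: (eq_lin (fun a => ract2E m n a)); lin.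
Qed.

Lemma lcoact2_bal :
  balanced (fun m n : E => tprod (@bmul K A) (@tA K A E) (l m) (l n)).
Proof.
have bT := tprod_bilin (bmul_bilin HA) (@tA_bilin K A E).
split; first by lin.
move=> {bT} m b n; apply: tensor_ext => X f bf; rewrite [LHS]ev_tprod; try lin.
rewrite [RHS]ev_tprod; try lin.
rewrite (ev_lcoact_ract HA HE); last by lin.
apply: eq_ev => x m0; rewrite (ev_lcoact_lact HA HE); last by lin.
by do 2!apply: eq_ev => ? ?; rewrite (bmulA HA) tA_bal.
Qed.

Lemma rcoact2_bal :
  balanced (fun m n : E => tprod (@tA K A E) (@bmul K A) (r m) (r n)).
Proof.
have bT := tprod_bilin (@tA_bilin K A E) (bmul_bilin HA).
split; first by lin.
move=> {bT} m b n; apply: tensor_ext => X f bf; rewrite [LHS]ev_tprod; try lin.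
rewrite [RHS]ev_tprod; try lin.
rewrite (ev_rcoact_ract HA HE); last by lin.
apply: eq_ev => x m0; rewrite (ev_rcoact_lact HA HE); last by lin.
by do 2!apply: eq_ev => ? ?; rewrite (bmulA HA) tA_bal.
Qed.

Lemma lcoact2_lin : lin (lcoact2 (E := E)).
Proof. exact: tlift_tA_lin lcoact2_bal. Qed.

Lemma rcoact2_lin : lin (rcoact2 (E := E)).
Proof. exact: tlift_tA_lin rcoact2_bal. Qed.

Lemma ev_lcoact2 X (f : A -> tensA E -> X) m n : bilin f ->
  ev (lcoact2 (tA m n)) f
  = ev (l m) (fun x m0 => ev (l n) (fun y n0 => f (x *A y) (tA m0 n0))).
Proof.
move=> bf; rewrite /lcoact2 tlift_tA; last exact: lcoact2_bal.
by rewrite ev_tprod //; lin.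
Qed.

Lemma ev_rcoact2 X (f : tensA E -> A -> X) m n : bilin f ->
  ev (rcoact2 (tA m n)) f
  = ev (r m) (fun m0 x => ev (r n) (fun n0 y => f (tA m0 n0) (x *A y))).
Proof.
move=> bf; rewrite /rcoact2 tlift_tA; last exact: rcoact2_bal.
by rewrite ev_tprod //; lin.
Qed.

Hint Extern 0 (bilin (@lact2 _ _ _)) => lin_apply lact2_bilin : lin.
Hint Extern 0 (bilin (@ract2 _ _ _)) => lin_apply ract2_bilin : lin.
Hint Extern 0 (lin (lcoact2 (E := _))) => lin_apply lcoact2_lin : lin.
Hint Extern 0 (lin (rcoact2 (E := _))) => lin_apply rcoact2_lin : lin.

Lemma ev_lcoact2_lact2 X (f : A -> tensA E -> X) a x : bilin f ->
  ev (lcoact2 (lact2 a x)) f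
  = ev (cop A a) (fun a1 a2 => ev (lcoact2 x) (fun y x0 => f (a1 *A y) (lact2 a2 x0))).
Proof.
move=> bf; move: x; apply: tA_lin_ext; try solve [lin].
move=> m n; rewrite -> lact2E, ev_lcoact2 by exact: bf.
rewrite -> (ev_lcoact_lact HA HE) by lin.
apply: eq_ev => a1 a2; rewrite -> ev_lcoact2 by lin.
by do 2!apply: eq_ev => ? ?; rewrite lact2E (bmulA HA).
Qed.

Lemma ev_lcoact2_ract2 X (f : A -> tensA E -> X) x a : bilin f ->
  ev (lcoact2 (ract2 x a)) f
  = ev (lcoact2 x) (fun y x0 => ev (cop A a) (fun a1 a2 => f (y *A a1) (ract2 x0 a2))).
Proof.
move=> bf; move: x; apply: tA_lin_ext; try solve [lin].
move=> m n; rewrite -> ract2E, ev_lcoact2 by exact: bf.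
rewrite -> ev_lcoact2 by lin.
apply: eq_ev => y m0; rewrite -> (ev_lcoact_ract HA HE) by lin.
by do 2!apply: eq_ev => ? ?; rewrite ract2E (bmulA HA).
Qed.

Lemma ev_rcoact2_lact2 X (f : tensA E -> A -> X) a x : bilin f ->
  ev (rcoact2 (lact2 a x)) f
  = ev (cop A a) (fun a1 a2 => ev (rcoact2 x) (fun x0 y => f (lact2 a1 x0) (a2 *A y))).
Proof.
move=> bf; move: x; apply: tA_lin_ext; try solve [lin].
move=> m n; rewrite -> lact2E, ev_rcoact2 by exact: bf.
rewrite -> (ev_rcoact_lact HA HE) by lin.
apply: eq_ev => a1 a2; rewrite -> ev_rcoact2 by lin.
by do 2!apply: eq_ev => ? ?; rewrite lact2E (bmulA HA).
Qed.

Lemma ev_rcoact2_ract2 X (f : tensA E -> A -> X) x a : bilin f ->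
  ev (rcoact2 (ract2 x a)) f
  = ev (rcoact2 x) (fun x0 y => ev (cop A a) (fun a1 a2 => f (ract2 x0 a1) (y *A a2))).
Proof.
move=> bf; move: x; apply: tA_lin_ext; try solve [lin].
move=> m n; rewrite -> ract2E, ev_rcoact2 by exact: bf.
rewrite -> ev_rcoact2 by lin.
apply: eq_ev => y m0; rewrite -> (ev_rcoact_ract HA HE) by lin.
by do 2!apply: eq_ev => ? ?; rewrite ract2E (bmulA HA).
Qed.

Lemma iota_bilin : bilin (fun w1 w2 : linv E => tA w1 w2 : tensA E).
Proof. by lin. Qed.

Lemma iotaE (w1 w2 : linv E) : iota (w1 \ox w2) = tA w1 w2.
Proof. by rewrite /iota tlift_tens //; apply: iota_bilin. Qed.

Lemma iota_lin : lin (iota (E := E)).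
Proof. by apply: tlift_lin; apply: iota_bilin. Qed.
Hint Extern 0 (lin (iota (E := _))) => lin_apply iota_lin : lin.

Lemma umul_bilin : bilin (fun t a => ract2 (iota (E := E) t) a).
Proof. by lin. Qed.

Lemma umulE t a : umul (t \ox a) = ract2 (iota (E := E) t) a.
Proof. by rewrite /umul tlift_tens //; apply: umul_bilin. Qed.

Lemma umul_lin : lin (umul (E := E)).
Proof. by apply: tlift_lin; apply: umul_bilin. Qed.

Lemma linvP (w : linv E) : is_linv E w.
Proof. by case: w => w /=; rewrite inE => /eqP. Qed.

Lemma lcoact2_iota t : lcoact2 (iota (E := E) t) = 1A \ox iota t.
Proof.
move: t; apply: tensor_lin_ext; try solve [lin].
move=> v w; rewrite iotaE; apply: tensor_ext => X f bf.
rewrite ev_lcoact2 // ev_tens // (ev_linv (linvP v)); last by lin.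
by rewrite (ev_linv (linvP w)) ?bmul1 //; lin.
Qed.

End BalancedOperations.
#[global] Hint Extern 0 (bilin (@lact2 _ _ _)) => lin_apply lact2_bilin : lin.
#[global] Hint Extern 0 (bilin (@ract2 _ _ _)) => lin_apply ract2_bilin : lin.
#[global] Hint Extern 0 (lin (lcoact2 (E := _))) => lin_apply lcoact2_lin : lin.
#[global] Hint Extern 0 (lin (rcoact2 (E := _))) => lin_apply rcoact2_lin : lin.
#[global] Hint Extern 0 (lin (iota (E := _))) => lin_apply iota_lin : lin.
#[global] Hint Extern 0 (lin (umul (E := _))) => lin_apply umul_lin : lin.

(** * E as a free right module over its left-invariants *)

Section FreeBasis.
Context {K : fieldType} {A : @bialg_data K} {E : calculus_data A}.
Hypothesis HA : bialgebra A.
Hypothesis HE : bicovariant_bimodule E.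
Variable S : {linear A -> A}.
Hypothesis HS : antipode S.
Local Notation "a *A b" := (bmul a b) (at level 40, left associativity).
Local Notation "1A" := (bone A).
Local Notation "a *> m" := (lact a m) (at level 38, right associativity).
Local Notation "m <* a" := (ract m a) (at level 39, left associativity).
Local Notation l := (lcoact E).
Local Notation P := (lproj_inv (E := E) S).
Local Notation F := (drinfeld_map (E := E) S).
Implicit Types (a b c : A) (m : E) (v w : linv E) (X : lmodType K).

Hint Resolve linvP : core.

Let Pinv m : P m \in coinvp 1A l.
Proof. by rewrite inE; apply/eqP; apply: (lproj_inv_linv HA HE HS). Qed.

Definition linv_proj m : linv E := Coinv (Pinv m).

Lemma linv_proj_val m : linv_proj m = P m :> E. Proof. by []. Qed.

Lemma linv_proj_lin : lin linv_proj.
Proof. by move=> a u v; apply: val_inj => /=; apply: (lproj_inv_lin HE). Qed.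
Hint Extern 0 (lin linv_proj) => lin_apply linv_proj_lin : lin.

Lemma linv_proj_id v : linv_proj v = v.
Proof. by apply: val_inj; apply: (lproj_inv_id HA HE HS). Qed.

Lemma calculus_span (Q : E -> Prop) :
  (forall m n, Q m -> Q n -> Q (m + n)) -> (forall a v, Q (a *> v)) ->
  forall m, Q m.
Proof.
move=> QD Qa m; rewrite -[m](lproj_invK HA HE HS (f := id)) //.
apply: ev_ind => // [|x m0]; last by rewrite -linv_proj_val.
by rewrite -(lin_zero (bilin_lin1 (lact_bilin HE) (linv_proj 0))).
Qed.

Lemma calculus_span_rinv (Q : E -> Prop) :
  (forall m n, Q m -> Q n -> Q (m + n)) ->
  (forall a h, is_rinv E h -> Q (h <* a)) -> forall m, Q m.
Proof.
move=> QD Qa m; rewrite -[m](rproj_invK HA HE HS (f := id)) //.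
have Ih n := rproj_inv_rinv HA HE HS n.
apply: ev_ind => // [|m0 y]; last exact: Qa.
by rewrite -(lin_zero (bilin_lin2 (ract_bilin HE) (rproj_inv S 0))); apply: Qa.
Qed.

Lemma tA_span (Q : tensA E -> Prop) :
  (forall s t, Q s -> Q t -> Q (s + t)) -> (forall a v w, Q (lact2 a (tA v w))) ->
  forall t, Q t.
Proof.
move=> QD Qa; apply: tA_ind => // m n; move: n m.
apply: calculus_span => [n n' Qn Qn' m|a w m].
  by rewrite (linD (bilin_lin2 tA_bilin m)); apply: QD.
rewrite -tA_bal; move: (m <* a) => {}m {a}.
move: m; apply: calculus_span => [m m' Qm Qm'|a v].
  by rewrite (linD (bilin_lin1 tA_bilin _)); apply: QD.
by rewrite -(lact2E HE).
Qed.

(** These generators are the ones on which a canonical braiding is determined: it is bilinear over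
    the algebra and flips left-invariant past right-invariant. *)
Lemma tA_span_biinv (Q : tensA E -> Prop) :
  (forall s t, Q s -> Q t -> Q (s + t)) ->
  (forall a b v h, is_rinv E h -> Q (lact2 a (ract2 (tA v h) b))) ->
  forall t, Q t.
Proof.
move=> QD Qa; apply: tA_ind => // m n; move: n m.
apply: calculus_span_rinv => [n n' Qn Qn' m|b h Ih].
  by rewrite (linD (bilin_lin2 tA_bilin m)); apply: QD.
apply: calculus_span => [m m' Qm Qm'|a v].
  by rewrite (linD (bilin_lin1 tA_bilin _)); apply: QD.
by rewrite -(lact2E HE) -(ract2E HE); apply: Qa.
Qed.

(* The averaging x |-> S(x_(-1)) x_(0) sends a . iota t to eps a . iota t. *)
Lemma linv2_iota x : lcoact2 x = 1A \ox x -> exists t, x = iota (E := E) t.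
Proof.
move=> Ix; pose p (x : tensA E) := ev (lcoact2 x) (fun a y => lact2 (S a) y).
have Lp : lin p by rewrite /p; lin.
have -> : x = p x.
  rewrite /p Ix ev_tens; last by lin.
  rewrite (antipode1 HA HS); move: x {Ix}.
  by apply: tA_lin_ext; try lin; move=> m n; rewrite (lact2E HE) (lact1 HE).
have iotaD : {morph iota (E := E) : s t / s + t} by apply: linD; lin.
apply: (@tA_span (fun x => exists t, p x = iota t)) => [u v [t tE] [s sE]|a v w].
  by exists (t + s); rewrite (linD Lp) tE sE iotaD.
exists (eps A a *: (v \ox w)); rewrite (linZ (iota_lin (E := E))) iotaE.
rewrite /p (ev_lcoact2_lact2 HA HE); last by lin.
rewrite -iotaE lcoact2_iota //.
under eq_ev => a1 a2.
  rewrite ev_tens; last by lin.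
  rewrite (bmulr1 HA); over.
transitivity (ev (cop A a) (fun x y => lact2 (S x *A y) (iota (v \ox w)))).
  by apply: eq_ev => ? ?; rewrite iotaE !(lact2E HE) (lactA HE).
rewrite (antipodel HA HS (f := fun u => lact2 u (iota (v \ox w)))); last by lin.
by rewrite iotaE (lact2E HE) (lact1 HE).
Qed.

Hypothesis fdE : findim (is_linv E).

(* w <|' a plays the role of w <| S^-1(a). *)
Lemma inverse_action : exists f : E -> A -> E,
  [/\ bilin f, forall v a, is_linv E (f v a),
  forall v a, ev (cop A a) (fun a1 a2 => f (P (v <* a2)) a1) = eps A a *: (v : E)
  & forall v a, ev (cop A a) (fun a1 a2 => P (f v a2 <* a1)) = eps A a *: (v : E)].
Proof.
have [G [LG GI FG GF]] := drinfeld_map_inverse HA HE HS fdE.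
have PI m : is_linv E (P m) by apply: (lproj_inv_linv HA HE HS).
(* Since F(v <| b) = F(v) <| S^2(b), putting formally b = S^-1(a) gives F(v <| S^-1(a)) = F(v) <|
   S(a); G then inverts F. *)
exists (fun (v : E) a => G (P (F v <* S a))); split=> [|v a|v a|v a].
- by lin.
- exact: GI.
- rewrite -(lin_ev (g := G)) // (drinfeld_map_cancel HA HE HS) //.
  by rewrite (linZ LG) GF.
rewrite -[LHS]GF.
  rewrite (lin_ev (g := F)); last by lin.
  under eq_ev => a1 a2.
    rewrite (drinfeld_map_ract HA HE HS) ?FG //; last exact: GI.
    rewrite (lproj_ractA HA HE HS) -(antipode_mul HA HS); over.
  rewrite (antipodel HA HS (f := fun u => P (F v <* S u))); last by lin.
  rewrite (linZ LG) (antipode1 HA HS) (ract1 HE).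
  by rewrite (lproj_inv_id HA HE HS) ?GF //; apply: (drinfeld_map_linv HA HE HS).
apply: ev_ind => [|m n Im In|m y]; last exact: PI.
  by rewrite /is_linv (lin_zero (lin_linear _)) (lin_zero (bilin_lin2 (bilin_tens _ _)
    _)).
by rewrite /is_linv (linD (lin_linear _)) Im In (linD (bilin_lin2 (bilin_tens _ _) _)).
Qed.

(** Every m is a sum of terms a v with v left-invariant, and moving a to the right calls for an
    inverse antipode: a v = (v <| S^-1(a_2)) a_1. [inverse_action] supplies the substitute from
    which [U] is built. *)
Lemma linv_free : exists U : E -> tensor (linv E) A,
  [/\ lin U, forall w a, U (w <* a) = w \ox a,
    forall m, ev (U m) (fun w a => w <* a) = m
  & forall m c, U (m <* c) = ev (U m) (fun w a => w \ox (a *A c))].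
Proof.
have [f [bf If fP Pf]] := inverse_action.
pose U m := ev (l m) (fun x m0 =>
  ev (cop A x) (fun a1 a2 => linv_proj (f (P m0) a2) \ox a1)).
have LU : lin U by rewrite /U; lin.
have UE w a : U (w <* a) = w \ox a.
  rewrite /U (ev_lcoact_ract HA HE); last by lin.
  rewrite ev_linv //; last by lin.
  under eq_ev => a1 a2 do rewrite (bmul1 HA).
  rewrite -(cop_coassoc HA (F := fun x y z => linv_proj (f (P (w <* z)) y) \ox x));
    last by lin.
  under eq_ev => x b.
    rewrite -(lin_ev (g := fun n => linv_proj n \ox x)); last by lin.
    rewrite fP (linZ (f := fun n => linv_proj n \ox x)); last by lin.
    rewrite linv_proj_id; over.
  by rewrite (cop_counitr HA (f := fun x => w \ox x)); last by lin.
have mulU m : ev (U m) (fun w a => w <* a) = m.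
  rewrite /U ev_ev; last by lin.
  under eq_ev => x m0.
    rewrite ev_ev; last by lin.
    under eq_ev => a1 a2.
      rewrite ev_tens; last by lin.
      rewrite linv_proj_val (lproj_inv_id HA HE HS (If (linv_proj m0) a2)).
      rewrite -[f _ _ <* _](lproj_invK HA HE HS (f := id)) //.
      rewrite (ev_lcoact_ract HA HE); last by lin.
      rewrite (ev_linv (If (linv_proj m0) a2)); last by lin.
      under eq_ev => b1 b2 do rewrite (bmul1 HA).
      over.
    rewrite -(cop_coassoc HA (F := fun b1 b2 a2 => b1 *> P (f (P m0) a2 <* b2))); last
      by lin.
    under eq_ev => b1 d.
      rewrite -(lin_ev (g := fun n => b1 *> n)); last by lin.
      rewrite (Pf (linv_proj m0)) (linZ (f := fun n => b1 *> n)); last by lin.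
      over.
    rewrite (cop_counitr HA (f := fun b1 => b1 *> P m0)); last by lin.
    over.
  exact: (lproj_invK HA HE HS (f := id)).
exists U; split=> // m c.
rewrite -{1}[m]mulU (lin_ev (g := fun n => U (n <* c))); last by lin.
by apply: eq_ev => w a; rewrite (ractA HE) UE.
Qed.

(** The inverse moves coefficients to the right twice: m = w a, and then a n = w' b, give m (x) n =
    (w (x) w') b. *)
Lemma umul_bij : exists J : tensA E -> tensor (linv2 E) A,
  [/\ lin J, cancel (umul (E := E)) J & cancel J (umul (E := E))].
Proof.
have [U [LU UE mulU UR]] := linv_free.
pose J0 m n := ev (U m) (fun w a => ev (U (a *> n)) (fun w' b => (w \ox w') \ox b)).
have J0b : balanced J0.
  split; first by rewrite /J0; lin.
  move=> m c n; rewrite /J0 UR ev_ev; last by lin.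
  apply: eq_ev => w a; rewrite ev_tens; last by lin.
  by rewrite -(lactA HE).
exists (tlift J0); split; first exact: tlift_tA_lin.
  apply: tensor_lin_ext => // [|t a].
    by have LJ := tlift_tA_lin J0b; lin.
  rewrite umulE //; move: t; apply: tensor_lin_ext; try lin.
    by have LJ := tlift_tA_lin J0b; lin.
  move=> w w'; rewrite iotaE (ract2E HE) tlift_tA // /J0.
  rewrite -[X in U X](ract1 HE) UE ev_tens; last by lin.
  by rewrite (lact1 HE) UE ev_tens //; lin.
apply: tA_lin_ext => [||m n] //.
  by have LJ := tlift_tA_lin J0b; have Lm := umul_lin HE; lin.
rewrite tlift_tA // /J0 (lin_ev (g := umul (E := E))); last exact: umul_lin.
under eq_ev => w a.
  rewrite (lin_ev (g := umul (E := E))); last exact: umul_lin.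
  under eq_ev => w' b do rewrite umulE // iotaE (ract2E HE).
  rewrite -(lin_ev (g := fun n => tA (w : E) n)); last by lin.
  rewrite mulU -tA_bal; over.
rewrite -(lin_ev (g := fun m => tA m n)); last by lin.
by rewrite mulU.
Qed.

(** The retraction is id (x) eps after the inverse of [umul]. It makes [iota] injective, so that
    [finv iota] is a genuine inverse on the left-invariants of the tensor square. *)
Lemma iota_retract : exists j : tensA E -> linv2 E,
  [/\ lin j, cancel (iota (E := E)) j
    & forall x, lcoact2 x = 1A \ox x -> iota (j x) = x].
Proof.
have [J [LJ umulK JK]] := umul_bij.
pose j x := ev (J x) (fun t b => eps A b *: t).
have jK : cancel (iota (E := E)) j.
  move=> t; have -> : iota t = umul (t \ox 1A).
    rewrite umulE //; move: (iota t).
    by apply: tA_lin_ext; try lin; move=> m n; rewrite (ract2E HE) (ract1 HE).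
  by rewrite /j umulK ev_tens ?(eps1 HA) ?scale1r //; lin.
exists j; split=> [||x /linv2_iota [t ->]]; first by rewrite /j; lin.
  exact: jK.
by rewrite jK.
Qed.

End FreeBasis.

(** * Twists *)

Section OneSidedTwist.
Context {K : fieldType} {C : lmodType K} (D : C -> tensor C C).
Hypothesis LD : lin D.
Implicit Types M N Q X Y : lmodType K.

(** Only left coactions of C occur. Along right coactions, the same definition is used with the legs
    swapped. *)
Definition tw2 M N X (l : M -> tensor C M) (l' : N -> tensor C N)
    (F : C -> C -> K) (f : M -> N -> X) (m : M) (n : N) : X :=
  ev (l m) (fun x m0 => ev (l' n) (fun y n0 => F x y *: f m0 n0)).

Definition tw3 M N Q X (l : M -> tensor C M) (l' : N -> tensor C N)
    (l'' : Q -> tensor C Q) (F : C -> C -> C -> K) (f : M -> N -> Q -> X)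
    (m : M) (n : N) (q : Q) : X :=
  ev (l m) (fun x m0 => ev (l' n) (fun y n0 => ev (l'' q) (fun z q0 =>
    F x y z *: f m0 n0 q0))).

(** Convolution is the twist of a scalar-valued map along the comultiplication itself, so the
    associativity and unit laws of convolution are instances of the composition and counit laws of
    twists. *)
Definition cconv2 (F G : C -> C -> K) : C -> C -> K :=
  tw2 D D F (G : C -> C -> K^o).
Definition cconv3 (F G : C -> C -> C -> K) : C -> C -> C -> K :=
  tw3 D D D F (G : C -> C -> C -> K^o).

Local Notation bilink F := (@bilin K _ _ K^o F).
Local Notation trilink F := (@trilin K _ _ _ K^o F).
Local Notation link e := (@lin K _ K^o e).

Definition counitary M (e : C -> K) (l : M -> tensor C M) : Prop :=
  forall X (f : M -> X) m, lin f -> ev (l m) (fun x m0 => e x *: f m0) = f m.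

Section Twist.
Context M N Q X (l : M -> tensor C M) (l' : N -> tensor C N)
  (l'' : Q -> tensor C Q).
Hypotheses (Ll : lin l) (Ll' : lin l') (Ll'' : lin l'').

Lemma tw2_bilin (F : C -> C -> K) (f : M -> N -> X) :
  bilink F -> bilin f -> bilin (tw2 l l' F f).
Proof. by move=> bF bf; rewrite /tw2; lin. Qed.

Lemma tw3_trilin (F : C -> C -> C -> K) (f : M -> N -> Q -> X) :
  trilink F -> trilin f -> trilin (tw3 l l' l'' F f).
Proof. by move=> bF bf; rewrite /tw3; lin. Qed.

Lemma lin_tw2 Y (g : X -> Y) F (f : M -> N -> X) m n : lin g ->
  g (tw2 l l' F f m n) = tw2 l l' F (fun m n => g (f m n)) m n.
Proof.
move=> Lg; rewrite /tw2 (lin_ev (g := g)) //; apply: eq_ev => x m0.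
by rewrite (lin_ev (g := g)) //; apply: eq_ev => y n0; rewrite (linZ Lg).
Qed.

Lemma eq_tw2 F (f g : M -> N -> X) m n :
  (forall m n, f m n = g m n) -> tw2 l l' F f m n = tw2 l l' F g m n.
Proof. by move=> fg; do 2!apply: eq_ev => ? ?; rewrite fg. Qed.

Lemma eq_tw3 F (f g : M -> N -> Q -> X) m n q :
  (forall m n q, f m n q = g m n q) -> tw3 l l' l'' F f m n q = tw3 l l' l'' F g m n q.
Proof. by move=> fg; do 3!apply: eq_ev => ? ?; rewrite fg. Qed.

Hypotheses (cl : coassociative D l) (cl' : coassociative D l')
  (cl'' : coassociative D l'').

Lemma tw2_comp (F G : C -> C -> K) (f : M -> N -> X) m n : bilink F -> bilink G ->
  bilin f ->
  tw2 l l' F (tw2 l l' G f) m n = tw2 l l' (cconv2 F G) f m n.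
Proof.
move=> bF bG bf; rewrite /tw2.
transitivity (ev (l m) (fun x m0 => ev (l m0) (fun x' m1 =>
  ev (l' n) (fun y n0 => ev (l' n0) (fun y' n1 =>
    F x y *: (G x' y' *: f m1 n1)))))).
  apply: eq_ev => x m0; rewrite [RHS]exch_ev; apply: eq_ev => y n0.
  by do 2!(rewrite scaler_ev; apply: eq_ev => ? ?).
rewrite cl; last by lin.
apply: eq_ev => x m0.
under eq_ev => x1 x2.
  rewrite (cl' (F := fun y y' n1 => F x1 y *: (G x2 y' *: f m0 n1))); last by lin.
  over.
rewrite exch_ev; apply: eq_ev => y n0.
rewrite /cconv2 /tw2 ev_scalel; apply: eq_ev => x1 x2.
by rewrite ev_scalel; apply: eq_ev => y1 y2; rewrite scalerA.
Qed.

Lemma tw3_comp (F G : C -> C -> C -> K) (f : M -> N -> Q -> X) m n q :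
  trilink F -> trilink G -> trilin f ->
  tw3 l l' l'' F (tw3 l l' l'' G f) m n q = tw3 l l' l'' (cconv3 F G) f m n q.
Proof.
move=> tF tG tf; rewrite /tw3.
transitivity (ev (l m) (fun x m0 => ev (l m0) (fun x' m1 =>
  ev (l' n) (fun y n0 => ev (l' n0) (fun y' n1 =>
  ev (l'' q) (fun z q0 => ev (l'' q0) (fun z' q1 =>
    F x y z *: (G x' y' z' *: f m1 n1 q1)))))))).
  apply: eq_ev => x m0; rewrite [RHS]exch_ev; apply: eq_ev => y n0.
  under [RHS]eq_ev => x' m1 do rewrite exch_ev.
  rewrite [RHS]exch_ev; apply: eq_ev => z q0.
  by do 3!(rewrite scaler_ev; apply: eq_ev => ? ?).
rewrite cl; last by lin.
apply: eq_ev => x m0.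
under eq_ev => x1 x2.
  rewrite (cl' (F := fun y y' n1 => ev (l'' q) (fun z q0 => ev (l'' q0)
    (fun z' q1 => F x1 y z *: (G x2 y' z' *: f m0 n1 q1))))); last by lin.
  under eq_ev => y n0.
    under eq_ev => y1 y2.
      rewrite (cl'' (F := fun z z' q1 =>
        F x1 y1 z *: (G x2 y2 z' *: f m0 n0 q1))); last by lin.
      over.
    rewrite exch_ev; over.
  over.
rewrite exch_ev; apply: eq_ev => y n0.
rewrite exch_ev; apply: eq_ev => z q0.
rewrite /cconv3 /tw3 ev_scalel; apply: eq_ev => x1 x2.
rewrite ev_scalel; apply: eq_ev => y1 y2.
by rewrite ev_scalel; apply: eq_ev => z1 z2; rewrite scalerA.
Qed.

Context (e : C -> K).
Hypotheses (Le : link e) (el : counitary e l) (el' : counitary e l')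
  (el'' : counitary e l'').

Lemma tw2_counit (f : M -> N -> X) m n : bilin f ->
  tw2 l l' (fun x y => e x * e y) f m n = f m n.
Proof.
move=> bf; rewrite -(el (f := fun m => f m n)); last by lin.
apply: eq_ev => x m0; rewrite -[in RHS](el' (f := f m0)); last by lin.
by rewrite scaler_ev; apply: eq_ev => y n0; rewrite scalerA.
Qed.

Lemma tw3_counit (f : M -> N -> Q -> X) m n q : trilin f ->
  tw3 l l' l'' (fun x y z => e x * (e y * e z)) f m n q = f m n q.
Proof.
move=> tf; rewrite -(el (f := fun m => f m n q)); last by lin.
apply: eq_ev => x m0; rewrite -[in RHS](el' (f := fun n => f m0 n q)); last by lin.
rewrite scaler_ev; apply: eq_ev => y n0.
rewrite -[in RHS](el'' (f := f m0 n0)); last by lin.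
by rewrite !scaler_ev; apply: eq_ev => z q0; rewrite !scalerA mulrA.
Qed.

End Twist.

Definition covariant M N Q (mu : C -> C -> C) (l : M -> tensor C M)
    (l' : N -> tensor C N) (l'' : Q -> tensor C Q) (p : M -> N -> Q) : Prop :=
  forall X (f : C -> Q -> X) m n, bilin f ->
    ev (l'' (p m n)) f
    = ev (l m) (fun x m0 => ev (l' n) (fun y n0 => f (mu x y) (p m0 n0))).

Section TwistCovariant.
Context M N Q Y X (l : M -> tensor C M) (l' : N -> tensor C N)
  (l'' : Q -> tensor C Q) (k : Y -> tensor C Y).
Hypotheses (Ll : lin l) (Ll' : lin l') (Ll'' : lin l'') (Lk : lin k).
Hypotheses (cl : coassociative D l) (cl' : coassociative D l')
  (cl'' : coassociative D l'').
Context (e : C -> K) (mu : C -> C -> C).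
Hypotheses (Le : link e) (bmu : bilin mu).
Hypotheses (el : counitary e l) (el'' : counitary e l'').

(** By covariance, the coaction of p(m, n) is the product of those of m and n, so the outer
    functional becomes F(xy, z); a counit on q makes the inner one a function of three arguments.
    With F = G = [om] the convolution is one side of the cocycle identity. *)
Lemma tw2_covariantl (F G : C -> C -> K) (p : M -> N -> Y) (B : Y -> Q -> X) m n q :
  bilink F -> bilink G -> bilin p -> bilin B -> covariant mu l l' k p ->
  tw2 k l'' F B (tw2 l l' G p m n) q
  = tw3 l l' l'' (cconv3 (fun x y z => G x y * e z) (fun x y z => F (mu x y) z))
      (fun m n q => B (p m n) q) m n q.
Proof.
move=> bF bG bp bB cp.
rewrite (lin_tw2 l l' (g := fun y => tw2 k l'' F B y q)); last first.
  by rewrite /tw2; lin.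
rewrite -tw3_comp //; try lin.
apply: eq_ev => x m0; apply: eq_ev => y n0.
have -> : tw2 k l'' F B (p m0 n0) q
  = tw3 l l' l'' (fun x y z => F (mu x y) z) (fun m n q => B (p m n) q) m0 n0 q.
  by rewrite /tw2 cp //; lin.
rewrite -[in LHS](el'' (f := tw3 l l' l'' _ _ m0 n0)); last by rewrite /tw3; lin.
by rewrite scaler_ev; apply: eq_ev => z q0; rewrite scalerA.
Qed.

End TwistCovariant.

Section TwistCovariantRight.
Context M N Q Y X (l : M -> tensor C M) (l' : N -> tensor C N)
  (l'' : Q -> tensor C Q) (k : Y -> tensor C Y).
Hypotheses (Ll : lin l) (Ll' : lin l') (Ll'' : lin l'') (Lk : lin k).
Hypotheses (cl : coassociative D l) (cl' : coassociative D l')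
  (cl'' : coassociative D l'').
Context (e : C -> K) (mu : C -> C -> C).
Hypotheses (Le : link e) (bmu : bilin mu) (el : counitary e l).

(** The other bracketing; for F = G = [om] it yields the other side of the cocycle identity. *)
Lemma tw2_covariantr (F G : C -> C -> K) (p : N -> Q -> Y) (B : M -> Y -> X) m n q :
  bilink F -> bilink G -> bilin p -> bilin B -> covariant mu l' l'' k p ->
  tw2 l k F B m (tw2 l' l'' G p n q)
  = tw3 l l' l'' (cconv3 (fun x y z => e x * G y z) (fun x y z => F x (mu y z)))
      (fun m n q => B m (p n q)) m n q.
Proof.
move=> bF bG bp bB cp.
rewrite (lin_tw2 l' l'' (g := tw2 l k F B m)); last by rewrite /tw2; lin.
rewrite -tw3_comp //; try lin.
have E n0 q0 : tw2 l k F B m (p n0 q0)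
  = tw3 l l' l'' (fun x y z => F x (mu y z)) (fun m n q => B m (p n q)) m n0 q0.
  rewrite /tw2 /tw3; apply: eq_ev => x m0.
  by rewrite (cp _ (fun y n => F x y *: B m0 n)) //; lin.
transitivity (ev (l' n) (fun y n0 => ev (l'' q) (fun z q0 => G y z *:
    tw3 l l' l'' (fun x y z => F x (mu y z)) (fun m n q => B m (p n q)) m n0 q0))).
  by do 2!apply: eq_ev => ? ?; rewrite -E.
rewrite [RHS]/tw3 [RHS]exch_ev; apply: eq_ev => y n0.
rewrite [RHS]exch_ev; apply: eq_ev => z q0.
rewrite -[in LHS](el (f := fun m => tw3 l l' l'' _ _ m n0 q0)); last by rewrite /tw3; lin.
by rewrite scaler_ev; apply: eq_ev => x m0; rewrite scalerA mulrC.
Qed.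

End TwistCovariantRight.
End OneSidedTwist.

(** * The cocycle and its inverse in the convolution algebra *)

Section Cocycle.
Context {K : fieldType} {A : @bialg_data K}.
Hypothesis HA : bialgebra A.
Local Notation "a *A b" := (bmul a b) (at level 40, left associativity).
Local Notation "1A" := (bone A).
Local Notation bilink F := (@bilin K _ _ K^o F).
Local Notation trilink F := (@trilin K _ _ _ K^o F).
Local Notation c2 := (cconv2 (cop A)).
Local Notation c3 := (cconv3 (cop A)).
Local Notation eps3 := (fun x y z : A => eps A x * (eps A y * eps A z)).
Implicit Types (a b c x y z : A).

Definition rcop (a : A) : tensor A A := tswap (cop A a).

Lemma rcop_lin : lin rcop.
Proof. by rewrite /rcop; lin. Qed.

Lemma eps_lin : @lin K _ K^o (eps A).
Proof. exact: lin_scalar. Qed.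

Lemma counitary_cop : counitary (eps A) (cop A).
Proof. by move=> X f a Lf; apply: cop_counitl. Qed.

Lemma coassociative_rcop : coassociative rcop rcop.
Proof.
move=> X F tF a; rewrite /rcop !ev_tswap; try lin.
under eq_ev => x y.
  rewrite ev_tswap; last by lin.
  over.
rewrite -(cop_coassoc HA (F := fun u v w => F w v u)); last by split=> [?|? ?]; lin.
by apply: eq_ev => x y; rewrite ev_tswap //; lin.
Qed.

Lemma conv2E (F G : A -> A -> K) : bilink F -> bilink G ->
  conv2 F G = c2 F G.
Proof.
move=> bF bG; apply/funext => a; apply/funext => b.
have E a1 a2 : tlift (fun b1 b2 => F a1 b1 * G a2 b2 : K^o) (cop A b)
  = ev (cop A b) (fun b1 b2 => F a1 b1 * G a2 b2 : K^o).
  by rewrite tlift_ev //; lin.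
rewrite /conv2 /cconv2 /tw2 tlift_ev; first by apply: (@eq_ev _ _ _ K^o) => ? ?;
  rewrite E.
by apply: (@eq_bilin _ _ _ K^o _ _ E); lin.
Qed.

Lemma conv3E (F G : A -> A -> A -> K) : trilink F -> trilink G ->
  conv3 F G = c3 F G.
Proof.
move=> bF bG; apply/funext => a; apply/funext => b; apply/funext => c.
have E a1 a2 b1 b2 : tlift (fun c1 c2 => F a1 b1 c1 * G a2 b2 c2 : K^o) (cop A c)
  = ev (cop A c) (fun c1 c2 => F a1 b1 c1 * G a2 b2 c2 : K^o).
  by rewrite tlift_ev //; lin.
have E' a1 a2 : tlift (fun b1 b2 => tlift (fun c1 c2 =>
    F a1 b1 c1 * G a2 b2 c2 : K^o) (cop A c)) (cop A b)
  = ev (cop A b) (fun b1 b2 => ev (cop A c) (fun c1 c2 =>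
      F a1 b1 c1 * G a2 b2 c2 : K^o)).
  rewrite tlift_ev; first by apply: (@eq_ev _ _ _ K^o) => ? ?; rewrite E.
  by apply: (@eq_bilin _ _ _ K^o _ _ (E a1 a2)); lin.
rewrite /conv3 /cconv3 /tw3 tlift_ev; last by apply: (@eq_bilin _ _ _ K^o _ _ E'); lin.
by apply: (@eq_ev _ _ _ K^o) => a1 a2; rewrite E'.
Qed.

Lemma cconv2_rcop (F G : A -> A -> K) : bilink F -> bilink G -> cconv2 rcop F G = c2 G F.
Proof.
move=> bF bG; apply/funext => a; apply/funext => b.
rewrite /cconv2 /tw2 /rcop ev_tswap; last by lin.
apply: (@eq_ev _ _ _ K^o) => a1 a2; rewrite ev_tswap; last by lin.
by apply: (@eq_ev _ _ _ K^o) => b1 b2; rewrite [_ *: _]mulrC.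
Qed.

Lemma cconv3_rcop (F G : A -> A -> A -> K) : trilink F -> trilink G -> cconv3 rcop F G
  = c3 G F.
Proof.
move=> bF bG; apply/funext => a; apply/funext => b; apply/funext => c.
rewrite /cconv3 /tw3 /rcop ev_tswap; last by lin.
apply: (@eq_ev _ _ _ K^o) => a1 a2; rewrite ev_tswap; last by lin.
apply: (@eq_ev _ _ _ K^o) => b1 b2; rewrite ev_tswap; last by lin.
by apply: (@eq_ev _ _ _ K^o) => d1 d2; rewrite [_ *: _]mulrC.
Qed.

Lemma cconv3A (F G H : A -> A -> A -> K) : trilink F -> trilink G -> trilink H ->
  c3 F (c3 G H) = c3 (c3 F G) H.
Proof.
move=> tF tG tH; apply/funext => a; apply/funext => b; apply/funext => c.
have cA := cop_coassociative HA.
exact: (tw3_comp (X := K^o) cA cA cA a b c tF tG tH).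
Qed.

Lemma cconv3_eps3l (F : A -> A -> A -> K) : trilink F -> c3 eps3 F = F.
Proof.
move=> tF; apply/funext => a; apply/funext => b; apply/funext => c.
have cA := counitary_cop.
exact: (tw3_counit (X := K^o) cA cA cA a b c tF).
Qed.

Lemma cconv3_eps3r (F : A -> A -> A -> K) : trilink F -> c3 F eps3 = F.
Proof.
move=> tF; apply/funext => a; apply/funext => b; apply/funext => c.
rewrite /cconv3 /tw3 -[RHS](cop_counitr HA (f := fun a => F a b c : K^o)); last by lin.
apply: (@eq_ev _ _ _ K^o) => a1 a2.
rewrite -[F a1 b c](cop_counitr HA (f := fun b => F a1 b c : K^o)); last by lin.
rewrite scaler_ev; apply: (@eq_ev _ _ _ K^o) => b1 b2.
rewrite -[F a1 b1 c](cop_counitr HA (f := fun c => F a1 b1 c : K^o)); last by lin.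
rewrite !scaler_ev; apply: (@eq_ev _ _ _ K^o) => d1 d2.
by rewrite /GRing.scale /= [LHS]mulrC !mulrA.
Qed.

Lemma cconv3_mull (F G : A -> A -> K) : bilink F -> bilink G ->
  c3 (fun x y z => F (x *A y) z) (fun x y z => G (x *A y) z)
  = fun x y z => c2 F G (x *A y) z.
Proof.
move=> bF bG; apply/funext => a; apply/funext => b; apply/funext => c.
by rewrite /cconv2 /tw2 (ev_cop_mul HA) //; lin.
Qed.

Lemma cconv3_mulr (F G : A -> A -> K) : bilink F -> bilink G ->
  c3 (fun x y z => F x (y *A z)) (fun x y z => G x (y *A z))
  = fun x y z => c2 F G x (y *A z).
Proof.
move=> bF bG; apply/funext => a; apply/funext => b; apply/funext => c.
rewrite /cconv2 /tw2; apply: (@eq_ev _ _ _ K^o) => a1 a2.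
by rewrite (ev_cop_mul HA) //; lin.
Qed.

Lemma cconv3_epsr (F G : A -> A -> K) : bilink F -> bilink G ->
  c3 (fun x y z => F x y * eps A z) (fun x y z => G x y * eps A z)
  = fun x y z => c2 F G x y * eps A z.
Proof.
move=> bF bG; apply/funext => a; apply/funext => b; apply/funext => c.
rewrite mulrC -[RHS]/(eps A c *: (c2 F G a b : K^o)) /cconv2 /tw2.
rewrite scaler_ev; apply: (@eq_ev _ _ _ K^o) => a1 a2; rewrite scaler_ev; apply:
  (@eq_ev _ _ _ K^o) => b1 b2.
rewrite -[X in X *: _](cop_counitl HA (f := fun c => eps A c : K^o)); last by lin.
rewrite ev_scalel; apply: (@eq_ev _ _ _ K^o) => c1 c2.
by rewrite /GRing.scale /= mulrACA mulrC.
Qed.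

Lemma cconv3_epsl (F G : A -> A -> K) : bilink F -> bilink G ->
  c3 (fun x y z => eps A x * F y z) (fun x y z => eps A x * G y z)
  = fun x y z => eps A x * c2 F G y z.
Proof.
move=> bF bG; apply/funext => a; apply/funext => b; apply/funext => c.
rewrite -[RHS]/(eps A a *: (c2 F G b c : K^o)) /cconv2 /tw2.
rewrite -[X in X *: _](cop_counitl HA (f := fun c => eps A c : K^o)); last by lin.
rewrite ev_scalel; apply: (@eq_ev _ _ _ K^o) => a1 a2.
rewrite scaler_ev; apply: (@eq_ev _ _ _ K^o) => b1 b2; rewrite scaler_ev; apply:
  (@eq_ev _ _ _ K^o) => c1 c2.
by rewrite /GRing.scale /= mulrACA.
Qed.

Variables om om' : A -> A -> K.
Hypothesis Hom : dual_2cocycle om om'.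

Let sum_bilin (F : A -> A -> K) : in_dual_tensor2 F -> bilink F.
Proof.
move=> [n [h [k [_ FE]]]].
apply: (@eq_bilin _ _ _ K^o _ (fun a b => \sum_i h i a * k i b : K^o)) => //.
by split=> [a|b]; apply: (@lin_big _ _ K^o) => i; lin.
Qed.

Lemma cocycle_bilin : bilink om.
Proof. by case: Hom => [[/sum_bilin]]. Qed.

Lemma cocycle_inv_bilin : bilink om'.
Proof. by case: Hom => [[_ /sum_bilin]]. Qed.
Let bom := cocycle_bilin.
Let bom' := cocycle_inv_bilin.

Lemma cocycleK : c2 om om' = fun a b => eps A a * eps A b.
Proof.
rewrite -conv2E //; apply/funext => a; apply/funext => b.
by case: Hom => _ /(_ a b) [].
Qed.

Lemma cocycleVK : c2 om' om = fun a b => eps A a * eps A b.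
Proof.
rewrite -conv2E //; apply/funext => a; apply/funext => b.
by case: Hom => _ /(_ a b) [].
Qed.

Lemma cocycle1l a : om 1A a = eps A a.
Proof. by case: Hom => _ _ /(_ a) []. Qed.

Lemma cocycle1r a : om a 1A = eps A a.
Proof. by case: Hom => _ _ /(_ a) []. Qed.

Lemma cocycle_inv1l a : om' 1A a = eps A a.
Proof.
have := congr1 (fun f => f 1A a) cocycleK.
rewrite /cconv2 /tw2 (ev_cop1 HA); last by lin.
under eq_ev => x y do rewrite cocycle1l.
rewrite (cop_counitl HA (f := fun a => om' 1A a : K^o)); last by lin.
by rewrite (eps1 HA) mul1r.
Qed.

Lemma cocycle_inv1r a : om' a 1A = eps A a.
Proof.
have := congr1 (fun f => f a 1A) cocycleK.
rewrite /cconv2 /tw2; under eq_ev => x y.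
  rewrite (ev_cop1 HA); last by lin.
  rewrite cocycle1r; over.
rewrite (cop_counitl HA (f := fun a => om' a 1A : K^o)); last by lin.
by rewrite (eps1 HA) mulr1.
Qed.

(** One side of the cocycle identity as a functional of three arguments, followed by its convolution
    inverse. *)
Definition cocycle3 : A -> A -> A -> K :=
  c3 (fun x y z => om x y * eps A z) (fun x y z => om (x *A y) z).
Definition cocycle3_inv : A -> A -> A -> K :=
  c3 (fun x y z => om' (x *A y) z) (fun x y z => om' x y * eps A z).

Lemma cconv3_trilin (F G : A -> A -> A -> K) : trilink F -> trilink G -> trilink (c3 F G).
Proof.
have LD := lin_linear (cop A).
by move=> tF tG; apply: (tw3_trilin (X := K^o) LD LD LD tF tG).
Qed.

Lemma cocycle3_trilin : trilink cocycle3.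
Proof. by apply: cconv3_trilin; lin. Qed.

Lemma cocycle3_inv_trilin : trilink cocycle3_inv.
Proof. by apply: cconv3_trilin; lin. Qed.

Lemma cocycle3E :
  cocycle3 = c3 (fun x y z => eps A x * om y z) (fun x y z => om x (y *A z)).
Proof.
rewrite /cocycle3 -!conv3E; try lin.
apply/funext => a; apply/funext => b; apply/funext => c.
by case: Hom => _ _ _ ->.
Qed.

Lemma cocycle3VK : c3 cocycle3_inv cocycle3 = eps3.
Proof.
have t1 : trilink (fun x y z => om' (x *A y) z) by lin.
have t2 : trilink (fun x y z => om' x y * eps A z) by lin.
have t3 : trilink (fun x y z => om x y * eps A z) by lin.
have t4 : trilink (fun x y z => om (x *A y) z) by lin.
rewrite /cocycle3_inv /cocycle3 -(cconv3A t1 t2 (cconv3_trilin t3 t4)).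
rewrite (cconv3A t2 t3 t4).
rewrite cconv3_epsr // cocycleVK.
have -> : (fun x y z => eps A x * eps A y * eps A z) = eps3.
  by do 3!apply/funext => ?; rewrite mulrA.
rewrite cconv3_eps3l; last by lin.
rewrite cconv3_mull // cocycleVK.
by do 3!apply/funext => ?; rewrite (eps_mul HA) mulrA.
Qed.

Let cocycle3K' : c3 cocycle3
  (c3 (fun x y z => om' x (y *A z)) (fun x y z => eps A x * om' y z)) = eps3.
Proof.
have t1 : trilink (fun x y z => eps A x * om y z) by lin.
have t2 : trilink (fun x y z => om x (y *A z)) by lin.
have t3 : trilink (fun x y z => om' x (y *A z)) by lin.
have t4 : trilink (fun x y z => eps A x * om' y z) by lin.
rewrite cocycle3E -(cconv3A t1 t2 (cconv3_trilin t3 t4)).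
rewrite (cconv3A t2 t3 t4).
rewrite cconv3_mulr // cocycleK.
have -> : (fun x y z => eps A x * eps A (y *A z)) = eps3.
  by do 3!apply/funext => ?; rewrite (eps_mul HA).
rewrite cconv3_eps3l; last by lin.
by rewrite cconv3_epsl // cocycleK.
Qed.

(** A left and a right convolution inverse of [cocycle3] coincide. The result is the cocycle
    identity for [om'], with the order of convolution reversed. *)
Lemma cocycle3_invE : cocycle3_inv =
  c3 (fun x y z => om' x (y *A z)) (fun x y z => eps A x * om' y z).
Proof.
rewrite -[LHS]cconv3_eps3r; last exact: cocycle3_inv_trilin.
rewrite -cocycle3K'.
have t1 : trilink (fun x y z => om' x (y *A z)) by lin.
have t2 : trilink (fun x y z => eps A x * om' y z) by lin.
rewrite (cconv3A cocycle3_inv_trilin cocycle3_trilin (cconv3_trilin t1 t2)).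
by rewrite cocycle3VK cconv3_eps3l //; apply: cconv3_trilin.
Qed.

End Cocycle.
#[global] Hint Extern 0 (lin rcop) => lin_apply rcop_lin : lin.

Section Commuting.
Context {K : fieldType} {C : lmodType K}.
Local Notation bilink F := (@bilin K _ _ K^o F).
Implicit Types M N Q X Y : lmodType K.

Definition commuting M (l r : M -> tensor C M) : Prop :=
  forall X (F : C -> C -> M -> X), trilin F -> forall m,
    ev (l m) (fun x m0 => ev (r m0) (fun y m1 => F x y m1))
    = ev (r m) (fun y m0 => ev (l m0) (fun x m1 => F x y m1)).

Context M N Y (l r : M -> tensor C M) (l' r' : N -> tensor C N).
Hypotheses (Ll : lin l) (Lr : lin r) (Ll' : lin l') (Lr' : lin r').
Hypotheses (lr : commuting l r) (lr' : commuting l' r').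

Lemma ev_commuting X (W : C -> C -> C -> C -> M -> N -> X) m n :
  (forall z t n, trilin (fun x y m => W x z y t m n)) ->
  (forall x y m, trilin (fun z t n => W x z y t m n)) ->
  ev (l m) (fun x m0 => ev (l' n) (fun z n0 =>
    ev (r m0) (fun y m1 => ev (r' n0) (fun t n1 => W x z y t m1 n1))))
  = ev (r m) (fun y m0 => ev (r' n) (fun t n0 =>
    ev (l m0) (fun x m1 => ev (l' n0) (fun z n1 => W x z y t m1 n1)))).
Proof.
move=> W1 W2.
have L1 x y z t n1 : lin (fun m => W x z y t m n1) by exact: (trilin_lin3 (W1 z t n1) x
  y).
have L2 x y t m1 n1 : lin (fun z => W x z y t m1 n1).
  by exact: (trilin_lin1 (W2 x y m1) t n1).
have L3 x z t m1 n1 : lin (fun y => W x z y t m1 n1).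
  by exact: (trilin_lin2 (W1 z t n1) x m1).
have L4 z y t m1 n1 : lin (fun x => W x z y t m1 n1).
  by exact: (trilin_lin1 (W1 z t n1) y m1).
transitivity (ev (l m) (fun x m0 => ev (r m0) (fun y m1 =>
    ev (l' n) (fun z n0 => ev (r' n0) (fun t n1 => W x z y t m1 n1))))).
  by apply: eq_ev => x m0; rewrite exch_ev.
rewrite (lr (F := fun x y m1 => ev (l' n) (fun z n0 => ev (r' n0)
  (fun t n1 => W x z y t m1 n1)))); last first.
  split=> [x|y m1]; last first.
    by apply: lin_ev_fun => z n0; apply: lin_ev_fun => t n1; apply: L4.
  apply: bilinI => [y|m1]; apply: lin_ev_fun => z n0; apply: lin_ev_fun => t n1.
    exact: L1.
  exact: L3.
apply: eq_ev => y m0.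
under eq_ev => x m1.
  rewrite (lr' (F := fun z t n1 => W x z y t m1 n1)); last exact: W2.
  over.
by rewrite exch_ev.
Qed.

Lemma tw2C X (F G : C -> C -> K) (f : M -> N -> X) m n :
  bilink F -> bilink G -> bilin f ->
  tw2 l l' F (tw2 r r' G f) m n = tw2 r r' G (tw2 l l' F f) m n.
Proof.
move=> bF bG bf; rewrite /tw2.
transitivity (ev (l m) (fun x m0 => ev (l' n) (fun z n0 =>
    ev (r m0) (fun y m1 => ev (r' n0) (fun t n1 =>
      F x z *: (G y t *: f m1 n1)))))).
  by do 2!apply: eq_ev => ? ?; do 2!(rewrite scaler_ev; apply: eq_ev => ? ?).
rewrite (ev_commuting (W := fun x z y t m n => F x z *: (G y t *: f m n))); try by
  move=> *; lin.
do 2!apply: eq_ev => ? ?; do 2!(rewrite scaler_ev; apply: eq_ev => ? ?).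
by rewrite !scalerA mulrC.
Qed.

(** The coactions l and r commute, so a twist along l does not disturb covariance along r. *)
Lemma tw2_covariant (mu : C -> C -> C) (k : Y -> tensor C Y)
    (F : C -> C -> K) (p : M -> N -> Y) :
  lin k -> bilin mu -> bilink F -> bilin p ->
  covariant mu r r' k p -> covariant mu r r' k (tw2 l l' F p).
Proof.
move=> Lk bmu bF bp cp Z f m n bf.
rewrite (lin_tw2 l l' (g := fun y => ev (k y) f)); last by lin.
transitivity (ev (l m) (fun x m0 => ev (l' n) (fun z n0 =>
    ev (r m0) (fun y m1 => ev (r' n0) (fun t n1 =>
      F x z *: f (mu y t) (p m1 n1)))))).
  apply: eq_ev => x m0; apply: eq_ev => z n0; rewrite cp //.
  by do 2!(rewrite scaler_ev; apply: eq_ev => ? ?).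
rewrite (ev_commuting (W := fun x z y t m n => F x z *: f (mu y t) (p m n))); try by
  move=> *; lin.
apply: eq_ev => y m0; apply: eq_ev => t n0.
by rewrite (lin_tw2 l l' (g := f (mu y t))); last by lin.
Qed.

End Commuting.

(** * Two-sided twists *)

Section TwoSidedTwist.
Context {K : fieldType} {A : @bialg_data K}.
Hypothesis HA : bialgebra A.
Local Notation bilink F := (@bilin K _ _ K^o F).
Implicit Types M N Q X Y : lmodType K.

(* A bicomodule whose right coaction has been swapped into a left coaction of
   the co-opposite coalgebra. *)
Record bicomodule M (l r : M -> tensor A M) : Prop := Bicomodule {
  bico_ll : lin l;
  bico_lr : lin r;
  bico_al : coassociative (cop A) l;
  bico_ar : coassociative (rcop (A := A)) r;
  bico_el : counitary (eps A) l;
  bico_er : counitary (eps A) r;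
  bico_c : commuting l r }.

Definition twist M N X (l r : M -> tensor A M) (l' r' : N -> tensor A N)
    (F G : A -> A -> K) (f : M -> N -> X) : M -> N -> X :=
  tw2 r r' G (tw2 l l' F f).

Definition bicovariant M N Y (l r : M -> tensor A M) (l' r' : N -> tensor A N)
    (k s : Y -> tensor A Y) (p : M -> N -> Y) : Prop :=
  covariant (@bmul K A) l l' k p /\ covariant (@bmul K A) r r' s p.

Section Bilinear.
Context M N X (l r : M -> tensor A M) (l' r' : N -> tensor A N).
Hypotheses (HM : bicomodule l r) (HN : bicomodule l' r').

Lemma twist_bilin (F G : A -> A -> K) (f : M -> N -> X) : bilink F -> bilink G -> bilin
  f ->
  bilin (twist l r l' r' F G f).
Proof.
case: HM HN => Ll Lr _ _ _ _ _ [Ll' Lr' _ _ _ _ _] bF bG bf.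
by do 2!apply: tw2_bilin => //.
Qed.

Lemma lin_twist Y (g : X -> Y) F G (f : M -> N -> X) m n : lin g ->
  g (twist l r l' r' F G f m n) = twist l r l' r' F G (fun m n => g (f m n)) m n.
Proof.
move=> Lg; rewrite /twist (lin_tw2 r r' (g := g)) //.
by apply: eq_tw2 => m' n'; rewrite (lin_tw2 l l' (g := g)).
Qed.

Lemma eq_twist F G (f g : M -> N -> X) m n : (forall m n, f m n = g m n) ->
  twist l r l' r' F G f m n = twist l r l' r' F G g m n.
Proof. by move=> fg; apply: eq_tw2 => m' n'; apply: eq_tw2. Qed.

(** One identity F * G = eps serves both halves: along r the convolution is reversed, and there the
    two functionals also occur in the opposite order. *)
Lemma twist_comp (F G : A -> A -> K) (f : M -> N -> X) m n : bilink F -> bilink G ->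
  cconv2 (cop A) F G = (fun a b => eps A a * eps A b) ->
  bilin f -> twist l r l' r' F G (twist l r l' r' G F f) m n = f m n.
Proof.
case: HM HN => Ll Lr al ar el er c [Ll' Lr' al' ar' el' er' c'] bF bG FG bf.
rewrite /twist; under eq_tw2 => m' n'.
  rewrite (tw2C c c' (f := tw2 l l' G f)) //; last exact: tw2_bilin.
  under eq_tw2 => m'' n'' do rewrite (tw2_comp al al') // FG (tw2_counit el el') //.
  over.
by rewrite (tw2_comp ar ar') // cconv2_rcop // FG (tw2_counit er er').
Qed.

End Bilinear.

Section Associativity.
Variables om om' : A -> A -> K.
Hypothesis Hom : dual_2cocycle om om'.
Context M N Q Y Y' X (l r : M -> tensor A M) (l' r' : N -> tensor A N)
  (l'' r'' : Q -> tensor A Q) (k s : Y -> tensor A Y) (k' s' : Y' -> tensor A Y').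
Hypotheses (HM : bicomodule l r) (HN : bicomodule l' r') (HQ : bicomodule l'' r'').
Hypotheses (Lk : lin k) (Ls : lin s) (Lk' : lin k') (Ls' : lin s').
Let bom := cocycle_bilin Hom.
Let bom' := cocycle_inv_bilin Hom.

(** The normal form of both bracketings. Along r the convolution of the functionals of [om'] is
    reversed, which is why [cocycle3_inv] appears there. *)
Definition twist3 (f : M -> N -> Q -> X) : M -> N -> Q -> X :=
  tw3 r r' r'' (cocycle3_inv om') (tw3 l l' l'' (cocycle3 om) f).

Lemma eq_twist3 (f g : M -> N -> Q -> X) m n q :
  (forall m n q, f m n q = g m n q) -> twist3 f m n q = twist3 g m n q.
Proof. by move=> fg; apply: eq_tw3 => m' n' q'; apply: eq_tw3. Qed.

(** The twist is undone by [cocycle3_inv] along l and [cocycle3] along r; because of the reversal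
    along r, [cocycle3VK] proves both cancellations. *)
Lemma twist3_inj (f g : M -> N -> Q -> X) : trilin f -> trilin g ->
  (forall m n q, twist3 f m n q = twist3 g m n q) ->
  forall m n q, f m n q = g m n q.
Proof.
case: HM HN HQ => Ll Lr al ar el er _ [Ll' Lr' al' ar' el' er' _].
move=> [Ll'' Lr'' al'' ar'' el'' er'' _] tf tg fg m n q.
have t1 := cocycle3_trilin HA Hom; have t2 := cocycle3_inv_trilin HA Hom.
have tw3K (h : M -> N -> Q -> X) m' n' q' : trilin h ->
    tw3 l l' l'' (cocycle3_inv om') (tw3 r r' r'' (cocycle3 om) (twist3 h)) m' n' q'
    = h m' n' q'.
  move=> th; have th' := tw3_trilin Ll Ll' Ll'' t1 th.
  transitivity (tw3 l l' l'' (cocycle3_inv om') (tw3 l l' l'' (cocycle3 om) h) m' n' q').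
    apply: eq_tw3 => m1 n1 q1.
    rewrite /twist3 (tw3_comp ar ar' ar'') // cconv3_rcop // (cocycle3VK HA Hom).
    by rewrite (tw3_counit er er' er'').
  by rewrite (tw3_comp al al' al'') // (cocycle3VK HA Hom) (tw3_counit el el' el'').
by rewrite -[LHS]tw3K // -[RHS]tw3K //; do 2!apply: eq_tw3 => ? ? ?.
Qed.

Lemma twist_covariantl (p : M -> N -> Y) (B : Y -> Q -> X) m n q :
  bilin p -> bilin B -> bicovariant l r l' r' k s p ->
  twist k s l'' r'' om om' B (twist l r l' r' om om' p m n) q
  = twist3 (fun m n q => B (p m n) q) m n q.
Proof.
case: HM HN HQ => Ll Lr al ar el er c [Ll' Lr' al' ar' el' er' c'].
move=> [Ll'' Lr'' al'' ar'' el'' er'' c''] bp bB [cl cr].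
have bmu := bmul_bilin HA; have Le := eps_lin (A := A).
have cr1 : covariant (@bmul K A) r r' s (tw2 l l' om p) by apply: tw2_covariant.
rewrite /twist (tw2_covariantl Lr'' Ls ar ar' ar'' Le bmu er'' _ _ _ bom' bom') //; try
  exact: tw2_bilin.
rewrite cconv3_rcop; try lin.
apply: eq_tw3 => m' n' q'.
exact: (tw2_covariantl Ll'' Lk al al' al'' Le bmu el'' _ _ _ bom bom).
Qed.

Lemma twist_covariantr (p : N -> Q -> Y') (B : M -> Y' -> X) m n q :
  bilin p -> bilin B -> bicovariant l' r' l'' r'' k' s' p ->
  twist l r k' s' om om' B m (twist l' r' l'' r'' om om' p n q)
  = twist3 (fun m n q => B m (p n q)) m n q.
Proof.
case: HM HN HQ => Ll Lr al ar el er c [Ll' Lr' al' ar' el' er' c'].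
move=> [Ll'' Lr'' al'' ar'' el'' er'' c''] bp bB [cl cr].
have bmu := bmul_bilin HA; have Le := eps_lin (A := A).
have cr1 : covariant (@bmul K A) r' r'' s' (tw2 l' l'' om p) by apply: tw2_covariant.
rewrite /twist (tw2_covariantr Lr Ls' ar ar' ar'' Le bmu er _ _ _ bom' bom') //; try
  exact: tw2_bilin.
rewrite cconv3_rcop; try lin.
rewrite /twist3 (cocycle3_invE HA Hom) (cocycle3E HA Hom).
apply: eq_tw3 => m' n' q'.
exact: (tw2_covariantr Ll Lk' al al' al'' Le bmu el _ _ _ bom bom).
Qed.

(** The main use of the cocycle identity. Associativity of the deformed product, the bimodule
    axioms, balancing, and the compatibility of [xi] with the actions are all instances of it. *)
Lemma twist_assoc (p : M -> N -> Y) (B : Y -> Q -> X) (p' : N -> Q -> Y')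
    (B' : M -> Y' -> X) m n q :
  bilin p -> bilin B -> bicovariant l r l' r' k s p ->
  bilin p' -> bilin B' -> bicovariant l' r' l'' r'' k' s' p' ->
  (forall m n q, B (p m n) q = B' m (p' n q)) ->
  twist k s l'' r'' om om' B (twist l r l' r' om om' p m n) q
  = twist l r k' s' om om' B' m (twist l' r' l'' r'' om om' p' n q).
Proof.
move=> bp bB cp bp' bB' cp' BB'; rewrite twist_covariantl // twist_covariantr //.
exact: eq_twist3.
Qed.

(** The converse, from injectivity of the triple twist; it recovers balancing over A from balancing
    over the deformed algebra. *)
Lemma twist_assoc_inv (p : M -> N -> Y) (B : Y -> Q -> X) (p' : N -> Q -> Y')
    (B' : M -> Y' -> X) m n q :
  bilin p -> bilin B -> bicovariant l r l' r' k s p ->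
  bilin p' -> bilin B' -> bicovariant l' r' l'' r'' k' s' p' ->
  (forall m n q,
    twist k s l'' r'' om om' B (twist l r l' r' om om' p m n) q
    = twist l r k' s' om om' B' m (twist l' r' l'' r'' om om' p' n q)) ->
  B (p m n) q = B' m (p' n q).
Proof.
move=> bp bB cp bp' bB' cp' BB'; move: m n q; apply: twist3_inj; try lin.
by move=> m n q; rewrite -twist_covariantl // -twist_covariantr.
Qed.

End Associativity.
End TwoSidedTwist.

Section SweedlerEv.
Context {K : fieldType} {A : @bialg_data K} {E : calculus_data A}.
Implicit Types X : lmodType K.

Lemma sweedler3_ev X (a : A) (F : A -> A -> A -> X) : trilin F ->
  sweedler3 a F
  = ev (cop A a) (fun a1 b => ev (cop A b) (fun a2 a3 => F a1 a2 a3)).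
Proof.
move=> tF; have E0 a1 b : tlift (fun a2 a3 => F a1 a2 a3) (cop A b)
  = ev (cop A b) (fun a2 a3 => F a1 a2 a3) by rewrite tlift_ev //; lin.
rewrite /sweedler3 tlift_ev; first by apply: eq_ev => a1 b; rewrite E0.
by apply: (eq_bilin E0); lin.
Qed.

Lemma eq_sweedler3 X (a : A) (F G : A -> A -> A -> X) :
  (forall x y z, F x y z = G x y z) -> sweedler3 a F = sweedler3 a G.
Proof.
by move=> FG; congr sweedler3; do 3!apply/funext => ?; apply: FG.
Qed.

Lemma bisweedler_ev X (m : E) (F : A -> E -> A -> X) : trilin F ->
  bisweedler m F
  = ev (rcoact E m) (fun m' y => ev (lcoact E m') (fun x m0 => F x m0 y)).
Proof.
move=> tF; have E0 m' y : tlift (fun x m0 => F x m0 y) (lcoact E m')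
  = ev (lcoact E m') (fun x m0 => F x m0 y) by rewrite tlift_ev //; lin.
rewrite /bisweedler tlift_ev; first by apply: eq_ev => m' y; rewrite E0.
by apply: (eq_bilin E0); lin.
Qed.

End SweedlerEv.

(** * The deformed operations as twists *)

Section Deformation.
Context {K : fieldType} {A : @bialg_data K} {E : calculus_data A}.
Hypothesis HA : bialgebra A.
Hypothesis HE : bicovariant_bimodule E.
Local Notation "a *A b" := (bmul a b) (at level 40, left associativity).
Local Notation "a *> m" := (lact a m) (at level 38, right associativity).
Local Notation "m <* a" := (ract m a) (at level 39, left associativity).
Local Notation l := (lcoact E).
Local Notation r := (rcoact E).
Local Notation bilink F := (@bilin K _ _ K^o F).
Implicit Types (a b c : A) (m n : E) (X : lmodType K).

Definition rco (m : E) : tensor A E := tswap (r m).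
Definition rco2 (x : tensA E) : tensor A (tensA E) := tswap (rcoact2 x).

Lemma rco_lin : lin rco. Proof. by rewrite /rco; lin. Qed.
Lemma rco2_lin : lin rco2. Proof. by rewrite /rco2; lin. Qed.

Lemma bicomodule_A : bicomodule (cop A) (rcop (A := A)).
Proof.
split=> [|||||X f a Lf|X F tF a].
- by lin.
- exact: rcop_lin.
- exact: cop_coassociative.
- exact: coassociative_rcop.
- exact: counitary_cop.
- by rewrite /rcop ev_tswap; [apply: cop_counitr | lin].
rewrite /rcop [RHS]ev_tswap; last by lin.
rewrite -(cop_coassoc HA (F := fun x c y => F x y c)); last by split=> [?|? ?]; lin.
by apply: eq_ev => x b; rewrite ev_tswap //; lin.
Qed.

Lemma bicomodule_E : bicomodule l rco.
Proof.
split=> [|||||X f m Lf|X F tF m].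
- by lin.
- exact: rco_lin.
- exact: lcoact_coassociative.
- exact: rcoact_coassociative.
- by move=> X f m Lf; apply: lcoact_counit.
- by rewrite /rco ev_tswap; [apply: rcoact_counit | lin].
rewrite /rco [RHS]ev_tswap; last by lin.
rewrite -(coact_comm HE (F := fun x m0 y => F x y m0)); last by split=> [?|? ?]; lin.
by apply: eq_ev => x b; rewrite ev_tswap //; lin.
Qed.

Lemma bicovariant_bmul :
  bicovariant (cop A) (rcop (A := A)) (cop A) rcop (cop A) rcop (@bmul K A).
Proof.
split=> X f a b bf; first exact: ev_cop_mul.
rewrite /rcop ev_tswap // (ev_cop_mul HA); last by lin.
rewrite ev_tswap; last by lin.
by apply: eq_ev => ? ?; rewrite ev_tswap //; lin.
Qed.

Lemma bicovariant_lact :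
  bicovariant (cop A) (rcop (A := A)) l rco l rco (@lact K A E).
Proof.
split=> X f a m bf; first exact: (ev_lcoact_lact HA HE).
rewrite /rcop /rco ev_tswap // (ev_rcoact_lact HA HE); last by lin.
rewrite ev_tswap; last by lin.
by apply: eq_ev => ? ?; rewrite ev_tswap //; lin.
Qed.

Lemma bicovariant_ract :
  bicovariant l rco (cop A) (rcop (A := A)) l rco (@ract K A E).
Proof.
split=> X f a m bf; first exact: (ev_lcoact_ract HA HE).
rewrite /rcop /rco ev_tswap // (ev_rcoact_ract HA HE); last by lin.
rewrite ev_tswap; last by lin.
by apply: eq_ev => ? ?; rewrite ev_tswap //; lin.
Qed.

Lemma bicovariant_tA :
  bicovariant l rco l rco (lcoact2 (E := E)) rco2 (@tA K A E).
Proof.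
split=> X f m n bf; first exact: (ev_lcoact2 HA HE).
rewrite /rco /rco2; rewrite -> ev_tswap by lin.
rewrite -> (ev_rcoact2 HA HE) by lin.
rewrite -> ev_tswap by lin.
by apply: eq_ev => ? ?; rewrite -> ev_tswap by lin.
Qed.

Section TwistSweedler.
Context (M N X : lmodType K) (lM : M -> tensor A M) (rM : M -> tensor M A)
  (lN : N -> tensor A N) (rN : N -> tensor N A).
Hypotheses (LlM : lin lM) (LlN : lin lN).

Lemma twist_sweedler (F G : A -> A -> K) (f : M -> N -> X) (m : M) (n : N) :
  bilink F -> bilink G -> bilin f ->
  twist lM (fun m : M => tswap (rM m)) lN (fun n : N => tswap (rN n)) F G f m n
  = ev (rM m) (fun (m' : M) y => ev (lM m') (fun x (m0 : M) =>
      ev (rN n) (fun (n' : N) t => ev (lN n') (fun z (n0 : N) => (F x z * G y t) *: f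
        m0 n0)))).
Proof.
move=> bF bG bf; rewrite /twist /tw2 ev_tswap; last by lin.
apply: eq_ev => m' y; rewrite ev_tswap; last by lin.
rewrite [RHS]exch_ev; apply: eq_ev => n' t; rewrite scaler_ev.
apply: eq_ev => x m0; rewrite scaler_ev; apply: eq_ev => z n0.
by rewrite scalerA mulrC.
Qed.

End TwistSweedler.

Variables om om' : A -> A -> K.
Hypothesis Hom : dual_2cocycle om om'.
Let bom := cocycle_bilin Hom.
Let bom' := cocycle_inv_bilin Hom.

Lemma deform_mulE a b :
  deform_mul om om' a b
  = twist (cop A) rcop (cop A) rcop om om' (@bmul K A) a b.
Proof.
have E1 a1 a2 a3 : sweedler3 b (fun b1 b2 b3 => (om a1 b1 * om' a3 b3) *: bmul a2 b2)
  = ev (cop A b) (fun b' b3 => ev (cop A b') (fun b1 b2 =>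
      (om a1 b1 * om' a3 b3) *: bmul a2 b2)).
  rewrite sweedler3_ev; last by lin.
  by rewrite -(cop_coassoc HA (F := fun b1 b2 b3 => (om a1 b1 * om' a3 b3) *: bmul a2
    b2)); last by lin.
rewrite /deform_mul (eq_sweedler3 _ E1) sweedler3_ev; last by lin.
by rewrite (cop_coassoc HA) ?twist_sweedler //; lin.
Qed.

Lemma deform_lactE a m :
  deform_lact om om' a m
  = twist (cop A) rcop l rco om om' (@lact K A E) a m.
Proof.
have E1 a1 a2 a3 : bisweedler m (fun x m0 y => (om a1 x * om' a3 y) *: lact a2 m0)
  = ev (r m) (fun m' y => ev (l m') (fun x m0 => (om a1 x * om' a3 y) *: lact a2 m0)).
  by rewrite bisweedler_ev //; lin.
rewrite /deform_lact (eq_sweedler3 _ E1) sweedler3_ev; last by lin.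
by rewrite (cop_coassoc HA) ?twist_sweedler //; lin.
Qed.

Lemma deform_ractE m a :
  deform_ract om om' m a
  = twist l rco (cop A) rcop om om' (@ract K A E) m a.
Proof.
have E1 a1 a2 a3 : bisweedler m (fun x m0 y => (om x a1 * om' y a3) *: ract m0 a2)
  = ev (r m) (fun m' y => ev (l m') (fun x m0 => (om x a1 * om' y a3) *: ract m0 a2)).
  by rewrite bisweedler_ev //; lin.
rewrite /deform_ract (eq_sweedler3 _ E1) sweedler3_ev; last by lin.
rewrite (cop_coassoc HA); last by lin.
rewrite twist_sweedler; try lin.
under [RHS]eq_ev => m' y do rewrite exch_ev.
rewrite [RHS]exch_ev; apply: eq_ev => a' a3.
under [RHS]eq_ev => m' y do rewrite exch_ev.
by rewrite [RHS]exch_ev.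
Qed.

End Deformation.

(** * The deformed calculus *)

Section DeformedTensor.
Context {K : fieldType} {A : @bialg_data K} {E : calculus_data A}.
Hypothesis HA : bialgebra A.
Hypothesis HE : bicovariant_bimodule E.
Variables om om' : A -> A -> K.
Hypothesis Hom : dual_2cocycle om om'.
Local Notation "a *A b" := (bmul a b) (at level 40, left associativity).
Local Notation "a *> m" := (lact a m) (at level 38, right associativity).
Local Notation "m <* a" := (ract m a) (at level 39, left associativity).
Local Notation l := (lcoact E).
Local Notation r := (rcoact E).
Local Notation Eo := (deform_calculus om om' E).
Local Notation tEE := (twist l rco l rco om om').
Local Notation tEE' := (twist l rco l rco om' om).
Local Notation xi := (xi (E := E) om om').
Implicit Types (a b c : A) (m n : E) (X : lmodType K).

Let bom := cocycle_bilin Hom.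
Let bom' := cocycle_inv_bilin Hom.
Let bicoA := bicomodule_A HA.
Let bicoE := bicomodule_E HE.

Lemma twistK X (f : E -> E -> X) m n : bilin f -> tEE (tEE' f) m n = f m n.
Proof. by move=> bf; apply: twist_comp => //; apply: cocycleK. Qed.

Lemma twistVK X (f : E -> E -> X) m n : bilin f -> tEE' (tEE f) m n = f m n.
Proof. by move=> bf; apply: twist_comp => //; apply: cocycleVK. Qed.

Lemma balanced_twist X (f : E -> E -> X) :
  balanced (E := E) f -> balanced (E := Eo) (tEE f).
Proof.
move=> [bf ff]; split; first exact: twist_bilin.
move=> m a n.
have -> : ract (c := Eo) m a = twist l rco (cop A) rcop om om' (@ract K A E) m a.
  exact: (deform_ractE HA HE Hom).
have -> : lact (c := Eo) a n = twist (cop A) rcop l rco om om' (@lact K A E) a n.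
  exact: (deform_lactE HA HE Hom).
by apply: (twist_assoc HA Hom bicoE bicoA bicoE); try exact: rco_lin; try solve [lin];
  [apply: bicovariant_ract | apply: bicovariant_lact | ].
Qed.

(** Needed for the inverse of [xi] to be well defined on the tensor square over A. By
    [twist_assoc_inv] balancing may be checked after twisting, where it becomes the hypothesis on
    f. *)
Lemma balanced_untwist X (f : E -> E -> X) :
  balanced (E := Eo) f -> balanced (E := E) (tEE' f).
Proof.
move=> [bf ff]; have bf' : bilin (tEE' f) by apply: twist_bilin.
split=> // m a n; move: m a n.
move=> m a n.
apply: (twist_assoc_inv HA Hom bicoE bicoA bicoE (k := l) (k' := l)
  (s := rco) (s' := rco)); try exact: rco_lin; try solve [lin].
- exact: (bicovariant_ract HA HE).
- exact: (bicovariant_lact HA HE).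
move=> {}m {}a {}n; rewrite !twistK //.
by rewrite -deform_ractE // -deform_lactE //; apply: ff.
Qed.

Lemma xi_tlift : xi = tlift (tEE (@tA K A E)).
Proof.
congr tlift; apply/funext => m; apply/funext => n.
  have E1 x m0 y : bisweedler n (fun z n0 t => (om x z * om' y t) *: tA m0 n0)
    = ev (r n) (fun n' t => ev (l n') (fun z n0 => (om x z * om' y t) *: tA (m0 : E) n0)).
    by rewrite bisweedler_ev //; lin.
  rewrite (_ : (fun x m0 y => _) = (fun x (m0 : E) y => ev (r n) (fun n' t =>
    ev (l n') (fun z n0 => (om x z * om' y t) *: tA m0 n0)))); last first.
    by do 3!apply/funext => ?; apply: E1.
  rewrite -> bisweedler_ev by lin.
by rewrite twist_sweedler //; lin.
Qed.

Lemma xiE m n : xi (tA (E := Eo) m n) = tEE (@tA K A E) m n.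
Proof.
rewrite xi_tlift.
have Hb : balanced (E := E) (@tA K A E) by split; [lin | exact: tA_bal].
exact: (@tlift_tA _ _ Eo _ (tEE (@tA K A E)) m n (balanced_twist Hb)).
Qed.

Lemma xi_lin : lin xi.
Proof.
rewrite xi_tlift.
have Hb : balanced (E := E) (@tA K A E) by split; [lin | exact: tA_bal].
exact: (@tlift_tA_lin _ _ Eo _ (tEE (@tA K A E)) (balanced_twist Hb)).
Qed.

Definition xi_inv : tensA E -> tensA Eo := tlift (tEE' (tA (E := Eo))).

Let balEo : balanced (E := Eo) (tA (E := Eo)).
Proof. by split; [exact: tA_bilin | exact: tA_bal]. Qed.

Lemma xi_invE m n : xi_inv (tA m n) = tEE' (tA (E := Eo)) m n.
Proof.
exact: (@tlift_tA _ _ E _ (tEE' (tA (E := Eo))) m n (balanced_untwist balEo)).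
Qed.

Lemma xi_inv_lin : lin xi_inv.
Proof.
exact: (@tlift_tA_lin _ _ E _ (tEE' (tA (E := Eo))) (balanced_untwist balEo)).
Qed.

Lemma xiK : cancel xi xi_inv.
Proof.
apply: (@tA_lin_ext _ _ Eo _ (fun x => xi_inv (xi x)) id).
- exact: (lin_comp xi_inv_lin xi_lin).
- exact: lin_id.
move=> m n; rewrite xiE.
apply: etrans (lin_twist _ _ _ _ _ _ _ _ _ xi_inv_lin) _.
apply: etrans (eq_twist _ _ _ _ _ _ _ _ xi_invE) _.
exact: (@twistK _ (tA (E := Eo)) m n (@tA_bilin _ _ Eo)).
Qed.

Lemma xi_invK : cancel xi_inv xi.
Proof.
apply: (@tA_lin_ext _ _ E _ (fun x => xi (xi_inv x)) id).
- exact: (lin_comp xi_lin xi_inv_lin).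
- exact: lin_id.
move=> m n; rewrite xi_invE.
apply: etrans (lin_twist _ _ _ _ _ _ _ _ _ xi_lin) _.
apply: etrans (eq_twist _ _ _ _ _ _ _ _ xiE) _.
exact: (@twistVK _ (@tA K A E) m n tA_bilin).
Qed.

Lemma finv_xi : Defs.finv xi =1 xi_inv.
Proof. exact: finv_eq xiK xi_invK. Qed.

End DeformedTensor.

(** * Covariance of twisted maps and the deformed bialgebra *)

Section ConjugateProduct.
Context {K : fieldType} {C : lmodType K} (D : C -> tensor C C).
Hypothesis LD : lin D.
Local Notation bilink F := (@bilin K _ _ K^o F).
Implicit Types X : lmodType K.
Context (M N Y : lmodType K) (l : M -> tensor C M) (l' : N -> tensor C N)
  (k : Y -> tensor C Y).
Hypotheses (Ll : lin l) (Ll' : lin l') (Lk : lin k).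
Hypotheses (cl : coassociative D l) (cl' : coassociative D l').
Local Notation D' := (fun c => tswap (D c)).

Lemma coassociative2 X (H : C -> C -> C -> C -> M -> N -> X) m n :
  (forall y1 y2 n, trilin (fun x1 x2 m => H x1 x2 y1 y2 m n)) ->
  (forall x1 x2 m, trilin (fun y1 y2 n => H x1 x2 y1 y2 m n)) ->
  ev (l m) (fun x m0 => ev (l' n) (fun y n0 =>
    ev (D x) (fun x1 x2 => ev (D y) (fun y1 y2 => H x1 x2 y1 y2 m0 n0))))
  = ev (l m) (fun x m0 => ev (l' n) (fun y n0 =>
    ev (l m0) (fun x' m1 => ev (l' n0) (fun y' n1 => H x x' y y' m1 n1)))).
Proof.
move=> H1 H2.
have L1 x1 y1 y2 m' n' : lin (fun x2 => H x1 x2 y1 y2 m' n').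
  exact: (trilin_lin2 (H1 y1 y2 n') x1 m').
have L2 x2 y1 y2 m' n' : lin (fun x1 => H x1 x2 y1 y2 m' n').
  exact: (trilin_lin1 (H1 y1 y2 n') x2 m').
have L3 x1 x2 y1 y2 n' : lin (fun m' => H x1 x2 y1 y2 m' n').
  exact: (trilin_lin3 (H1 y1 y2 n') x1 x2).
transitivity (ev (l m) (fun x m0 => ev (D x) (fun x1 x2 => ev (l' n) (fun y n0 =>
    ev (D y) (fun y1 y2 => H x1 x2 y1 y2 m0 n0))))).
  by apply: eq_ev => x m0; rewrite exch_ev.
rewrite -(cl (F := fun x1 x2 m0 => ev (l' n) (fun y n0 =>
    ev (D y) (fun y1 y2 => H x1 x2 y1 y2 m0 n0)))); last first.
  split=> [x1|x2 m0]; last by do 2!apply: lin_ev_fun => ? ?.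
  by apply: bilinI => ?; do 2!apply: lin_ev_fun => ? ?.
apply: eq_ev => x m0.
under eq_ev => x' m1.
  rewrite -(cl' (F := fun y1 y2 n0 => H x x' y1 y2 m1 n0)); last exact: H2.
  over.
by rewrite exch_ev.
Qed.

(** The coaction of the twist is F(x_1, y_1) x_2 y_2 (x) q(m_0, n_0). Inserting F' * F = eps between
    the two legs leaves the conjugated product F * mu * F' in the first and the twist of q by F in
    the second. This explains the two-sided form of the deformed product. *)
Lemma covariant_conj (mu : C -> C -> C) (F F' : C -> C -> K) (e : C -> K)
    (q : M -> N -> Y) :
  bilin mu -> bilink F -> bilink F' -> bilin q -> counitary e l -> counitary e l' ->
  cconv2 D F' F = (fun x y => e x * e y) ->
  covariant mu l l' k q ->
  covariant (tw2 D' D' F' (tw2 D D F mu)) l l' k (tw2 l l' F q).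
Proof.
move=> bmu bF bF' bq el el' FF cq X f m n bf.
have LD' : lin D' by lin.
have bmu' := tw2_bilin LD LD bF bmu.
rewrite (lin_tw2 l l' (g := fun y => ev (k y) f)); last by lin.
transitivity (ev (l m) (fun x m0 => ev (l' n) (fun y n0 =>
    ev (l m0) (fun x' m1 => ev (l' n0) (fun y' n1 => F x y *: f (mu x' y') (q m1 n1)))))).
  apply: eq_ev => x m0; apply: eq_ev => y n0; rewrite cq // scaler_ev.
  by apply: eq_ev => x' m1; rewrite scaler_ev.
rewrite -(coassociative2 (H := fun x x' y y' m n => F x y *: f (mu x' y') (q m n)));
  try by move=> *; lin.
transitivity (ev (l m) (fun x m0 => ev (l' n) (fun y n0 =>
    f (tw2 D D F mu x y) (tw2 l l' F' (tw2 l l' F q) m0 n0)))).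
  apply: eq_ev => x m0; apply: eq_ev => y n0.
  rewrite (tw2_comp cl cl') // FF (tw2_counit el el') //.
  by rewrite (lin_tw2 D D (g := fun z => f z (q m0 n0))); last by lin.
transitivity (ev (l m) (fun x m0 => ev (l' n) (fun y n0 =>
    ev (l m0) (fun x' m1 => ev (l' n0) (fun y' n1 =>
    F' x' y' *: f (tw2 D D F mu x y) (tw2 l l' F q m1 n1)))))).
  apply: eq_ev => x m0; apply: eq_ev => y n0.
  by rewrite (lin_tw2 l l' (g := f _)); last by lin.
have bQ := tw2_bilin Ll Ll' bF bq.
rewrite -(coassociative2 (H := fun x x' y y' m n => F' x' y' *: f (tw2 D D F mu x y)
  (tw2 l l' F q m n))); try by move=> *; lin.
apply: eq_ev => x m0; apply: eq_ev => y n0.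
rewrite (lin_tw2 D' D' (g := fun z => f z _)); last by lin.
rewrite /tw2 ev_tswap; last by lin.
by apply: eq_ev => x1 x2; rewrite ev_tswap //; lin.
Qed.

End ConjugateProduct.

Section TwistBicovariant.
Context {K : fieldType} {A : @bialg_data K}.
Hypothesis HA : bialgebra A.
Variables om om' : A -> A -> K.
Hypothesis Hom : dual_2cocycle om om'.
Context (M N Y : lmodType K) (l r : M -> tensor A M) (l' r' : N -> tensor A N)
  (k s : Y -> tensor A Y).
Hypotheses (HM : bicomodule l r) (HN : bicomodule l' r').
Hypotheses (Lk : lin k) (Ls : lin s).
Local Notation mul := (twist (cop A) rcop (cop A) rcop om om' (@bmul K A)).
Let bom := cocycle_bilin Hom.
Let bom' := cocycle_inv_bilin Hom.

(** Along l the twist by [om] conjugates the product, and along r the twist by [om'] does; in each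
    case the other half of the twist commutes with the coaction. Both conjugations yield the
    deformed product. *)
Lemma twist_bicovariant (p : M -> N -> Y) : bilin p ->
  bicovariant l r l' r' k s p ->
  covariant mul l l' k (twist l r l' r' om om' p) /\
  covariant mul r r' s (twist l r l' r' om om' p).
Proof.
case: HM HN => Ll Lr al ar el er c [Ll' Lr' al' ar' el' er' c'] bp [cl cr].
have bmu := bmul_bilin HA.
have Lrc := rcop_lin (A := A).
have c1 : commuting r l by move=> X F tF m; rewrite (c X (fun x y => F y x)) //; lin.
have c1' : commuting r' l' by move=> X F tF m; rewrite (c' X (fun x y => F y x)) //; lin.
have [cA _ _ _ _ _ cC] := bicomodule_A HA.
split=> X f m n bf.
  have cl1 : covariant (@bmul K A) l l' k (tw2 r r' om' p).
    exact: (tw2_covariant c1 c1').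
  have -> : twist l r l' r' om om' p m n = tw2 l l' om (tw2 r r' om' p) m n.
    by rewrite /twist (tw2C c c').
  under [RHS]eq_ev => x m0.
    under eq_ev => y n0.
      rewrite (_ : twist l r l' r' om om' p m0 n0 = tw2 l l' om (tw2 r r' om' p) m0 n0);
        last by rewrite /twist (tw2C c c').
      over.
    over.
  have LA : lin (cop A) by lin.
  have bq := tw2_bilin Lr Lr' bom' bp.
  exact: (covariant_conj LA Ll Ll' Lk al al' bmu bom bom' bq el el' (cocycleVK Hom) cl1).
have cr1 : covariant (@bmul K A) r r' s (tw2 l l' om p).
  exact: (tw2_covariant c c').
rewrite /twist.
have E1 : forall x y, tw2 rcop rcop om' (tw2 (cop A) (cop A) om (@bmul K A)) x y
    = tw2 (cop A) (cop A) om (tw2 rcop rcop om' (@bmul K A)) x y.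
  by move=> x y; rewrite (tw2C cC cC).
under [RHS]eq_ev => x m0 do under eq_ev => y n0 do rewrite E1.
have E2 c0 : tswap (rcop c0) = cop A c0.
  apply: tensor_ext => Z h bh; rewrite /rcop !ev_tswap //; lin.
have E3 : (fun c0 => tswap (rcop c0)) = cop A by apply/funext.
have := covariant_conj (D := rcop (A := A)) Lrc Lr Lr' Ls ar ar' (F := om') (F' := om)
  bmu bom' bom
  (tw2_bilin Ll Ll' bom bp) er er'.
rewrite E3; apply=> //.
rewrite cconv2_rcop //; exact: (cocycleVK Hom).
Qed.

End TwistBicovariant.

Section DeformedBialgebra.
Context {K : fieldType} {A : @bialg_data K}.
Hypothesis HA : bialgebra A.
Variables om om' : A -> A -> K.
Hypothesis Hom : dual_2cocycle om om'.
Local Notation "1A" := (bone A).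
Local Notation bilink F := (@bilin K _ _ K^o F).
Local Notation Ao := (deform_alg om om').
Local Notation mulo := (deform_mul om om').
Implicit Types (a b c : A) (M X : lmodType K).
Let bom := cocycle_bilin Hom.
Let bom' := cocycle_inv_bilin Hom.
Let bicoA := bicomodule_A HA.

Definition grouplike1 (D : A -> tensor A A) : Prop :=
  forall X (f : A -> A -> X), bilin f -> ev (D 1A) f = f 1A 1A.

Lemma cop_grouplike1 : grouplike1 (cop A).
Proof. by move=> X f bf; apply: ev_cop1. Qed.

Lemma rcop_grouplike1 : grouplike1 rcop.
Proof. by move=> X f bf; rewrite /rcop ev_tswap // (ev_cop1 HA) //; lin. Qed.

Lemma tw2_one1 M X (D : A -> tensor A A) (l : M -> tensor A M) (F : A -> A -> K)
    (f : A -> M -> X) m :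
  grouplike1 D -> lin l -> bilink F -> bilin f -> (forall a, F 1A a = eps A a) ->
  counitary (eps A) l -> tw2 D l F f 1A m = f 1A m.
Proof.
move=> D1 Ll bF bf F1 el; rewrite /tw2 D1; last by lin.
by under eq_ev => x m0 do rewrite F1; rewrite (el _ (f 1A)) //; lin.
Qed.

Lemma tw2_one2 M X (D : A -> tensor A A) (l : M -> tensor A M) (F : A -> A -> K)
    (f : M -> A -> X) m :
  grouplike1 D -> lin l -> bilink F -> bilin f -> (forall a, F a 1A = eps A a) ->
  counitary (eps A) l -> tw2 l D F f m 1A = f m 1A.
Proof.
move=> D1 Ll bF bf F1 el; rewrite /tw2 exch_ev D1; last by lin.
under eq_ev => x m0 do rewrite F1.
by rewrite (el _ (fun m0 => f m0 1A)) //; lin.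
Qed.

Lemma twist_one1 M X (l r : M -> tensor A M) (f : A -> M -> X) m :
  bicomodule l r -> bilin f -> twist (cop A) rcop l r om om' f 1A m = f 1A m.
Proof.
move=> [Ll Lr _ _ el er _] bf; have LA : lin (cop A) by lin.
rewrite /twist tw2_one1 //.
- exact: (tw2_one1 m cop_grouplike1 Ll bom bf (cocycle1l Hom) el).
- exact: rcop_grouplike1.
- exact: tw2_bilin.
- exact: (cocycle_inv1l HA Hom).
Qed.

Lemma twist_one2 M X (l r : M -> tensor A M) (f : M -> A -> X) m :
  bicomodule l r -> bilin f -> twist l r (cop A) rcop om om' f m 1A = f m 1A.
Proof.
move=> [Ll Lr _ _ el er _] bf; have LA : lin (cop A) by lin.
rewrite /twist tw2_one2 //.
- exact: (tw2_one2 m cop_grouplike1 Ll bom bf (cocycle1r Hom) el).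
- exact: rcop_grouplike1.
- exact: tw2_bilin.
- exact: (cocycle_inv1r HA Hom).
Qed.

Lemma deform_mul_fun :
  mulo = twist (cop A) rcop (cop A) rcop om om' (@bmul K A).
Proof. by do 2!apply/funext => ?; apply: deform_mulE. Qed.

Lemma deform_mul_bilin : bilin mulo.
Proof.
apply: (eq_bilin (deform_mulE HA Hom)); apply: twist_bilin => //; exact: bmul_bilin.
Qed.

Lemma deform_mulA a b c : mulo a (mulo b c) = mulo (mulo a b) c.
Proof.
have bmu := bmul_bilin HA; have Lrc := rcop_lin (A := A).
have bc := bicovariant_bmul HA.
rewrite deform_mul_fun.
apply/esym/(twist_assoc HA Hom bicoA bicoA bicoA (k := cop A) (s := rcop)
  (k' := cop A) (s' := rcop)) => //; try by lin.
by move=> x y z; rewrite (bmulA HA).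
Qed.

(** The coproduct is multiplicative by [twist_bicovariant] applied to the product of A, with the
    coproduct as coaction. The counit reduces the twisted product to the convolution [om] * [om'] =
    eps. *)
Lemma bialgebra_deform : bialgebra Ao.
Proof.
case: (HA) => [_ HC [_ c1 _ e1]].
have bmu := bmul_bilin HA; have bo := deform_mul_bilin.
split=> //; split=> //.
- exact: deform_mulA.
- by move=> a; rewrite /= (deform_mulE HA Hom) twist_one1 ?bmul1.
- by move=> a; rewrite /= (deform_mulE HA Hom) twist_one2 ?bmulr1.
- move=> a b.
  suff : cop A (mulo a b) = tprod mulo mulo (cop A a) (cop A b) by [].
  apply: tensor_ext => X f bf.
  rewrite ev_tprod //; have [cl _] := twist_bicovariant HA Hom bicoA bicoA
    (bico_ll bicoA) (bico_lr bicoA) bmu (bicovariant_bmul HA).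
  by rewrite deform_mul_fun cl.
- move=> a b; rewrite -[bmul a b]/(mulo a b) deform_mul_fun.
  have Le := lin_scalar (eps A).
  rewrite -[LHS]/(eps A _ : K^o) (lin_twist _ _ _ _ _ _ _ _ _ Le).
  have b2 : bilink (fun a b => eps A a * eps A b) by lin.
  have epsM m n : eps A (bmul m n) = eps A m * eps A n by apply: eps_mul.
  under (eq_twist (X := K^o)) => m n do rewrite epsM.
  rewrite /twist; under (eq_tw2 (X := K^o)) => m n.
    rewrite -[tw2 _ _ _ _ _ _]/(cconv2 (cop A) om (fun a b => eps A a * eps A b) m n).
    rewrite -cconv2_rcop // /cconv2 (tw2_counit (X := K^o) (bico_er bicoA) (bico_er
      bicoA)) //.
    over.
  rewrite -[LHS]/(cconv2 rcop om' om a b) cconv2_rcop //.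
  by rewrite (cocycleK Hom).
Qed.
End DeformedBialgebra.

Section ImageBicomodule.
Context {K : fieldType} {A : @bialg_data K}.
Hypothesis HA : bialgebra A.
Context (M N Y : lmodType K) (l r : M -> tensor A M) (l' r' : N -> tensor A N)
  (k s : Y -> tensor A Y).
Hypotheses (HM : bicomodule l r) (HN : bicomodule l' r').
Variable p : M -> N -> Y.
Hypothesis bp : bilin p.
Hypotheses (Lk : lin k) (Ls : lin s) (bc : bicovariant l r l' r' k s p).
Hypothesis p_ext : forall (X : lmodType K) (f g : Y -> X), lin f -> lin g ->
  (forall m n, f (p m n) = g (p m n)) -> forall y, f y = g y.

Lemma image_coassociative (D : A -> tensor A A) (l0 : M -> tensor A M) (l0' : N ->
  tensor A N)
    (k0 : Y -> tensor A Y) : lin D -> lin l0 -> lin l0' -> lin k0 ->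
  covariant (@bmul K A) D D D (@bmul K A) ->
  coassociative D l0 -> coassociative D l0' ->
  covariant (@bmul K A) l0 l0' k0 p -> coassociative D k0.
Proof.
move=> LD Ll Ll' Lk0 cm cl cl' cp X F tF; apply: p_ext; try by lin.
move=> m n; rewrite !cp; try by lin.
transitivity (ev (l0 m) (fun x m0 => ev (l0' n) (fun y n0 =>
    ev (l0 m0) (fun x' m1 => ev (l0' n0) (fun y' n1 => F (bmul x y) (bmul x' y') (p m1
      n1)))))).
  by do 2!apply: eq_ev => ? ?; rewrite cp //; lin.
rewrite -(coassociative2 cl cl' (H := fun x x' y y' m n => F (bmul x y) (bmul x' y') (p
  m n)));
  try by move=> *; lin.
by do 2!apply: eq_ev => ? ?; rewrite cm //; lin.
Qed.

Lemma image_counitary (l0 : M -> tensor A M) (l0' : N -> tensor A N)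
    (k0 : Y -> tensor A Y) : lin l0 -> lin l0' -> lin k0 ->
  counitary (eps A) l0 -> counitary (eps A) l0' ->
  covariant (@bmul K A) l0 l0' k0 p -> counitary (eps A) k0.
Proof.
move=> Ll Ll' Lk0 el el' cp X f y Lf; move: y; apply: p_ext => //; first by lin.
move=> m n; rewrite cp; last by lin.
rewrite -[RHS](tw2_counit (e := eps A) el el' (f := fun m n => f (p m n))); last by lin.
by do 2!apply: eq_ev => ? ?; rewrite (eps_mul HA).
Qed.

(** Each axiom is linear in the element of Y, so by [p_ext] it may be checked on p(m, n), where the
    coactions are products of those of m and n. *)
Lemma bicomodule_image : bicomodule k s.
Proof.
case: HM HN bc => Ll Lr al ar el er c [Ll' Lr' al' ar' el' er' c'] [cl cr].
have [LA LA' _ _ _ _ _] := bicomodule_A HA; have [cm cm'] := bicovariant_bmul HA.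
split=> //.
- exact: image_coassociative LA Ll Ll' Lk cm al al' cl.
- exact: image_coassociative LA' Lr Lr' Ls cm' ar ar' cr.
- exact: image_counitary Ll Ll' Lk el el' cl.
- exact: image_counitary Lr Lr' Ls er er' cr.
move=> X F tF; apply: p_ext; try by lin.
move=> m n; rewrite cl; last by lin.
rewrite cr; last by lin.
transitivity (ev (l m) (fun x m0 => ev (l' n) (fun z n0 =>
    ev (r m0) (fun y m1 => ev (r' n0) (fun t n1 => F (bmul x z) (bmul y t) (p m1 n1)))))).
  by do 2!apply: eq_ev => ? ?; rewrite cr //; lin.
rewrite (ev_commuting c c' (W := fun x z y t m n => F (bmul x z) (bmul y t) (p m n)));
  try by move=> *; lin.
by do 2!apply: eq_ev => ? ?; rewrite cl //; lin.
Qed.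

End ImageBicomodule.

(** * The deformed bimodule and its tensor square *)

Section DeformedBimodule.
Context {K : fieldType} {A : @bialg_data K} {E : calculus_data A}.
Hypothesis HA : bialgebra A.
Hypothesis HE : bicovariant_bimodule E.
Variables om om' : A -> A -> K.
Hypothesis Hom : dual_2cocycle om om'.
Local Notation "a *A b" := (bmul a b) (at level 40, left associativity).
Local Notation "1A" := (bone A).
Local Notation l := (lcoact E).
Local Notation r := (rcoact E).
Local Notation Eo := (deform_calculus om om' E).
Local Notation mulo := (deform_mul om om').
Local Notation lacto := (deform_lact om om' (E := E)).
Local Notation racto := (deform_ract om om' (E := E)).
Implicit Types (a b c : A) (m n : E) (X : lmodType K).

Let bom := cocycle_bilin Hom.
Let bom' := cocycle_inv_bilin Hom.
Let bicoA := bicomodule_A HA.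
Let bicoE := bicomodule_E HE.

Lemma deform_lact_fun : lacto = twist (cop A) rcop l rco om om' (@lact K A E).
Proof. by do 2!apply/funext => ?; apply: (deform_lactE HA HE Hom). Qed.

Lemma deform_ract_fun : racto = twist l rco (cop A) rcop om om' (@ract K A E).
Proof. by do 2!apply/funext => ?; apply: (deform_ractE HA HE Hom). Qed.

Lemma deform_lact_bilin : bilin lacto.
Proof. by rewrite deform_lact_fun; apply: twist_bilin => //; lin. Qed.

Lemma deform_ract_bilin : bilin racto.
Proof. by rewrite deform_ract_fun; apply: twist_bilin => //; lin. Qed.

Let LrE : lin (rco (E := E)) := rco_lin (E := E).
Let bvm := bicovariant_bmul HA.
Let bvl := bicovariant_lact HA HE.
Let bvr := bicovariant_ract HA HE.
Let bl := lact_bilin HE.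
Let br := ract_bilin HE.

Lemma deform_lactA a b m : lacto a (lacto b m) = lacto (mulo a b) m.
Proof.
rewrite deform_lact_fun (deform_mul_fun HA Hom).
apply/esym/(twist_assoc HA Hom bicoA bicoA bicoE (k := cop A) (s := rcop)
  (k' := l) (s' := rco)) => //; try by lin.
by move=> x y z; rewrite (lactA HE).
Qed.

Lemma deform_ractA m a b : racto (racto m a) b = racto m (mulo a b).
Proof.
rewrite deform_ract_fun (deform_mul_fun HA Hom).
apply/(twist_assoc HA Hom bicoE bicoA bicoA (k := l) (s := rco)
  (k' := cop A) (s' := rcop)) => //; try by lin.
by move=> x y z; rewrite (ractA HE).
Qed.

Lemma deform_lractA a m b : racto (lacto a m) b = lacto a (racto m b).
Proof.
rewrite deform_ract_fun deform_lact_fun.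
apply/(twist_assoc HA Hom bicoA bicoE bicoA (k := l) (s := rco)
  (k' := l) (s' := rco)) => //; try by lin.
by move=> x y z; rewrite (lractA HE).
Qed.

Let lco_lact a m : l (lacto a m) = tprod mulo lacto (cop A a) (l m).
Proof.
have bmo := deform_mul_bilin HA Hom; have blo := deform_lact_bilin.
apply: tensor_ext => X f bf; rewrite [RHS]ev_tprod //.
have [cl _] := twist_bicovariant HA Hom bicoA bicoE (bico_ll bicoE) LrE bl bvl.
by rewrite deform_lact_fun (deform_mul_fun HA Hom) cl.
Qed.

Let lco_ract m a : l (racto m a) = tprod mulo racto (l m) (cop A a).
Proof.
have bmo := deform_mul_bilin HA Hom; have bro := deform_ract_bilin.
apply: tensor_ext => X f bf; rewrite [RHS]ev_tprod //.
have [cl _] := twist_bicovariant HA Hom bicoE bicoA (bico_ll bicoE) LrE br bvr.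
by rewrite deform_ract_fun (deform_mul_fun HA Hom) cl.
Qed.

Let rco_lact a m : r (lacto a m) = tprod lacto mulo (cop A a) (r m).
Proof.
have bmo := deform_mul_bilin HA Hom; have blo := deform_lact_bilin.
apply: tensor_ext => X f bf; rewrite [RHS]ev_tprod //.
have [_ cr] := twist_bicovariant HA Hom bicoA bicoE (bico_ll bicoE) LrE bl bvl.
have bf' : bilin (fun x y => f y x) by lin.
have := cr _ _ a m bf'; rewrite -deform_lact_fun -(deform_mul_fun HA Hom).
rewrite /rco /rcop ev_tswap // => ->; rewrite ev_tswap; last by lin.
by apply: eq_ev => x a0; rewrite ev_tswap //; lin.
Qed.

Let rco_ract m a : r (racto m a) = tprod racto mulo (r m) (cop A a).
Proof.
have bmo := deform_mul_bilin HA Hom; have bro := deform_ract_bilin.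
apply: tensor_ext => X f bf; rewrite [RHS]ev_tprod //.
have [_ cr] := twist_bicovariant HA Hom bicoE bicoA (bico_ll bicoE) LrE br bvr.
have bf' : bilin (fun x y => f y x) by lin.
have := cr _ _ m a bf'; rewrite -deform_ract_fun -(deform_mul_fun HA Hom).
rewrite /rco /rcop ev_tswap // => ->; rewrite ev_tswap; last by lin.
by apply: eq_ev => x a0; rewrite ev_tswap //; lin.
Qed.

Lemma bimodule_deform : bicovariant_bimodule Eo.
Proof.
case: (HE) => [_ [l1 l2 _ _] [r1 r2 _ _] lr].
split=> //; split=> //.
- by split; [exact: deform_lact_bilin | exact: deform_ract_bilin].
- move=> m; split.
    rewrite -[LHS]/(lacto 1A m) deform_lact_fun (twist_one1 HA Hom) //.
    exact: (lact1 HE).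
  rewrite -[LHS]/(racto m 1A) deform_ract_fun (twist_one2 HA Hom) //.
  exact: (ract1 HE).
- exact: deform_lactA.
- by move=> a b m; exact: deform_ractA.
- by move=> a b m; exact: deform_lractA.
- by move=> a m; exact: lco_ract.
- by move=> a m; exact: rco_ract.
Qed.

Local Notation xi := (xi (E := E) om om').
Let HAo := bialgebra_deform HA Hom.
Let HEo := bimodule_deform.
Let tb := @tA_bilin K A E.
Let LrE2 : lin (rco2 (E := E)) := rco2_lin HA HE.
Let LlE2 : lin (lcoact2 (E := E)) := lcoact2_lin HA HE.
Let bvt := bicovariant_tA HA HE.

Let Lxi := xi_lin HA HE Hom.
Let xi_tA := xiE HA HE Hom.
Local Notation tlact2 := (twist (cop A) rcop (lcoact2 (E := E)) rco2 om om' (@lact2 K A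
  E)).
Local Notation tract2 := (twist (lcoact2 (E := E)) rco2 (cop A) rcop om om' (@ract2 K A
  E)).
Let bl2 := lact2_bilin HE.
Let br2 := ract2_bilin HE.

Lemma bicomodule_tA : bicomodule (lcoact2 (E := E)) rco2.
Proof. by apply: (bicomodule_image HA bicoE bicoE tb) => // X f g; apply: tA_lin_ext. Qed.

Let btl : bilin tlact2 := twist_bilin bicoA bicomodule_tA bom bom' bl2.
Let btr : bilin tract2 := twist_bilin bicomodule_tA bicoA bom bom' br2.

Lemma xi_lact2 a x : xi (lact2 (E := Eo) a x) = tlact2 a (xi x).
Proof.
move: x; apply: (@tA_lin_ext _ _ Eo _ (fun x => xi (lact2 (E := Eo) a x)) (fun x =>
  tlact2 a (xi x))).
- exact: (lin_comp Lxi (bilin_lin2 (lact2_bilin HEo) a)).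
- exact: (lin_comp (bilin_lin2 btl a) Lxi).
move=> m n; rewrite (lact2E HEo) !xi_tA.
rewrite -[lact _ _]/(lacto a m) deform_lact_fun.
apply/(twist_assoc HA Hom bicoA bicoE bicoE (k := l) (s := rco)
  (k' := lcoact2 (E := E)) (s' := rco2)) => //; try solve [lin].
by move=> x y z; rewrite (lact2E HE).
Qed.

Lemma xi_ract2 x a : xi (ract2 (E := Eo) x a) = tract2 (xi x) a.
Proof.
move: x; apply: (@tA_lin_ext _ _ Eo _ (fun x => xi (ract2 (E := Eo) x a)) (fun x =>
  tract2 (xi x) a)).
- exact: (lin_comp Lxi (bilin_lin1 (ract2_bilin HEo) a)).
- exact: (lin_comp (bilin_lin1 btr a) Lxi).
move=> m n; rewrite (ract2E HEo) !xi_tA.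
rewrite -[ract _ _]/(racto n a) deform_ract_fun.
apply/esym/(twist_assoc HA Hom bicoE bicoE bicoA (k := lcoact2 (E := E)) (s := rco2)
  (k' := l) (s' := rco)) => //; try solve [lin].
by move=> x y z; rewrite (ract2E HE).
Qed.

Lemma xi_lcoact2 x : tmap id xi (lcoact2 (E := Eo) x) = lcoact2 (xi x).
Proof.
move: x; apply: (@tA_lin_ext _ _ Eo (tensor A (tensA E)) (fun x => tmap id xi (lcoact2
  (E := Eo) x)) (fun x => lcoact2 (xi x))).
- exact: (lin_comp (tmap_lin (@lin_id _ A) Lxi) (lcoact2_lin HAo HEo)).
- exact: (lin_comp LlE2 Lxi).
move=> m n; apply: tensor_ext => X f bf.
rewrite ev_tmap //.
have Hb : @bilin K A (tensA Eo) X (fun x y => f x (xi y)) :=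
  bilinI (fun u => lin_comp (bilin_lin2 bf u) Lxi) (fun v => bilin_lin1 bf (xi v)).
apply: etrans (@ev_lcoact2 _ _ Eo HAo HEo X _ m n Hb) _.
have [cl _] := twist_bicovariant HA Hom bicoE bicoE LlE2 LrE2 tb bvt.
rewrite xi_tA cl //.
apply: eq_ev => x m0; apply: eq_ev => y n0.
by rewrite xi_tA -[bmul _ _]/(mulo x y) (deform_mul_fun HA Hom).
Qed.

Lemma xi_rcoact2 x : tmap xi id (rcoact2 (E := Eo) x) = rcoact2 (xi x).
Proof.
move: x; apply: (@tA_lin_ext _ _ Eo (tensor (tensA E) A) (fun x => tmap xi id (rcoact2
  (E := Eo) x)) (fun x => rcoact2 (xi x))).
- exact: (lin_comp (tmap_lin Lxi (@lin_id _ A)) (rcoact2_lin HAo HEo)).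
- exact: (lin_comp (rcoact2_lin HA HE) Lxi).
move=> m n; apply: tensor_ext => X f bf.
rewrite ev_tmap //.
have Hb : @bilin K (tensA Eo) A X (fun y x => f (xi y) x) :=
  bilinI (fun u => bilin_lin2 bf (xi u)) (fun v => lin_comp (bilin_lin1 bf v) Lxi).
apply: etrans (@ev_rcoact2 _ _ Eo HAo HEo X _ m n Hb) _.
have [_ cr] := twist_bicovariant HA Hom bicoE bicoE LlE2 LrE2 tb bvt.
have bT := twist_bilin bicoE bicoE bom bom' tb.
have bmo := deform_mul_bilin HA Hom.
have bf' : bilin (fun x y => f y x) by lin.
have := cr _ _ m n bf'; rewrite xi_tA.
under [RHS]eq_ev => m0 x do under eq_ev => n0 y do rewrite -(deform_mul_fun HA Hom).
under [X in _ -> X = _]eq_ev => m0 x do under eq_ev => n0 y do rewrite xi_tA.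
move: (twist l rco l rco om om' (@tA K A E)) bT => T bT {cr}.
rewrite /rco2 /rco; rewrite -> ev_tswap by exact: bf'.
move=> ->; rewrite -> ev_tswap by lin.
by apply: eq_ev => m0 x; rewrite -> ev_tswap by lin.
Qed.

End DeformedBimodule.

(** * The canonical braiding *)

Section Braiding.
Context {K : fieldType} {A : @bialg_data K} {E : calculus_data A}.
Hypothesis HA : bialgebra A.
Hypothesis HE : bicovariant_bimodule E.
Variable S : {linear A -> A}.
Hypothesis HS : antipode S.
Local Notation l := (lcoact E).
Local Notation r := (rcoact E).
Local Notation "1A" := (bone A).
Implicit Types (X : lmodType K).

Lemma tA_biinv_ext X (f g : tensA E -> X) : lin f -> lin g ->
  (forall a b v h, is_linv E v -> is_rinv E h ->
    f (lact2 a (ract2 (tA v h) b)) = g (lact2 a (ract2 (tA v h) b))) ->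
  forall x, f x = g x.
Proof.
move=> Lf Lg fg; apply: (tA_span_biinv HA HE HS) => [x y xE yE|a b v h Ih]; last exact:
  (fg a b v h (linvP v) Ih).
by rewrite (linD Lf) (linD Lg) xE yE.
Qed.

Section Covariance.
Variable sigma : tensA E -> tensA E.
Hypothesis sP : canonical_braiding sigma.
Let Ls : lin sigma. Proof. by case: sP. Qed.
Let sl a x : sigma (lact2 a x) = lact2 a (sigma x). Proof. by case: sP. Qed.
Let sr a x : sigma (ract2 x a) = ract2 (sigma x) a. Proof. by case: sP. Qed.
Let stA (v h : E) : is_linv E v -> is_rinv E h -> sigma (tA v h) = tA h v.
Proof. by case: sP => _ _ _; apply. Qed.

(** On a generator a (v (x) h) b the coaction of v is trivial and that of h stays in A (x) E_0, so
    the braiding flips v and h_0 as it flips v and h. *)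
Lemma braiding_lcoact2 X (f : A -> tensA E -> X) x : bilin f ->
  ev (lcoact2 (sigma x)) f = ev (lcoact2 x) (fun a x0 => f a (sigma x0)).
Proof.
move=> bf; move: x.
apply: (tA_biinv_ext (f := fun x => ev (lcoact2 (sigma x)) f)
  (g := fun x => ev (lcoact2 x) (fun a x0 => f a (sigma x0)))); try solve [lin].
move=> a b v h Iv Ih.
rewrite sl sr (stA Iv Ih).
do 2!rewrite -> (ev_lcoact2_lact2 HA HE) by lin.
apply: eq_ev => a1 a2.
do 2!rewrite -> (ev_lcoact2_ract2 HA HE) by lin.
do 2!rewrite -> (ev_lcoact2 HA HE) by lin.
rewrite exch_ev; do 2!rewrite -> (ev_linv Iv) by lin.
pose F y h0 := ev (cop A b) (fun b1 b2 =>
    f (bmul a1 (bmul (bmul 1A y) b1)) (lact2 a2 (ract2 (tA (h0 : E) v) b2))).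
pose G y h0 := ev (cop A b) (fun b1 b2 =>
    f (bmul a1 (bmul (bmul 1A y) b1)) (sigma (lact2 a2 (ract2 (tA v (h0 : E)) b2)))).
have bF : bilin F by rewrite /F; lin.
have bG : bilin G by rewrite /G; lin.
transitivity (ev (l h) F).
  by apply: eq_ev => y h0; rewrite /F (bmul1 HA) (bmulr1 HA).
apply: etrans (esym (ev_lcoact_rinv HA HE HS Ih bF)) _.
apply: etrans (ev_lcoact_rinv HA HE HS Ih bG).
apply: eq_ev => y h0; apply: eq_ev => b1 b2; rewrite sl sr stA //.
exact: (rproj_inv_rinv HA HE HS).
Qed.

Lemma braiding_rcoact2 X (f : tensA E -> A -> X) x : bilin f ->
  ev (rcoact2 (sigma x)) f = ev (rcoact2 x) (fun x0 a => f (sigma x0) a).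
Proof.
move=> bf; move: x.
apply: (tA_biinv_ext (f := fun x => ev (rcoact2 (sigma x)) f)
  (g := fun x => ev (rcoact2 x) (fun x0 a => f (sigma x0) a))); try solve [lin].
move=> a b v h Iv Ih.
rewrite sl sr (stA Iv Ih).
do 2!rewrite -> (ev_rcoact2_lact2 HA HE) by lin.
apply: eq_ev => a1 a2.
do 2!rewrite -> (ev_rcoact2_ract2 HA HE) by lin.
do 2!rewrite -> (ev_rcoact2 HA HE) by lin.
rewrite [RHS]exch_ev; do 2!rewrite -> (ev_rinv Ih) by lin.
pose F v0 y := ev (cop A b) (fun b1 b2 =>
    f (lact2 a1 (ract2 (tA h (v0 : E)) b1)) (bmul a2 (bmul (bmul y 1A) b2))).
pose G v0 y := ev (cop A b) (fun b1 b2 =>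
    f (sigma (lact2 a1 (ract2 (tA (v0 : E) h) b1))) (bmul a2 (bmul (bmul y 1A) b2))).
have bF : bilin F by rewrite /F; lin.
have bG : bilin G by rewrite /G; lin.
transitivity (ev (r v) F).
  by apply: eq_ev => y h0; rewrite /F (bmul1 HA) (bmulr1 HA).
apply: etrans (esym (ev_rcoact_linv HA HE HS Iv bF)) _.
apply: etrans (ev_rcoact_linv HA HE HS Iv bG).
apply: eq_ev => y h0; apply: eq_ev => b1 b2; rewrite sl sr stA //.
exact: (lproj_inv_linv HA HE HS).
Qed.

End Covariance.
End Braiding.

Section Equivariant.
Context {K : fieldType} {C : lmodType K}.
Implicit Types M N X : lmodType K.

Definition equivariant M' M (k : M' -> tensor C M') (l : M -> tensor C M) (s : M' -> M) :=
  forall X (h : C -> M -> X) m, bilin h ->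
    ev (l (s m)) h = ev (k m) (fun x m0 => h x (s m0)).

Lemma tw2_equivl M M' N X (l : M -> tensor C M) (k : M' -> tensor C M')
    (l' : N -> tensor C N) (s : M' -> M) (F : C -> C -> K) (f : M -> N -> X) m n :
  lin l' -> @bilin K _ _ K^o F -> bilin f ->
  equivariant k l s ->
  tw2 l l' F f (s m) n = tw2 k l' F (fun m n => f (s m) n) m n.
Proof. by move=> Ll' bF bf sk; rewrite /tw2 sk //; lin. Qed.

Lemma tw2_equivr M N N' X (l : M -> tensor C M) (l' : N -> tensor C N)
    (k : N' -> tensor C N') (s : N' -> N) (F : C -> C -> K) (f : M -> N -> X) m n :
  @bilin K _ _ K^o F -> bilin f ->
  equivariant k l' s ->
  tw2 l l' F f m (s n) = tw2 l k F (fun m n => f m (s n)) m n.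
Proof. by move=> bF bf sk; rewrite /tw2; apply: eq_ev => x m0; rewrite sk //; lin. Qed.

End Equivariant.

Section TwistEquivariant.
Context {K : fieldType} {A : @bialg_data K}.
Context (M M' N N' X : lmodType K) (l r : M -> tensor A M) (l' r' : N -> tensor A N)
  (k t : M' -> tensor A M') (k' t' : N' -> tensor A N').
Hypotheses (HM : bicomodule l r) (HN : bicomodule l' r').
Variables F G : A -> A -> K.
Hypotheses (bF : @bilin K _ _ K^o F) (bG : @bilin K _ _ K^o G).
Variable f : M -> N -> X.
Hypothesis bf : bilin f.
Let Ll := bico_ll HM.
Let Ll' := bico_ll HN.
Let Lr' := bico_lr HN.

Lemma twist_equivl (s : M' -> M) m n : equivariant k l s -> equivariant t r s ->
  twist l r l' r' F G f (s m) n = twist k t l' r' F G (fun m n => f (s m) n) m n.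
Proof.
move=> sl sr; have bf1 := tw2_bilin Ll Ll' bF bf; rewrite /twist.
apply: etrans (tw2_equivl m n Lr' bG bf1 sr) _; apply: eq_tw2 => m' n'.
exact: tw2_equivl m' n' Ll' bF bf sl.
Qed.

Lemma twist_equivr (s : N' -> N) m n : equivariant k' l' s -> equivariant t' r' s ->
  twist l r l' r' F G f m (s n) = twist l r k' t' F G (fun m n => f m (s n)) m n.
Proof.
move=> sl sr; have bf1 := tw2_bilin Ll Ll' bF bf; rewrite /twist.
apply: etrans (tw2_equivr r m n bG bf1 sr) _; apply: eq_tw2 => m' n'.
exact: (tw2_equivr l m' n' bF bf sl).
Qed.

End TwistEquivariant.

Section DeformedBraiding.
Context {K : fieldType} {A : @bialg_data K} {E : calculus_data A}.
Hypothesis HA : bialgebra A.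
Hypothesis HE : bicovariant_bimodule E.
Variable S : {linear A -> A}.
Hypothesis HS : antipode S.
Variables om om' : A -> A -> K.
Hypothesis Hom : dual_2cocycle om om'.
Local Notation l := (lcoact E).
Local Notation r := (rcoact E).
Local Notation l2 := (lcoact2 (E := E)).
Local Notation P := (lproj_inv (E := E) S).
Local Notation P' := (rproj_inv (E := E) S).
Local Notation Eo := (deform_calculus om om' E).
Local Notation lacto := (deform_lact om om' (E := E)).
Local Notation racto := (deform_ract om om' (E := E)).
Local Notation xi := (xi (E := E) om om').
Local Notation xiV := (xi_inv (E := E) om om').
Local Notation tlact2 := (twist (cop A) rcop (lcoact2 (E := E)) rco2 om om' (@lact2 K A
  E)).
Local Notation tract2 := (twist (lcoact2 (E := E)) rco2 (cop A) rcop om om' (@ract2 K A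
  E)).
Implicit Types (X : lmodType K).

Let bl2 := lact2_bilin HE.
Let br2 := ract2_bilin HE.
Let tb := @tA_bilin K A E.
Let bom := cocycle_bilin Hom.
Let bom' := cocycle_inv_bilin Hom.
Let HEo := bimodule_deform HA HE Hom.
Let Lxi := xi_lin HA HE Hom.
Let LxiV := xi_inv_lin HA HE Hom.
Let xK := xiK HA HE Hom.
Let xVK := xi_invK HA HE Hom.
Let bicoA := bicomodule_A HA.
Let bicoE := bicomodule_E HE.
Let bicoT := bicomodule_tA HA HE.

Section Braid.
Variable sigma : tensA E -> tensA E.
Hypothesis sP : canonical_braiding sigma.
Let Ls : lin sigma. Proof. by case: sP. Qed.
Let stA (v h : E) : is_linv E v -> is_rinv E h -> sigma (tA v h) = tA h v.
Proof. by case: sP => _ _ _; apply. Qed.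
Let sl a x : sigma (lact2 a x) = lact2 a (sigma x). Proof. by case: sP. Qed.
Let sr a x : sigma (ract2 x a) = ract2 (sigma x) a. Proof. by case: sP. Qed.

Lemma braiding_lco2 : equivariant l2 l2 sigma.
Proof. by move=> X h m bh; apply: (braiding_lcoact2 HA HE HS sP). Qed.

Lemma braiding_rco2 : equivariant (rco2 (E := E)) (rco2 (E := E)) sigma.
Proof.
move=> X f x bf; rewrite /rco2; rewrite -> ev_tswap by exact: bf.
rewrite -> (braiding_rcoact2 HA HE HS sP) by lin.
by rewrite -> ev_tswap by lin.
Qed.

Lemma braiding_tlact2 a x : sigma (tlact2 a x) = tlact2 a (sigma x).
Proof.
rewrite (lin_twist _ _ _ _ _ _ _ _ _ Ls); apply/esym.
apply: etrans (twist_equivr bicoA bicoT bom bom' bl2 a x braiding_lco2 braiding_rco2) _.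
by apply: eq_twist => m n; exact: (esym (sl m n)).
Qed.

Lemma braiding_tract2 x a : sigma (tract2 x a) = tract2 (sigma x) a.
Proof.
rewrite (lin_twist _ _ _ _ _ _ _ _ _ Ls); apply/esym.
apply: etrans (twist_equivl bicoT bicoA bom bom' br2 x a braiding_lco2 braiding_rco2) _.
by apply: eq_twist => m n; exact: (esym (sr n m)).
Qed.

Let rinv_twist v h : is_rinv E h -> twist l rco l rco om om' (@tA K A E) v h = tw2 l l
  om (@tA K A E) v h.
Proof.
move=> Ih; rewrite /twist {1}/tw2.
have bT := tw2_bilin (bico_ll bicoE) (bico_ll bicoE) bom tb.
transitivity (ev (rco v) (fun y v0 => eps A y *: tw2 l l om (@tA K A E) v0 h)).
  apply: eq_ev => y v0; rewrite {1}/rco; rewrite -> ev_tswap by lin.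
  rewrite -> (ev_rinv Ih) by lin.
  cbv beta; rewrite (cocycle_inv1r HA Hom).
  reflexivity.
exact: (bico_er bicoE v (bilin_lin1 bT h)).
Qed.

Let rinv_twistl v h : is_rinv E h -> twist l rco l rco om om' (@tA K A E) h v = tw2 l l
  om (@tA K A E) h v.
Proof.
move=> Ih; rewrite /twist {1}/tw2.
have bT := tw2_bilin (bico_ll bicoE) (bico_ll bicoE) bom tb.
rewrite {1}/rco; rewrite -> ev_tswap by lin.
rewrite -> (ev_rinv Ih) by lin.
transitivity (ev (rco v) (fun y v0 => eps A y *: tw2 l l om (@tA K A E) h v0)).
  by apply: eq_ev => y v0; rewrite (cocycle_inv1l HA Hom); reflexivity.
exact: (bico_er bicoE v (bilin_lin2 bT h)).
Qed.

Lemma twist_linv v h : is_linv E v -> tw2 l l om (@tA K A E) v h = tA v h.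
Proof.
move=> Iv; rewrite /tw2; rewrite -> (ev_linv Iv) by lin.
under eq_ev => y h0 do (cbv beta; rewrite (cocycle1l Hom)).
exact: (lcoact_counit HE h (bilin_lin2 tb v)).
Qed.

Let linv_twr v h : is_linv E v -> tw2 l l om (@tA K A E) h v = tA h v.
Proof.
move=> Iv; rewrite /tw2 exch_ev; rewrite -> (ev_linv Iv) by lin.
under eq_ev => y h0 do (cbv beta; rewrite (cocycle1r Hom)).
exact: (lcoact_counit HE h (bilin_lin1 tb v)).
Qed.

(** Each functional meets the unit: [om] through the trivial left coaction of v, [om'] through the
    trivial right coaction of h. Normalisation leaves counits. Hence the flip survives conjugation
    by [xi]. *)
Lemma xi_linv_rinv v h : is_linv E v -> is_rinv E h -> xi (tA (E := Eo) v h) = tA v h.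
Proof. by move=> Iv Ih; exact: etrans (xiE HA HE Hom v h) (etrans (rinv_twist v Ih)
  (twist_linv h Iv)). Qed.

Lemma xi_rinv_linv v h : is_linv E v -> is_rinv E h -> xi (tA (E := Eo) h v) = tA h v.
Proof. by move=> Iv Ih; exact: etrans (xiE HA HE Hom h v) (etrans (rinv_twistl v Ih)
  (linv_twr h Iv)). Qed.

Lemma deform_braiding : canonical_braiding (E := Eo) (fun x => xiV (sigma (xi x))).
Proof.
split.
- exact: (lin_comp LxiV (lin_comp Ls Lxi)).
- move=> a x; rewrite (xi_lact2 HA HE Hom) braiding_tlact2.
  apply: (can_inj xK); apply: etrans (xVK _) (esym _).
  exact: etrans (xi_lact2 HA HE Hom a _) (congr1 (tlact2 a) (xVK _)).
- move=> a x; rewrite (xi_ract2 HA HE Hom) braiding_tract2.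
  apply: (can_inj xK); apply: etrans (xVK _) (esym _).
  exact: etrans (xi_ract2 HA HE Hom _ a) (congr1 (fun y => tract2 y a) (xVK _)).
move=> v h Iv Ih; rewrite (xi_linv_rinv Iv Ih) (stA Iv Ih) -(xi_rinv_linv Iv Ih).
exact: xK.
Qed.

End Braid.

Let bal := lact_bilin HE.
Let bar := ract_bilin HE.
Let blo := deform_lact_bilin HA HE Hom.
Let bro := deform_ract_bilin HA HE Hom.

(** Untwisting the action: [om'] sees only the trivial left coaction of v and becomes a counit,
    while [om] gives scalars and v_0 remains left-invariant. So a v is a combination of deformed
    multiples of left-invariants. *)
Let lact_undeform a (v : E) : is_linv E v ->
  lact a v = ev (rcop a) (fun y a' => ev (r v) (fun v0 t => om y t *: lacto a' (P v0))).
Proof.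
move=> Iv; have bT : bilin (tw2 (cop A) l om' lacto) by apply: tw2_bilin; lin.
transitivity (twist (cop A) rcop l rco om' om lacto a v).
  rewrite (deform_lact_fun HA HE Hom).
  by apply/esym/(twist_comp bicoA bicoE _ _ bom' bom (cocycleVK Hom) bal).
rewrite /twist {1}/tw2; apply: eq_ev => y a'.
rewrite /rco; rewrite -> ev_tswap by lin.
pose F v0 t := om y t *: tw2 (cop A) l om' lacto a' v0.
have bF : bilin F by rewrite /F; lin.
apply: etrans (esym (ev_rcoact_linv HA HE HS Iv bF)) _.
apply: eq_ev => v0 t; rewrite /F; congr (_ *: _).
have Ip := lproj_inv_linv HA HE HS v0.
rewrite /tw2.
transitivity (ev (cop A a') (fun x a'' => eps A x *: lacto a'' (P v0))).
  apply: eq_ev => x a''; rewrite -> (ev_linv Ip) by lin.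
  by rewrite (cocycle_inv1r HA Hom).
exact: (cop_counitl HA a' (bilin_lin1 blo (P v0))).
Qed.

Let ract_undeform (h : E) b : is_rinv E h ->
  ract h b = ev (l h) (fun x h0 => ev (cop A b) (fun b1 b' => om' x b1 *: racto (P' h0)
    b')).
Proof.
move=> Ih; have bT : bilin (tw2 l (cop A) om' racto) by apply: tw2_bilin; lin.
transitivity (twist l rco (cop A) rcop om' om racto h b).
  rewrite (deform_ract_fun HA HE Hom).
  by apply/esym/(twist_comp bicoE bicoA _ _ bom' bom (cocycleVK Hom) bar).
transitivity (tw2 l (cop A) om' racto h b).
  rewrite /twist {1}/tw2 /rco; rewrite -> ev_tswap by lin.
  rewrite -> (ev_rinv Ih) by lin.
  transitivity (ev (rcop b) (fun y b' => eps A y *: tw2 l (cop A) om' racto h b')).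
    by apply: eq_ev => y b'; rewrite (cocycle1l Hom).
  exact: (bico_er bicoA b (bilin_lin2 bT h)).
pose F x h0 := ev (cop A b) (fun b1 b' => om' x b1 *: racto (h0 : E) b').
have bF : bilin F by rewrite /F; lin.
exact: (esym (ev_lcoact_rinv HA HE HS Ih bF)).
Qed.

(** The counterpart of [calculus_span] for the deformed actions, obtained by untwisting instead of
    from an antipode. *)
Lemma deform_span (Q : E -> Prop) :
  (forall m n, Q m -> Q n -> Q (m + n)) ->
  (forall a v, is_linv E v -> Q (lacto a v)) -> forall m, Q m.
Proof.
move=> QD Qa; have Q0 : Q 0.
  rewrite -(lin_zero (bilin_lin1 blo (P 0))); apply: Qa.
  exact: (lproj_inv_linv HA HE HS).
apply: (calculus_span HA HE HS) => // a v; rewrite (lact_undeform a (linvP v)).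
apply: ev_ind => // y a'; apply: ev_ind => // v0 t.
rewrite -(linZ (bilin_lin1 blo (P v0))); apply: Qa.
exact: (lproj_inv_linv HA HE HS).
Qed.

Lemma deform_span_rinv (Q : E -> Prop) :
  (forall m n, Q m -> Q n -> Q (m + n)) ->
  (forall h b, is_rinv E h -> Q (racto h b)) -> forall m, Q m.
Proof.
move=> QD Qa; have Q0 : Q 0.
  rewrite -(lin_zero (bilin_lin2 bro (P' 0))); apply: Qa.
  exact: (rproj_inv_rinv HA HE HS).
apply: (calculus_span_rinv HA HE HS) => // b h Ih; rewrite (ract_undeform b Ih).
apply: ev_ind => // x h0; apply: ev_ind => // b1 b'.
rewrite -(linZ (bilin_lin2 bro (P' h0))); apply: Qa.
exact: (rproj_inv_rinv HA HE HS).
Qed.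

(** Identifies the braiding that comes with an arbitrary Levi-Civita connection on the deformed side
    with the conjugate of [sigma]. *)
Lemma deform_braiding_unique (s s' : tensA Eo -> tensA Eo) :
  canonical_braiding s -> canonical_braiding s' -> s =1 s'.
Proof.
move=> [Ls sl sr st] [Ls' sl' sr' st'].
apply: (@tA_lin_ext _ _ Eo _ s s' Ls Ls') => m n; move: n m.
have bo := @tA_bilin _ _ Eo.
have add (m : E) : lin (fun n : E => s (tA (E := Eo) m n)).
  exact: (lin_comp Ls (bilin_lin2 bo m)).
have add' (m : E) : lin (fun n : E => s' (tA (E := Eo) m n)).
  exact: (lin_comp Ls' (bilin_lin2 bo m)).
have addl (n : E) : lin (fun m : E => s (tA (E := Eo) m n)).
  exact: (lin_comp Ls (bilin_lin1 bo n)).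
have addl' (n : E) : lin (fun m : E => s' (tA (E := Eo) m n)).
  exact: (lin_comp Ls' (bilin_lin1 bo n)).
apply: (@deform_span_rinv (fun n => forall m, s (tA (E := Eo) m n) = s' (tA (E := Eo) m
  n))).
  move=> n n' En En' m.
  exact: etrans (linD (add m) n n') (etrans (f_equal2 +%R (En m) (En' m)) (esym (linD
    (add' m) n n'))).
move=> h b Ih.
apply: (@deform_span (fun m => s (tA (E := Eo) m (racto h b)) = s' (tA (E := Eo) m
  (racto h b)))).
  move=> m m' Em Em'.
  exact: etrans (linD (addl _) m m') (etrans (f_equal2 +%R Em Em') (esym (linD (addl'
    _) m m'))).
move=> a v Iv.
have -> : tA (E := Eo) (lacto a v) (racto h b)
  = lact2 (E := Eo) a (ract2 (E := Eo) (tA (E := Eo) v h) b).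
  exact: esym (etrans (congr1 _ (ract2E HEo v h b)) (lact2E HEo a v (racto h b))).
have yE := etrans (st v h Iv Ih) (esym (st' v h Iv Ih)).
move: (tA (E := Eo) v h) yE => y yE.
have zE : s (ract2 (E := Eo) y b) = s' (ract2 (E := Eo) y b).
  apply: etrans (sr b y) _; apply: etrans (esym (sr' b y)).
  exact: (congr1 (fun y => ract2 (E := Eo) y b) yE).
move: (ract2 (E := Eo) y b) zE => z zE.
apply: etrans (sl a z) _; apply: etrans (esym (sl' a z)).
exact: (congr1 (lact2 (E := Eo) a) zE).
Qed.

End DeformedBraiding.

(** * Connections and torsion *)

Section Torsion.
Context {K : fieldType} {A : @bialg_data K} {E : calculus_data A}.
Variables (sigma : tensA E -> tensA E) (nabla : E -> tensA E).
Hypotheses (Ls : lin sigma) (Ln : lin nabla).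

Lemma span_fixed (V : lmodType K) (s : V -> V) : lin s ->
  forall x, Defs.span [set x | s x = x]%classic x -> s x = x.
Proof.
move=> Ls' x /(_ [set x | s x = x]%classic); apply=> [|a u v su sv|//] /=; first exact:
  lin_zero.
by rewrite Ls' su sv.
Qed.

(** The fixed points of sigma already form a subspace, so being zero in Omega^2 means being fixed;
    by linearity, single terms a db suffice. *)
Lemma torsionlessP : torsionless nabla sigma <->
  forall a b, let t := nabla (lact a (diff E b)) + tA (diff E a) (diff E b) in
    sigma t = t.
Proof.
have wD x y : wedge sigma (x + y) = wedge sigma x + wedge sigma y by apply: lprojD.
have w0 : wedge sigma 0 = 0 by apply: (linear0 (lproj _)).
split=> [tn a b /=|tn s].
  have := tn [:: (a, b)]; rewrite !big_seq1 /= -wD -w0 => /lproj_eq.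
  by rewrite subr0; apply: span_fixed.
rewrite (lin_sum Ln) (big_morph _ wD w0) -big_split /=.
rewrite big1 // => p _; rewrite -wD -w0; apply/lproj_eq; rewrite subr0.
by apply: spanS; apply: tn.
Qed.

End Torsion.

Section CovariantMaps.
Context {K : fieldType} {A : @bialg_data K} {E : calculus_data A}.
Variable N : E -> tensA E.
Hypotheses (LN : lin N) (lN : left_covariant N) (rN : right_covariant N).

Lemma left_covariant_lco : equivariant (lcoact E) (lcoact2 (E := E)) N.
Proof. by move=> X h m bh; rewrite -lN; rewrite -> (ev_tmap (lcoact E m) (@lin_id K A)
  LN bh). Qed.

Lemma right_covariant_rco : equivariant (rco (E := E)) (rco2 (E := E)) N.
Proof.
move=> X h m bh; rewrite /rco2 /rco; rewrite -> ev_tswap by exact: bh.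
rewrite -rN; rewrite -> (ev_tmap (rcoact E m) LN (@lin_id K A)) by lin.
by rewrite -> ev_tswap by lin.
Qed.

End CovariantMaps.

Section TransportConnection.
Context {K : fieldType} {A : @bialg_data K} {E : calculus_data A}.
Hypothesis HA : bialgebra A.
Hypothesis HE : bicovariant_bimodule E.
Variable S : {linear A -> A}.
Hypothesis HS : antipode S.
Hypothesis dl : forall a, lcoact E (diff E a) = tmap id (diff E) (cop A a).
Hypothesis dr : forall a, rcoact E (diff E a) = tmap (diff E) id (cop A a).
Variables om om' : A -> A -> K.
Hypothesis Hom : dual_2cocycle om om'.
Local Notation l := (lcoact E).
Local Notation r := (rcoact E).
Local Notation l2 := (lcoact2 (E := E)).
Local Notation d := (diff E).
Local Notation Eo := (deform_calculus om om' E).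
Local Notation lacto := (deform_lact om om' (E := E)).
Local Notation racto := (deform_ract om om' (E := E)).
Local Notation xi := (xi (E := E) om om').
Local Notation xiV := (xi_inv (E := E) om om').
Implicit Types (M N X : lmodType K).

Let br2 := ract2_bilin HE.
Let tb := @tA_bilin K A E.
Let bom := cocycle_bilin Hom.
Let bom' := cocycle_inv_bilin Hom.
Let Lxi := xi_lin HA HE Hom.
Let LxiV := xi_inv_lin HA HE Hom.
Let xK := xiK HA HE Hom.
Let xVK := xi_invK HA HE Hom.
Let bicoA := bicomodule_A HA.
Let bicoE := bicomodule_E HE.
Let bicoT := bicomodule_tA HA HE.

Lemma twist_inj M N X (l1 r1 : M -> tensor A M) (l2 r2 : N -> tensor A N)
    (f g : M -> N -> X) : bicomodule l1 r1 -> bicomodule l2 r2 -> bilin f -> bilin g ->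
  (forall m n, twist l1 r1 l2 r2 om om' f m n = twist l1 r1 l2 r2 om om' g m n) <->
  (forall m n, f m n = g m n).
Proof.
move=> HM HN bf bg; split=> fg m n; last exact: eq_twist.
rewrite -(twist_comp HM HN _ _ bom' bom (cocycleVK Hom) bf).
rewrite -(twist_comp HM HN _ _ bom' bom (cocycleVK Hom) bg).
exact: eq_twist.
Qed.

Lemma twistD M N X (l1 r1 : M -> tensor A M) (l2 r2 : N -> tensor A N) F G
    (f g : M -> N -> X) m n :
  twist l1 r1 l2 r2 F G (fun m n => f m n + g m n) m n
  = twist l1 r1 l2 r2 F G f m n + twist l1 r1 l2 r2 F G g m n.
Proof.
rewrite /twist /tw2 ev.unlock -big_split; apply: eq_bigr => i _ /=.
rewrite -big_split; apply: eq_bigr => j _ /=; rewrite -scalerDr; congr (_ *: _).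
rewrite -big_split; apply: eq_bigr => p _ /=.
rewrite -big_split; apply: eq_bigr => q _ /=.
by rewrite -scalerDr.
Qed.

Lemma diff_lco : equivariant (cop A) l d.
Proof. by move=> X h a bh; rewrite dl ev_tmap //; lin. Qed.

Lemma diff_rco : equivariant rcop (rco (E := E)) d.
Proof.
move=> X h a bh; rewrite /rcop /rco ev_tswap // dr ev_tmap; try lin.
by rewrite ev_tswap //; lin.
Qed.

Variable N' : E -> tensA Eo.
Hypothesis LN' : lin N'.
Let N (m : E) : tensA E := xi (N' m).
Let LN : lin N. Proof. exact: (lin_comp Lxi LN'). Qed.

Lemma transport_left_covariant :
  left_covariant (E := Eo) N' <-> left_covariant N.
Proof.
have E1 m : tmap id xi (tmap id N' (l m)) = tmap id N (l m).
  apply: tensor_ext => X f bf.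
  rewrite -> (ev_tmap (tmap id N' (l m)) (@lin_id K A) Lxi bf).
  have b1 : @bilin K A (tensA Eo) X (fun x y => f x (xi y)) :=
    bilinI (fun u => lin_comp (bilin_lin2 bf u) Lxi) (fun v => bilin_lin1 bf (xi v)).
  rewrite -> (ev_tmap (l m) (@lin_id K A) LN' b1).
  by rewrite -> (ev_tmap (l m) (@lin_id K A) LN bf).
have E2 : cancel (tmap (M := A) (N := tensA Eo) id xi) (tmap id xiV).
  move=> t; apply: tensor_ext => X f bf.
  rewrite -> (ev_tmap _ (@lin_id K A) LxiV bf).
  have b1 : @bilin K A (tensA E) X (fun x y => f x (xiV y)) :=
    bilinI (fun u => lin_comp (bilin_lin2 bf u) LxiV) (fun v => bilin_lin1 bf (xiV v)).
  apply: etrans (ev_tmap t (@lin_id K A) Lxi b1) _.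
  by apply: eq_ev => x y; exact: (congr1 (f x) (xK y)).
have E3 m := xi_lcoact2 HA HE Hom (N' m).
split=> H m.
  apply: etrans (esym (E1 m)) _; apply: etrans _ (E3 m).
  exact: (congr1 _ (H m)).
apply: (can_inj E2); apply: etrans (E1 m) _; apply: etrans (H m) _.
exact: (esym (E3 m)).
Qed.

Lemma transport_right_covariant :
  right_covariant (E := Eo) N' <-> right_covariant N.
Proof.
have E1 m : tmap xi id (tmap N' id (r m)) = tmap N id (r m).
  apply: tensor_ext => X f bf.
  rewrite -> (ev_tmap (tmap N' id (r m)) Lxi (@lin_id K A) bf).
  have b1 : @bilin K (tensA Eo) A X (fun x y => f (xi x) y) :=
    bilinI (fun u => bilin_lin2 bf (xi u)) (fun v => lin_comp (bilin_lin1 bf v) Lxi).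
  rewrite -> (ev_tmap (r m) LN' (@lin_id K A) b1).
  by rewrite -> (ev_tmap (r m) LN (@lin_id K A) bf).
have E2 : cancel (tmap (M := tensA Eo) (N := A) xi id) (tmap xiV id).
  move=> t; apply: tensor_ext => X f bf.
  rewrite -> (ev_tmap _ LxiV (@lin_id K A) bf).
  have b1 : @bilin K (tensA E) A X (fun x y => f (xiV x) y) :=
    bilinI (fun u => bilin_lin2 bf (xiV u)) (fun v => lin_comp (bilin_lin1 bf v) LxiV).
  apply: etrans (ev_tmap t Lxi (@lin_id K A) b1) _.
  by apply: eq_ev => x y; exact: (congr1 (fun u => f u y) (xK x)).
have E3 m := xi_rcoact2 HA HE Hom (N' m).
split=> H m.
  apply: etrans (esym (E1 m)) _; apply: etrans _ (E3 m).
  exact: (congr1 _ (H m)).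
apply: (can_inj E2); apply: etrans (E1 m) _; apply: etrans (H m) _.
exact: (esym (E3 m)).
Qed.

Hypotheses (lN : left_covariant N) (rN : right_covariant N).

Let nabla_lco := left_covariant_lco LN lN.
Let nabla_rco := right_covariant_rco LN rN.

Lemma transport_connection : connection (E := Eo) N' <-> connection N.
Proof.
pose f (m : E) a := N (ract m a); pose g (m : E) a := ract2 (N m) a + tA m (d a).
have bf : bilin f by rewrite /f; lin.
have bg : bilin g by rewrite /g; lin.
have fE m a : xi (N' (racto m a)) = twist l rco (cop A) rcop om om' f m a.
  rewrite (deform_ract_fun HA HE Hom).
  exact: (lin_twist _ _ _ _ _ _ _ _ _ LN).
(* Bicovariance of [N] and of d moves the twists of [ract2] and [tA] from the arguments N m and d a
   to m and a. *)
have gE m a : xi (ract2 (E := Eo) (N' m) a + tA (E := Eo) m (d a))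
    = twist l rco (cop A) rcop om om' g m a.
  apply: etrans (linD Lxi _ _) _; apply: etrans _ (esym (twistD _ _ _ _ _ _ _ _ _ _)).
  congr (_ + _).
    apply: etrans (xi_ract2 HA HE Hom (N' m) a) _.
    exact: (twist_equivl bicoT bicoA bom bom' br2 m a nabla_lco nabla_rco).
  apply: etrans (xiE HA HE Hom m (d a)) _.
  exact: (twist_equivr bicoE bicoE bom bom' tb m a diff_lco diff_rco).
have [tfg fgt] := twist_inj bicoE bicoA bf bg.
split; case=> _ H.
  split; first exact: LN.
  apply: tfg => m a; apply: etrans (esym (fE m a)) _; apply: etrans _ (gE m a).
  exact: (congr1 xi (H m a)).
split; first exact: LN'.
move=> m a; apply: (can_inj xK); apply: etrans (fE m a) _.
apply: etrans _ (esym (gE m a)); exact: fgt.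
Qed.

Variable sigma : tensA E -> tensA E.
Hypothesis sP : canonical_braiding sigma.

Lemma transport_torsionless :
  torsionless (E := Eo) N' (fun x => xiV (sigma (xi x))) <-> torsionless N sigma.
Proof.
have Ls : lin sigma by case: sP.
have Lso : lin (fun x => xiV (sigma (xi x))) by exact: (lin_comp LxiV (lin_comp Ls Lxi)).
pose T a b := N (lact a (d b)) + tA (d a) (d b).
have bT : bilin T by rewrite /T; lin.
have b1 : bilin (fun a m => N (lact a m)) by lin.
have b2 : bilin (fun a m => tA (d a) m) by lin.
have b3 : bilin (fun a b => sigma (T a b)) by lin.
have TE a b : xi (N' (lacto a (d b)) + tA (E := Eo) (d a) (d b))
   = twist (cop A) rcop (cop A) rcop om om' T a b.
  apply: etrans (linD Lxi _ _) _; apply: etrans _ (esym (twistD _ _ _ _ _ _ _ _ _ _)).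
  congr (_ + _).
    rewrite (deform_lact_fun HA HE Hom).
    apply: etrans (lin_twist _ _ _ _ _ _ _ _ _ LN) _.
    exact: (twist_equivr bicoA bicoE bom bom' b1 a b diff_lco diff_rco).
  apply: etrans (xiE HA HE Hom (d a) (d b)) _.
  apply: etrans (twist_equivl bicoE bicoE bom bom' tb a (d b) diff_lco diff_rco) _.
  exact: (twist_equivr bicoA bicoE bom bom' b2 a b diff_lco diff_rco).
have [tst stt] := twist_inj bicoA bicoA b3 bT.
have sT a b := lin_twist (cop A) rcop (cop A) rcop om om' T a b Ls.
split=> H.
  apply/(torsionlessP Ls LN); apply: tst => a b; apply: etrans (esym (sT a b)) _.
  have /(congr1 xi) := (torsionlessP Lso LN').1 H a b.
  move=> H1; have := etrans (esym (xVK _)) H1.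
  by rewrite TE.
apply/(torsionlessP Lso LN') => a b /=.
apply: (can_inj xK); apply: etrans (xVK _) _.
apply: etrans (congr1 sigma (TE a b)) _; apply: etrans _ (esym (TE a b)).
apply: etrans (sT a b) _; apply: stt; exact: ((torsionlessP Ls LN).1 H).
Qed.

End TransportConnection.

(** * Compatibility with the metric *)

Section LinvComodule.
Context {K : fieldType} {A : @bialg_data K} {E : calculus_data A}.
Hypothesis HA : bialgebra A.
Hypothesis HE : bicovariant_bimodule E.
Variable S : {linear A -> A}.
Hypothesis HS : antipode S.
Local Notation r := (rcoact E).
Local Notation V := (linv E).
Local Notation pi := (linv_proj HA HE HS).
Implicit Types (X : lmodType K) (w : V).

Let LrE : lin (rco (E := E)) := rco_lin (E := E).
Let LrA : lin (rcop (A := A)) := rcop_lin (A := A).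
Let LrE2 : lin (rco2 (E := E)) := rco2_lin HA HE.
Let bicoE := bicomodule_E HE.
Let Lpi : lin pi := linv_proj_lin HA HE HS.

(** The right coaction restricted to 0E, with swapped legs. The projection [pi] only retypes its
    second leg, which is left-invariant already by [ev_rcoact_linv]. *)
Definition rlinv (w : V) : tensor A V := ev (r (w : E)) (fun (m0 : E) y => y \ox pi m0).

Lemma rlinv_lin : lin rlinv.
Proof. by rewrite /rlinv; lin. Qed.

Lemma ev_rlinv X (h : A -> V -> X) w : bilin h ->
  ev (rlinv w) h = ev (r (w : E)) (fun (m0 : E) y => h y (pi m0)).
Proof.
move=> bh; rewrite /rlinv ev_ev //.
by apply: eq_ev => w0 y; rewrite ev_tens.
Qed.

Lemma rlinv_val : equivariant rlinv (rco (E := E)) (fun w : V => w : E).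
Proof.
move=> X h w bh; rewrite ev_rlinv; last by lin.
rewrite /rco ev_tswap //.
have bf : bilin (fun m y => h y m) by lin.
exact: (esym (ev_rcoact_linv HA HE HS (linvP w) bf)).
Qed.

Let Lr := rlinv_lin.

Lemma rlinv_coassociative : coassociative (rcop (A := A)) rlinv.
Proof.
move=> X F tF w.
transitivity (ev (rco (w : E)) (fun x m0 => ev (rco m0) (fun y m1 => F x y (pi m1)))).
  apply: etrans _ (esym (rlinv_val _ _)); last by lin.
  apply: eq_ev => x w0.
  apply: etrans _ (esym (rlinv_val _ _)); last by lin.
  by apply: eq_ev => y w1; rewrite linv_proj_id.
rewrite (bico_ar bicoE (F := fun x y m => F x y (pi m))); last by split=> [?|? ?]; lin.
apply: etrans (rlinv_val _ _) _; first by lin.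
by apply: eq_ev => x w0; apply: eq_ev => y z; rewrite linv_proj_id.
Qed.

Lemma rlinv_counitary : counitary (eps A) rlinv.
Proof.
move=> X f w Lf.
transitivity (ev (rco (w : E)) (fun x m0 => eps A x *: f (pi m0))).
  apply: etrans _ (esym (rlinv_val _ _)); last by lin.
  by apply: eq_ev => x w0; rewrite linv_proj_id.
rewrite (bico_er bicoE (f := fun m => f (pi m))); last by lin.
by rewrite linv_proj_id.
Qed.

Definition rlinv2 (t : linv2 E) : tensor A (linv2 E) :=
  ev t (fun w1 w2 => ev (rlinv w1) (fun y1 v1 => ev (rlinv w2) (fun y2 v2 =>
    bmul y1 y2 \ox (v1 \ox v2)))).

Lemma rlinv2_lin : lin rlinv2.
Proof. by rewrite /rlinv2; lin. Qed.

Lemma rlinv2_covariant : covariant (@bmul K A) rlinv rlinv rlinv2 (@tens K V V).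
Proof.
move=> X f w1 w2 bf; rewrite /rlinv2 ev_tens; last by lin.
rewrite ev_ev //; apply: eq_ev => y1 v1; rewrite ev_ev //; apply: eq_ev => y2 v2.
by rewrite ev_tens.
Qed.

Let tens_ext (X : lmodType K) (f g : linv2 E -> X) : lin f -> lin g ->
  (forall v w, f (v \ox w) = g (v \ox w)) -> forall t, f t = g t.
Proof. exact: tensor_lin_ext. Qed.

Lemma rlinv2_coassociative : coassociative (rcop (A := A)) rlinv2.
Proof.
have [_ cm] := bicovariant_bmul HA.
exact: (image_coassociative HA (@bilin_tens K V V) tens_ext LrA Lr Lr rlinv2_lin cm
  rlinv_coassociative rlinv_coassociative rlinv2_covariant).
Qed.

Lemma rlinv2_counitary : counitary (eps A) rlinv2.
Proof.
exact: (image_counitary HA (@bilin_tens K V V) tens_ext Lr Lr rlinv2_lin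
  rlinv_counitary rlinv_counitary rlinv2_covariant).
Qed.

Lemma iota_rco2 : equivariant rlinv2 (rco2 (E := E)) (iota (E := E)).
Proof.
move=> X h t bh; move: t; apply: tens_ext; [lin | by have L2 := rlinv2_lin; lin | ].
move=> w1 w2; rewrite iotaE rlinv2_covariant; last by lin.
have [_ cr] := bicovariant_tA HA HE; rewrite cr //.
apply: etrans (rlinv_val _ _) _; first by lin.
apply: eq_ev => y1 v1; apply: etrans (rlinv_val _ _) _; first by lin.
by apply: eq_ev => y2 v2; rewrite iotaE.
Qed.

End LinvComodule.

(** * Reduction of compatibility to [Pi0] *)

Section Compatibility.
Context {K : fieldType} {A : @bialg_data K} {E : calculus_data A}.
Hypothesis HE : bicovariant_bimodule E.
Variables (nabla : E -> tensA E) (sigma : tensA E -> tensA E) (g : tensA E -> A).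
Variables (J : tensA E -> tensor (linv2 E) A) (k : linv2 E -> K).
Hypotheses (umulK : cancel (umul (E := E)) J) (JK : cancel J (umul (E := E))).
Hypotheses (Lg : lin g) (Lk : @lin K _ K^o k).
Hypothesis gi : forall t, g (iota t) = k t *: bone A.
Hypothesis gu : forall t a, g (umul (t \ox a)) = k t *: a.
Hypothesis LP : lin (Pi0 nabla sigma g).

(** Since g(t a) = k(t) a with k(t) a scalar, d(g(t a)) = k(t) da is precisely the second term of
    [Pi_g], and the first term Pi0(t) a is left over. The form [k] and the inverse [J] are
    parameters so that the lemma applies on the deformed side too. *)
Lemma compatibleP : compatible nabla sigma g <-> forall t, Pi0 nabla sigma g t = 0.
Proof.
pose f (t : linv2 E) a := ract (Pi0 nabla sigma g t) a + lact (g (iota t)) (diff E a).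
have bf : bilin f by rewrite /f; lin.
have PgE t a : Pi_g nabla sigma g (umul (t \ox a)) = f t a.
  by rewrite /Pi_g (finv_eq umulK JK) umulK tlift_tens.
have fE t a : f t a = ract (Pi0 nabla sigma g t) a + diff E (g (umul (t \ox a))).
  have Ll := bilin_lin1 (lact_bilin HE) (diff E a).
  by rewrite /f gi gu (linZ Ll) (lact1 HE) linearZ.
split=> [H t|P0 x].
  have := H (umul (t \ox bone A)); rewrite PgE fE (ract1 HE).
  by move/(congr1 (fun y => y - diff E (g (umul (t \ox bone A))))); rewrite addrK subrr.
rewrite -[x]JK; move: (J x).
have Lu := umul_lin HE.
have LPg : lin (fun u => Pi_g nabla sigma g (umul u)).
  apply: (eq_lin (g := tlift f)); last exact: tlift_lin.
  by move=> u; rewrite /Pi_g (finv_eq umulK JK) umulK.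
apply: (tensor_lin_ext LPg); first by lin.
by move=> t a; rewrite PgE fE P0 (lin_zero (bilin_lin1 (ract_bilin HE) a)) add0r.
Qed.

End Compatibility.

Section Psym.
Context {K : fieldType} {V : lmodType K}.

(** Q fixes P v, which lies in the common range, and kills v - P v, which lies in the common
    kernel. *)
Lemma is_psym_unique (s P Q : V -> V) : is_psym s P -> is_psym s Q -> P =1 Q.
Proof.
move=> [LP PP rP kP] [LQ QQ rQ kQ] v.
have PB x y : P (x - y) = P x - P y.
  by rewrite -scaleN1r addrC (LP (-1)) scaleN1r addrC.
have QB x y : Q (x - y) = Q x - Q y.
  by rewrite -scaleN1r addrC (LQ (-1)) scaleN1r addrC.
have QP : Q (P v) = P v.
  by have /rP/rQ[u <-] : exists u, P u = P v by exists v.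
have /kP/kQ : P (v - P v) = 0 by rewrite PB PP subrr.
by rewrite QB QP => /eqP; rewrite subr_eq0 => /eqP.
Qed.

Variables (s th thV : V -> V).
Hypotheses (Lth : lin th) (LthV : lin thV) (thK : cancel th thV) (thVK : cancel thV th).

Lemma is_psym_conj P : is_psym s P -> is_psym (fun t => thV (s (th t))) (fun t => thV
  (P (th t))).
Proof.
move=> [LP PP rP kP]; split=> [|v|v|v].
- exact: (lin_comp LthV (lin_comp LP Lth)).
- by rewrite thVK PP.
- split=> [[u <-]|H].
    by rewrite thVK (rP (P (th u))).1 //; exists (th u).
  have [|u uE] := (rP (th v)).2; first by rewrite -{2}H thVK.
  by exists (thV u); rewrite thVK uE thK.
split=> [H|H].
  have /kP : P (th v) = 0 by rewrite -[P _]thVK H (lin_zero Lth).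
  move=> /(_ [set x | Defs.span [set u | exists2 c : K, c != 1 & thV (s (th u)) = c *:
    u] (thV x)]%classic).
  rewrite /= thK; apply=> [|a x y Hx Hy|x [c c1 cx]] /=.
  - by rewrite (lin_zero LthV); apply: span0.
  - by rewrite (linZD LthV); apply: spanP.
  apply: spanS; exists c => //=; by rewrite thVK cx (linZ LthV).
have -> : P (th v) = 0; last by rewrite (lin_zero LthV).
apply/kP; move: H => /(_ [set x | Defs.span [set u | exists2 c : K, c != 1 & s u = c *:
  u] (th x)]%classic).
rewrite /=; apply=> [|a x y Hx Hy|x [c c1 cx]] /=.
- by rewrite (lin_zero Lth); apply: span0.
- by rewrite (linZD Lth); apply: spanP.
by apply: spanS; exists c => //=; rewrite -(linZ Lth) -cx thVK.
Qed.

End Psym.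

Section PsymConj.
Context {K : fieldType} {V : lmodType K}.
Variables (s th thV : V -> V).
Hypotheses (Lth : lin th) (LthV : lin thV) (thK : cancel th thV) (thVK : cancel thV th).

Lemma psym_lin (s0 : V -> V) : lin (psym s0).
Proof. by rewrite /psym; case: xgetP => [P _ []|]. Qed.

(** Conjugation matches the idempotents of the two operators. When there is none, [psym] takes its
    default value, the identity, on both sides, and conjugation preserves it. *)
Lemma psym_conj : psym (fun t => thV (s (th t))) =1 fun t => thV (psym s (th t)).
Proof.
move=> t; rewrite /psym; case: xgetP => [P _ /= HP|nP].
  have HP' := is_psym_conj LthV Lth thVK thK HP.
  case: xgetP => [Q _ /= HQ|/(_ (fun t => th (P (thV t))))]; last first.
    case; rewrite /=; move: HP'; congr is_psym; apply/funext => x; by rewrite !thVK.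
  apply: is_psym_unique HP (is_psym_conj Lth LthV thK thVK HQ) t.
case: xgetP => [Q _ /= HQ|_]; last by rewrite thK.
by case: (nP _ (is_psym_conj Lth LthV thK thVK HQ)).
Qed.

End PsymConj.

Section IdTensG.
Context {K : fieldType} {A : @bialg_data K} {E : calculus_data A}.
Hypothesis HE : bicovariant_bimodule E.
Variable g : tensA E -> A.
Hypothesis Lg : lin g.
Local Notation V := (linv E).

Let idg_ev (t : linv2 E) (w3 : V) :
  tlift (fun w1 w2 : V => ract (w1 : E) (g (tA (w2 : E) w3))) t
  = ev t (fun w1 w2 : V => ract (w1 : E) (g (tA (w2 : E) w3))).
Proof. by rewrite tlift_ev //; lin. Qed.

Let idg_bilin : bilin (fun (t : linv2 E) (w3 : V) =>
  tlift (fun w1 w2 : V => ract (w1 : E) (g (tA (w2 : E) w3))) t).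
Proof. by apply: (eq_bilin idg_ev); lin. Qed.

Lemma id_tens_g_lin : lin (id_tens_g (E := E) g).
Proof. exact: tlift_lin. Qed.

Lemma id_tens_g_tens (w1 w2 w3 : V) :
  id_tens_g (E := E) g ((w1 \ox w2) \ox w3) = ract (w1 : E) (g (tA (w2 : E) w3)).
Proof.
by rewrite /id_tens_g tlift_tens // idg_ev ev_tens //; lin.
Qed.

End IdTensG.

(** * Braiding, connection and metric on the left-invariants *)

Section InvariantRestriction.
Context {K : fieldType} {A : @bialg_data K} {E : calculus_data A}.
Hypothesis HA : bialgebra A.
Hypothesis HE : bicovariant_bimodule E.
Variable S : {linear A -> A}.
Hypothesis HS : antipode S.
Hypothesis fdE : findim (is_linv E).
Local Notation "1A" := (bone A).
Local Notation V := (linv E).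
Local Notation rV := (rlinv HA HE HS).
Local Notation rV2 := (rlinv2 HA HE HS).
Implicit Types (M X : lmodType K).

Lemma finv_iota x : lcoact2 x = 1A \ox x -> iota (Defs.finv (iota (E := E)) x) = x.
Proof.
have [j [_ jK _]] := iota_retract HA HE HS fdE.
move=> /(linv2_iota HA HE HS) [t ->].
by rewrite (finvE _ (can_inj jK)).
Qed.

Lemma finv_iota_lin M (f : M -> tensA E) : lin f ->
  (forall m, lcoact2 (f m) = 1A \ox f m) -> lin (fun m => Defs.finv (iota (E := E)) (f
    m)).
Proof.
move=> Lf If; have [j [Lj jK jV]] := iota_retract HA HE HS fdE.
apply: (eq_lin (g := fun m => j (f m))); last exact: (lin_comp Lj Lf).
by move=> m; rewrite -{1}(jV _ (If m)) (finvE _ (can_inj jK)).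
Qed.

Lemma iota_equivariant M (k : M -> tensor A M) (f : M -> linv2 E) : lin k ->
  equivariant k (rco2 (E := E)) (fun m => iota (f m)) -> lin f -> equivariant k rV2 f.
Proof.
move=> Lk ef Lf X h m bh; have [j [Lj jK _]] := iota_retract HA HE HS fdE.
transitivity (ev (rco2 (iota (f m))) (fun y x => h y (j x))).
  apply: etrans _ (esym (iota_rco2 HA HE HS _ _)); last by lin.
  by apply: eq_ev => y t; rewrite jK.
have b1 : bilin (fun y x => h y (j x)) by lin.
apply: etrans (ef _ _ m b1) _.
by apply: eq_ev => y m0; exact: (congr1 (h y) (jK (f m0))).
Qed.

Variable sigma : tensA E -> tensA E.
Hypothesis sP : canonical_braiding sigma.
Variable N : E -> tensA E.
Hypotheses (LN : lin N) (lN : left_covariant N) (rN : right_covariant N).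
Let Ls : lin sigma. Proof. by case: sP. Qed.

Let sigma_linv x : lcoact2 x = 1A \ox x -> lcoact2 (sigma x) = 1A \ox sigma x.
Proof.
move=> Ix; apply: tensor_ext => X f bf.
rewrite -> (braiding_lcoact2 HA HE HS sP) by exact: bf.
by rewrite Ix; do 2!rewrite -> ev_tens by lin.
Qed.

Lemma sigma0E t : iota (sigma0 sigma t) = sigma (iota t).
Proof. by apply: finv_iota; apply/sigma_linv/(lcoact2_iota HA HE). Qed.

Lemma sigma0_lin : lin (sigma0 (E := E) sigma).
Proof.
apply: finv_iota_lin => [|t]; first by lin.
by apply/sigma_linv/(lcoact2_iota HA HE).
Qed.

Let N_linv (w : V) : lcoact2 (N w) = 1A \ox N w.
Proof.
rewrite -lN (linvP w); apply: tensor_ext => X f bf.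
rewrite -> (ev_tmap _ (@lin_id K A) LN bf).
by do 2!rewrite -> ev_tens by lin.
Qed.

Lemma nabla0E (w : V) : iota (nabla0 N w) = N w.
Proof. exact/finv_iota/N_linv. Qed.

Lemma nabla0_lin : lin (nabla0 (E := E) N).
Proof.
apply: (finv_iota_lin (f := fun w : V => N w)) => [|t]; first by lin.
exact: N_linv.
Qed.

(** Isolated because it is equivariant for the right coaction, so that the twists in [Pi0] pass
    through it. *)
Definition kappa (w : V) : linv2 E := sigma0 sigma (nabla0 N w).

Lemma kappa_lin : lin kappa.
Proof. exact: (lin_comp sigma0_lin nabla0_lin). Qed.

Lemma kappa_equivariant : equivariant rV rV2 kappa.
Proof.
apply: iota_equivariant; [exact: rlinv_lin | | exact: kappa_lin].
move=> X h w bh.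
have E1 v : iota (kappa v) = sigma (N (v : V)) by rewrite sigma0E nabla0E.
have b1 : bilin (fun y x => h y (sigma x)) by lin.
have b2 : bilin (fun y m => h y (sigma (N m))) by lin.
apply: etrans (congr1 (fun x => ev (rco2 x) h) (E1 w)) _.
apply: etrans (braiding_rco2 HA HE HS sP _ bh) _.
apply: etrans (right_covariant_rco LN rN w b1) _.
apply: etrans (rlinv_val HA HE HS w b2) _.
by apply: eq_ev => y v; exact: (congr1 (h y) (esym (E1 v))).
Qed.

Variable g : tensA E -> A.
Hypotheses (Lg : lin g) (gr : forall x a, g (ract2 x a) = bmul (g x) a).
Hypothesis gI : bi_invariant g.

Definition kform (t : linv2 E) : K := eps A (g (iota t)).

Lemma kform_lin : @lin K _ K^o kform.
Proof. by rewrite /kform; have Le := eps_lin (A := A); lin. Qed.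

Lemma metric_iota t : g (iota t) = kform t *: 1A.
Proof.
have [gl _] := gI; rewrite -[LHS]gl (lcoact2_iota HA HE).
rewrite tlift_tens //; have Le := eps_lin (A := A); lin.
Qed.

Lemma metric_umul t a : g (umul (t \ox a)) = kform t *: a.
Proof.
rewrite (umulE HE) gr metric_iota (linZ (bilin_lin1 (bmul_bilin HA) a)).
by rewrite (bmul1 HA).
Qed.

(** Right invariance of g as k(t_0) t_1 = k(t) 1. It puts the unit into any cocycle that is
    evaluated on the coaction of t. *)
Lemma kform_invariant t : ev (rV2 t) (fun y s => kform s *: y) = kform t *: 1A.
Proof.
have Lk := kform_lin; have Le := eps_lin (A := A).
have [_ gI'] := gI; apply: etrans _ (metric_iota t); apply: etrans _ (gI' (iota t)).
rewrite -> tlift_ev by lin.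
transitivity (ev (rco2 (iota t)) (fun y x => eps A (g x) *: y)).
  by rewrite -> (iota_rco2 HA HE HS) by lin.
by rewrite /rco2; rewrite -> ev_tswap by lin.
Qed.

Lemma id_tens_gE (w1 w2 w3 : V) :
  id_tens_g (E := E) g ((w1 \ox w2) \ox w3) = kform (w2 \ox w3) *: (w1 : E).
Proof.
rewrite (id_tens_g_tens HE Lg) -iotaE metric_iota.
by rewrite (linZ (bilin_lin2 (ract_bilin HE) _)) (ract1 HE).
Qed.

Lemma Pi0E t : Pi0 N sigma g t
  = 2%:R *: id_tens_g g (tmap kappa id (psym (sigma0 sigma) t)).
Proof.
rewrite /Pi0; congr (_ *: id_tens_g g _); move: (psym _ t) => p.
have Ls0 := sigma0_lin; have Ln0 := nabla0_lin; have Lk := kappa_lin.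
apply: tensor_ext => X f bf.
rewrite -> (ev_tmap _ Ls0 (@lin_id K V) bf).
by do 2!rewrite -> ev_tmap by lin.
Qed.

Lemma Pi0_lin : lin (Pi0 N sigma g).
Proof.
have Lp := psym_lin (sigma0 (E := E) sigma).
have Li := id_tens_g_lin HE Lg.
have Lt := tmap_lin kappa_lin (@lin_id K V).
apply: (eq_lin Pi0E); apply: lin_scale.
exact: (lin_comp Li (lin_comp Lt Lp)).
Qed.

End InvariantRestriction.

Section TensorTwist.
Context {K : fieldType} {A : @bialg_data K}.
Hypothesis HA : bialgebra A.
Variables om om' : A -> A -> K.
Hypothesis Hom : dual_2cocycle om om'.
Let bom := cocycle_bilin Hom.
Let bom' := cocycle_inv_bilin Hom.
Context (M N : lmodType K) (rM : M -> tensor A M) (rN : N -> tensor A N).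
Hypotheses (LM : lin rM) (LN : lin rN).
Hypotheses (aM : coassociative (rcop (A := A)) rM) (aN : coassociative (rcop (A := A))
  rN).
Hypotheses (eM : counitary (eps A) rM) (eN : counitary (eps A) rN).
Implicit Types X : lmodType K.

Lemma tw2_rcopK X (f : M -> N -> X) m n : bilin f ->
  tw2 rM rN om (tw2 rM rN om' f) m n = f m n.
Proof.
move=> bf; rewrite (tw2_comp aM aN) // cconv2_rcop // (cocycleVK Hom).
exact: (tw2_counit eM eN).
Qed.

Lemma tw2_rcopVK X (f : M -> N -> X) m n : bilin f ->
  tw2 rM rN om' (tw2 rM rN om f) m n = f m n.
Proof.
move=> bf; rewrite (tw2_comp aM aN) // cconv2_rcop // (cocycleK Hom).
exact: (tw2_counit eM eN).
Qed.

Definition ttwist (F : A -> A -> K) : tensor M N -> tensor M N :=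
  tlift (tw2 rM rN F (@tens K M N)).

Lemma ttwist_lin F : @bilin K _ _ K^o F -> lin (ttwist F).
Proof. by move=> bF; apply: tlift_lin; apply: tw2_bilin => //; apply: bilin_tens. Qed.

Lemma ttwistE F m n : @bilin K _ _ K^o F ->
  ttwist F (m \ox n) = tw2 rM rN F (@tens K M N) m n.
Proof. by move=> bF; rewrite /ttwist tlift_tens //; apply: tw2_bilin => //; apply:
  bilin_tens. Qed.

Lemma ttwistK : cancel (ttwist om') (ttwist om).
Proof.
apply: (tensor_lin_ext (f := fun t => ttwist om (ttwist om' t)) (g := id)) => [||m n].
- exact: (lin_comp (ttwist_lin bom) (ttwist_lin bom')).
- exact: lin_id.
rewrite (ttwistE _ _ bom') (lin_tw2 _ _ _ _ _ _ (ttwist_lin bom)).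
under eq_tw2 => m' n' do rewrite (ttwistE _ _ bom).
exact: (tw2_rcopVK _ _ (bilin_tens M N)).
Qed.

Lemma ttwistVK : cancel (ttwist om) (ttwist om').
Proof.
apply: (tensor_lin_ext (f := fun t => ttwist om' (ttwist om t)) (g := id)) => [||m n].
- exact: (lin_comp (ttwist_lin bom') (ttwist_lin bom)).
- exact: lin_id.
rewrite (ttwistE _ _ bom) (lin_tw2 _ _ _ _ _ _ (ttwist_lin bom')).
under eq_tw2 => m' n' do rewrite (ttwistE _ _ bom').
exact: (tw2_rcopK _ _ (bilin_tens M N)).
Qed.

End TensorTwist.

(** * The left-invariants of the deformed calculus *)

Section DeformedInvariants.
Context {K : fieldType} {A : @bialg_data K} {E : calculus_data A}.
Hypothesis HA : bialgebra A.
Hypothesis HE : bicovariant_bimodule E.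
Variable S : {linear A -> A}.
Hypothesis HS : antipode S.
Hypothesis fdE : findim (is_linv E).
Variables om om' : A -> A -> K.
Hypothesis Hom : dual_2cocycle om om'.
Local Notation l := (lcoact E).
Local Notation V := (linv E).
Local Notation rV := (rlinv HA HE HS).
Local Notation rV2 := (rlinv2 HA HE HS).
Local Notation Eo := (deform_calculus om om' E).
Local Notation xi := (xi (E := E) om om').
Local Notation xiV := (xi_inv (E := E) om om').
Local Notation tract2 := (twist (lcoact2 (E := E)) rco2 (cop A) rcop om om' (@ract2 K A
  E)).
Implicit Types (M X : lmodType K).

Let bom := cocycle_bilin Hom.
Let bom' := cocycle_inv_bilin Hom.
Let HEo := bimodule_deform HA HE Hom.
Let Liota := iota_lin (E := E).
Let tb := @tA_bilin K A E.
Let Lxi := xi_lin HA HE Hom.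
Let xK := xiK HA HE Hom.
Let xVK := xi_invK HA HE Hom.
Let LrV : lin rV := rlinv_lin HA HE HS.
Let LrV2 : lin rV2 := rlinv2_lin HA HE HS.
Let arV := rlinv_coassociative HA HE HS.
Let arV2 := rlinv2_coassociative HA HE HS.
Let erV := rlinv_counitary HA HE HS.
Let erV2 := rlinv2_counitary HA HE HS.
Let LrA : lin (rcop (A := A)) := rcop_lin (A := A).
Let bicoA := bicomodule_A HA.
Let arA := bico_ar bicoA.
Let erA := bico_er bicoA.
Let br2 := ract2_bilin HE.
Let Ll : lin l. Proof. by lin. Qed.
Let LA : lin (cop A). Proof. by lin. Qed.
Let Ll2 : lin (lcoact2 (E := E)) := lcoact2_lin HA HE.

Definition theta : linv2 E -> linv2 E := ttwist rV rV om'.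
Definition theta_inv : linv2 E -> linv2 E := ttwist rV rV om.

Lemma theta_lin : lin theta. Proof. exact: ttwist_lin. Qed.
Lemma theta_inv_lin : lin theta_inv. Proof. exact: ttwist_lin. Qed.
Lemma thetaK : cancel theta theta_inv. Proof. exact: (ttwistK Hom LrV LrV). Qed.
Lemma theta_invK : cancel theta_inv theta. Proof. exact: (ttwistVK Hom LrV LrV). Qed.

Lemma thetaE v w : theta (v \ox w) = tw2 rV rV om' (@tens K V V) v w.
Proof. exact: ttwistE. Qed.

(** The trivial left coactions reduce [om] to a counit, so only the twist by [om'] remains. *)
Lemma xi_tA_linv (v w : V) : xi (tA (E := Eo) (v : E) (w : E))
  = tw2 rV rV om' (fun v w : V => tA (v : E) (w : E)) v w.
Proof.
apply: etrans (xiE HA HE Hom v w) _; rewrite /twist.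
have b1 := tw2_bilin Ll Ll bom tb.
have b2 : bilin (fun (m : E) (w : V) => tw2 l l om (@tA K A E) m (w : E)) by lin.
apply: etrans (tw2_equivr (rco (E := E)) (v : E) w bom' b1 (rlinv_val HA HE HS)) _.
apply: etrans (tw2_equivl v w LrV bom' b2 (rlinv_val HA HE HS)) _.
by apply: eq_tw2 => v' w'; exact: (twist_linv HE Hom w' (linvP v')).
Qed.

Lemma xi_iota (t : linv2 E) : xi (iota (E := Eo) t) = iota (theta t).
Proof.
move: t; apply: tensor_lin_ext.
- exact: (lin_comp Lxi (iota_lin (E := Eo))).
- exact: (lin_comp Liota theta_lin).
move=> v w; apply: etrans (congr1 xi (@iotaE _ _ Eo v w)) _.
apply: etrans (xi_tA_linv v w) _; rewrite thetaE.
apply: etrans _ (esym (lin_tw2 _ _ _ _ _ _ Liota)).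
by apply: eq_tw2 => v' w'; exact: (esym (iotaE v' w')).
Qed.

(** What is left of the deformed right action on a left-invariant t: the factor om'(t_1, a_2), since
    om(1, a_1) is a counit. *)
Definition psi : tensor (linv2 E) A -> tensor (linv2 E) A := ttwist rV2 rcop om'.
Definition psi_inv : tensor (linv2 E) A -> tensor (linv2 E) A := ttwist rV2 rcop om.

Lemma psiK : cancel psi psi_inv. Proof. exact: (ttwistK Hom LrV2 LrA). Qed.
Lemma psi_invK : cancel psi_inv psi. Proof. exact: (ttwistVK Hom LrV2 LrA). Qed.

Lemma xi_umul_tens (t : linv2 E) (a : A) :
  xi (umul (E := Eo) (t \ox a)) = umul (psi (theta t \ox a)).
Proof.
apply: etrans (congr1 xi (@umulE _ _ Eo HEo t a)) _.
apply: etrans (xi_ract2 HA HE Hom _ _) _.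
apply: etrans (congr1 (fun x => tract2 x a) (xi_iota t)) _.
move: (theta t) => {}t.
have b1 := tw2_bilin Ll2 LA bom br2.
apply: etrans (tw2_equivl t a LrA bom' b1 (iota_rco2 HA HE HS)) _.
apply/esym; rewrite /psi (ttwistE LrV2 LrA _ _ bom').
apply: etrans (lin_tw2 _ _ _ _ _ _ (umul_lin HE)) _.
apply: eq_tw2 => s b; rewrite (umulE HE); apply/esym.
rewrite /tw2 (lcoact2_iota HA HE).
rewrite -> ev_tens by lin.
transitivity (ev (cop A b) (fun x b' => eps A x *: ract2 (iota s) b')).
  by apply: eq_ev => x b'; exact: (congr1 (fun c => c *: ract2 (iota s) b') (cocycle1l
    Hom x)).
exact: (cop_counitl HA b (bilin_lin2 br2 (iota s))).
Qed.

(** Along [xi], the deformed multiplication is [umul] after [psi] and theta (x) id, all of which are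
    bijective. *)
Lemma umul_deform_bij : exists Jo : tensA Eo -> tensor (linv2 E) A,
  cancel (umul (E := Eo)) Jo /\ cancel Jo (umul (E := Eo)).
Proof.
have [J [LJ umulK JK]] := umul_bij HA HE HS fdE.
have Lpsi : lin psi by exact: ttwist_lin.
have Lth := tmap_lin theta_lin (@lin_id K A).
have LthV := tmap_lin theta_inv_lin (@lin_id K A).
have xu (u : tensor (linv2 E) A) : xi (umul (E := Eo) u) = umul (psi (tmap theta id u)).
  move: u; apply: tensor_lin_ext.
  - exact: (lin_comp Lxi (umul_lin HEo)).
  - exact: (lin_comp (umul_lin HE) (lin_comp Lpsi Lth)).
  move=> t a; apply: etrans (xi_umul_tens t a) _.
  have bt : bilin (fun (t : linv2 E) (a : A) => theta t \ox a) by have Lt := theta_lin;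
    lin.
  exact: (congr1 (fun u => umul (psi u)) (esym (tlift_tens bt t a))).
have thK : cancel (tmap theta (@id A)) (tmap theta_inv id).
  move=> u; apply: tensor_ext => X f bf; have Lt := theta_lin; have Lt' := theta_inv_lin.
  rewrite -> (ev_tmap _ theta_inv_lin (@lin_id K A) bf).
  rewrite -> ev_tmap by lin.
  by apply: eq_ev => t a; rewrite thetaK.
have thVK : cancel (tmap theta_inv (@id A)) (tmap theta id).
  move=> u; apply: tensor_ext => X f bf; have Lt := theta_lin; have Lt' := theta_inv_lin.
  rewrite -> (ev_tmap _ theta_lin (@lin_id K A) bf).
  rewrite -> ev_tmap by lin.
  by apply: eq_ev => t a; rewrite theta_invK.
exists (fun y => tmap theta_inv id (psi_inv (J (xi y)))); split=> u.
  by rewrite xu umulK psiK thK.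
apply: (can_inj xK); apply: etrans (xu _) _.
exact: etrans (congr1 (fun v => umul (psi v)) (thVK _)) (etrans (congr1 (umul (E := E))
  (psi_invK _)) (JK _)).
Qed.

Lemma iota_deform_inj : injective (iota (E := Eo)).
Proof.
have [j [Lj jK _]] := iota_retract HA HE HS fdE.
move=> s t st; apply: (can_inj thetaK); apply: (can_inj jK).
apply: etrans (esym (xi_iota s)) _; apply: etrans _ (xi_iota t).
exact: (congr1 xi st).
Qed.

Lemma finv_iota_deform x y : x = iota (E := E) y ->
  Defs.finv (iota (E := Eo)) (xiV x) = theta_inv y.
Proof.
move=> ->; have <- : iota (E := Eo) (theta_inv y) = xiV (iota y).
  apply: (can_inj xK); apply: etrans (xi_iota _) _; rewrite theta_invK.
  exact: (esym (xVK _)).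
exact: finvE iota_deform_inj.
Qed.

End DeformedInvariants.

(** * Compatibility of the deformed connection *)

Section DeformedCompatibility.
Context {K : fieldType} {A : @bialg_data K} {E : calculus_data A}.
Hypothesis HA : bialgebra A.
Hypothesis HE : bicovariant_bimodule E.
Variable S : {linear A -> A}.
Hypothesis HS : antipode S.
Hypothesis fdE : findim (is_linv E).
Variables om om' : A -> A -> K.
Hypothesis Hom : dual_2cocycle om om'.
Local Notation "1A" := (bone A).
Local Notation V := (linv E).
Local Notation rV := (rlinv HA HE HS).
Local Notation rV2 := (rlinv2 HA HE HS).
Local Notation Eo := (deform_calculus om om' E).
Local Notation xi := (xi (E := E) om om').
Local Notation xiV := (xi_inv (E := E) om om').
Implicit Types (M X : lmodType K).

Let bom := cocycle_bilin Hom.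
Let bom' := cocycle_inv_bilin Hom.
Let HEo := bimodule_deform HA HE Hom.
Let Lxi := xi_lin HA HE Hom.
Let xK := xiK HA HE Hom.
Let LrV : lin rV := rlinv_lin HA HE HS.
Let LrV2 : lin rV2 := rlinv2_lin HA HE HS.
Let arV := rlinv_coassociative HA HE HS.
Let arV2 := rlinv2_coassociative HA HE HS.
Let erV := rlinv_counitary HA HE HS.
Let erV2 := rlinv2_counitary HA HE HS.
Let LrA : lin (rcop (A := A)) := rcop_lin (A := A).
Let bicoA := bicomodule_A HA.
Let erA := bico_er bicoA.

Local Notation theta := (theta HA HE HS om').
Local Notation theta_inv := (theta_inv HA HE HS om).
Let Lth : lin theta := theta_lin HA HE HS Hom.
Let LthV : lin theta_inv := theta_inv_lin HA HE HS Hom.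
Let thK := thetaK HA HE HS Hom.
Let thVK := theta_invK HA HE HS Hom.

Variable sigma : tensA E -> tensA E.
Hypothesis sP : canonical_braiding sigma.
Variable N' : E -> tensA Eo.
Hypothesis LN' : lin N'.
Let N (m : E) : tensA E := xi (N' m).
Let LN : lin N. Proof. exact: (lin_comp Lxi LN'). Qed.
Hypotheses (lN : left_covariant N) (rN : right_covariant N).
Variable g : tensA E -> A.
Hypotheses (Lg : lin g) (gr : forall x a, g (ract2 x a) = bmul (g x) a).
Hypothesis gI : bi_invariant g.

Local Notation so := (fun x => xiV (sigma (xi x))).
Local Notation go := (deform_metric om om' g).
Local Notation kf := (kform g).
Local Notation kap := (kappa sigma N).
Let Ls0 : lin (sigma0 (E := E) sigma) := sigma0_lin HA HE HS fdE sP.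
Let Ln0 : lin (nabla0 (E := E) N) := nabla0_lin HA HE HS fdE LN lN.
Let Lkap : lin kap := kappa_lin HA HE HS fdE sP LN lN.
Let Lkf : @lin K _ K^o kf := kform_lin Lg.
Let Lgo : @lin K (tensA Eo) A go. Proof. exact: (lin_comp Lg Lxi). Qed.

Lemma nabla0_deform (w : V) : nabla0 (E := Eo) N' w = theta_inv (nabla0 N w).
Proof.
rewrite /nabla0; have -> : N' w = xiV (N w) by exact: (esym (xK _)).
exact: (finv_iota_deform HA HE HS fdE Hom (esym (nabla0E HA HE HS fdE LN lN w))).
Qed.

Lemma sigma0_deform (t : linv2 E) :
  sigma0 (E := Eo) so t = theta_inv (sigma0 sigma (theta t)).
Proof.
rewrite /sigma0.
apply: (finv_iota_deform HA HE HS fdE Hom).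
apply: etrans (congr1 sigma (xi_iota HA HE HS Hom t)) _.
exact: (esym (sigma0E HA HE HS fdE sP (theta t))).
Qed.

Lemma psym_deform (t : linv2 E) :
  psym (sigma0 (E := Eo) so) t = theta_inv (psym (sigma0 sigma) (theta t)).
Proof.
have -> : sigma0 (E := Eo) so = fun t : linv2 E => theta_inv (sigma0 sigma (theta t)).
  by apply/funext => s; exact: sigma0_deform.
exact: (@psym_conj _ (linv2 E) (sigma0 sigma) theta theta_inv Lth LthV thK thVK t).
Qed.

Lemma metric_iota_deform (t : linv2 E) : go (iota (E := Eo) t) = kf (theta t) *: 1A.
Proof.
apply: etrans (congr1 g (xi_iota HA HE HS Hom t)) _.
exact: (metric_iota HA HE Lg gI (theta t)).
Qed.

Local Notation idgo := (id_tens_g (E := Eo) go).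

Lemma id_tens_g_deform (w1 w2 w3 : V) :
  idgo ((w1 \ox w2) \ox w3) = kf (theta (w2 \ox w3)) *: (w1 : E).
Proof.
apply: etrans (@id_tens_g_tens _ _ Eo HEo go Lgo w1 w2 w3) _.
apply: etrans (congr1 (ract (c := Eo) (w1 : E)) (esym (congr1 go (@iotaE _ _ Eo w2
  w3)))) _.
apply: etrans (congr1 (ract (c := Eo) (w1 : E)) (metric_iota_deform (w2 \ox w3))) _.
apply: etrans (linZ (bilin_lin2 (ract_bilin HEo) (w1 : E)) _ _) _.
exact: (congr1 _ (ract1 HEo (w1 : E))).
Qed.

Let c (t : linv2 E) (w : V) : E := id_tens_g g (t \ox w).
Let bc : bilin c.
Proof. by have Li := id_tens_g_lin HE Lg; rewrite /c; lin. Qed.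
Let c' (m : V) (t : linv2 E) : E := kf t *: (m : E).
Let bc' : bilin c'. Proof. by rewrite /c'; lin. Qed.

(** By k(t_0) t_1 = k(t) 1, the factor om'(w_1, t_1) becomes om'(w_1, 1) = eps(w_1). *)
Let kform_twist (w : V) (t : linv2 E) : tw2 rV rV2 om' c' w t = kf t *: (w : E).
Proof.
transitivity (ev (rV w) (fun x v => eps A x *: (kf t *: (v : E)))); last first.
  by apply: (erV (f := fun v : V => kf t *: (v : E))); lin.
apply: eq_ev => x v.
transitivity (om' x (ev (rV2 t) (fun y s => kf s *: y)) *: (v : E)).
  have Lo : @lin K _ K^o (om' x) := bilin_lin2 bom' x.
  rewrite -[om' x _](esym (lin_ev _ _ Lo)) ev_scalel.
  by apply: eq_ev => y s; rewrite (linZ Lo) /c' scalerA mulrC.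
rewrite (kform_invariant HA HE HS Lg gI t).
rewrite (linZ (bilin_lin2 bom' x)) (cocycle_inv1r HA Hom).
by rewrite scalerA mulrC.
Qed.

Let kform_twistl (t : linv2 E) (a : A) : tw2 rV2 rcop om' (fun t a => kf t *: a) t a =
  kf t *: a.
Proof.
rewrite /tw2 exch_ev.
transitivity (ev (rcop a) (fun x b => eps A x *: (kf t *: b))); last first.
  by apply: (erA (f := fun b => kf t *: b)); lin.
apply: eq_ev => x b.
transitivity (om' (ev (rV2 t) (fun y s => kf s *: y)) x *: b).
  have Lo : @lin K _ K^o (om'^~ x) := bilin_lin1 bom' x.
  have E1 : om' (ev (rV2 t) (fun y s => kf s *: y)) x
      = ev (rV2 t) ((fun y s => om' (kf s *: y) x) : A -> linv2 E -> K^o) := @lin_ev K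
        A (linv2 E) A K^o (om'^~ x) (rV2 t) (fun y s => kf s *: y) Lo.
  rewrite E1 ev_scalel.
  by apply: eq_ev => y s; rewrite (linZ Lo) scalerA mulrC.
rewrite (kform_invariant HA HE HS Lg gI t).
rewrite (linZ (bilin_lin1 bom' x)) (cocycle_inv1l HA Hom).
by rewrite scalerA mulrC.
Qed.

(* om'(xy, z) * om'(x, y) = om'(x, yz) * om'(y, z) in the convolution algebra,
   and the right invariance of g reduces om'(x, yz) to a counit. *)
Lemma id_tens_g_theta (s : linv2 E) (w : V) : idgo (s \ox w) = tw2 rV2 rV om' c (theta
  s) w.
Proof.
have bt := @bilin_tens K V V.
have Lgo' := @id_tens_g_lin _ _ Eo HEo go Lgo.
move: s; apply: tensor_lin_ext.
- exact: (lin_comp Lgo' (bilin_lin1 (bilin_tens _ _) w)).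
- exact: (lin_comp (bilin_lin1 (tw2_bilin LrV2 LrV bom' bc) w) Lth).
move=> w1 w2; apply: etrans (id_tens_g_deform w1 w2 w) _.
apply: etrans _ (congr1 (fun s => tw2 rV2 rV om' c s w) (esym (thetaE HA HE HS Hom w1
  w2))).
have bmu := bmul_bilin HA; have Le := eps_lin (A := A).
have cv := rlinv2_covariant HA HE HS.
apply/esym; apply: etrans (tw2_covariantl LrV LrV2 arV arV arV Le bmu erV w1 w2 w bom'
  bom' bt bc cv) _.
apply: etrans _ (kform_twist w1 (theta (w2 \ox w))).
apply: etrans _ (congr1 (tw2 rV rV2 om' c' w1) (esym (thetaE HA HE HS Hom w2 w))).
apply: etrans _ (esym (tw2_covariantr LrV LrV2 arV arV arV Le bmu erV w1 w2 w bom' bom'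
  bt bc' cv)).
rewrite !cconv3_rcop; try by lin.
rewrite -(cocycle3_invE HA Hom).
by apply: eq_tw3 => v1 v2 v3; exact: (id_tens_gE HA HE Lg gI v1 v2 v3).
Qed.

Let Ls0o : lin (sigma0 (E := Eo) so : linv2 E -> linv2 E).
Proof. apply: (eq_lin sigma0_deform); exact: (lin_comp LthV (lin_comp Ls0 Lth)). Qed.
Let Ln0o : lin (nabla0 (E := Eo) N' : V -> linv2 E).
Proof. apply: (eq_lin nabla0_deform); exact: (lin_comp LthV Ln0). Qed.

(** By [id_tens_g_theta] the contraction carries a twist by [om']. It passes through the equivariant
    [kap] and cancels the twist by [om] that defines [theta_inv]. *)
Let idgo_nabla (p : linv2 E) :
  idgo (tmap (sigma0 (E := Eo) so) id (tmap (nabla0 (E := Eo) N') id (theta_inv p)))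
  = id_tens_g g (tmap kap id p).
Proof.
have bt := @bilin_tens K V V.
have Li := id_tens_g_lin HE Lg.
have Lgo' : @lin K (tensor (linv2 E) V) E idgo := @id_tens_g_lin _ _ Eo HEo go Lgo.
pose G (u w : V) : E := tw2 rV2 rV om' c (kap u) w.
have btc := tw2_bilin LrV2 LrV bom' bc.
have bG : bilin G by rewrite /G; lin.
have E1 (q : linv2 E) : idgo (tmap (sigma0 (E := Eo) so) id (tmap (nabla0 (E := Eo) N')
  id q)) = ev q G.
  have b1 : @bilin K (linv2 E) V E (fun t w => idgo (t \ox w)) by lin.
  have b2 : @bilin K (linv2 E) V E (fun t w => idgo (sigma0 (E := Eo) so t \ox w)) by lin.
  have -> (x : tensor (linv2 E) V) : idgo x = ev x (fun (t : linv2 E) (w : V) => idgo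
    (t \ox w)).
    by rewrite -(lin_ev _ _ Lgo') ev_id.
  apply: etrans (ev_tmap _ Ls0o (@lin_id K V) b1) _.
  apply: etrans (ev_tmap _ Ln0o (@lin_id K V) b2) _.
  apply: eq_ev => u w.
  have -> : sigma0 (E := Eo) so (nabla0 (E := Eo) N' u) = theta_inv (kap u).
    by rewrite nabla0_deform sigma0_deform thVK.
  by rewrite id_tens_g_theta thVK.
apply: etrans (E1 _) _.
have Lk := tmap_lin Lkap (@lin_id K V).
move: p; apply: tensor_lin_ext.
- by lin.
- exact: (lin_comp Li Lk).
move=> u w.
have -> : theta_inv (u \ox w) = tw2 rV rV om (@tens K V V) u w by exact: ttwistE.
rewrite (lin_tw2 _ _ _ _ _ _ (g := fun t => ev t G)); last by lin.
under eq_tw2 => u' w' do rewrite (ev_tens _ _ bG).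
apply: etrans (esym (tw2_equivl u w LrV bom btc (kappa_equivariant HA HE HS fdE sP LN
  lN rN))) _.
apply: etrans (tw2_rcopK Hom arV2 arV erV2 erV _ _ bc) _.
rewrite /c; congr (id_tens_g g _).
by rewrite tmap_ev // ev_tens //; lin.
Qed.

Lemma Pi0_deform (t : linv2 E) :
  Pi0 (E := Eo) N' so go t = Pi0 N sigma g (theta t).
Proof.
rewrite (Pi0E HA HE HS fdE sP LN lN g).
rewrite /Pi0 (psym_deform t); congr (_ *: _).
exact: idgo_nabla.
Qed.

Lemma compatible_deform : compatible (E := Eo) N' so go <-> compatible N sigma g.
Proof.
have [J [LJ umulK JK]] := umul_bij HA HE HS fdE.
have [Jo [umuloK JoK]] := umul_deform_bij HA HE HS fdE Hom.
have LP := Pi0_lin HA HE HS fdE sP LN lN Lg.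
have LPo : lin (Pi0 (E := Eo) N' so go).
  apply: (eq_lin Pi0_deform); exact: (lin_comp LP Lth).
have C := compatibleP HE umulK JK Lg (metric_iota HA HE Lg gI) (metric_umul HA HE Lg gr
  gI) LP.
have Lko : @lin K _ K^o (fun t : linv2 E => kf (theta t)) := lin_comp Lkf Lth.
have guo (t : linv2 E) (a : A) : go (umul (E := Eo) (t \ox a)) = kf (theta t) *: a.
  apply: etrans (congr1 g (xi_umul_tens HA HE HS Hom t a)) _.
  have -> : psi HA HE HS om' (theta t \ox a) = tw2 rV2 rcop om' (@tens K (linv2 E) A)
    (theta t) a.
    exact: ttwistE.
  move: (theta t) => {}t.
  rewrite (lin_tw2 _ _ _ _ _ _ (g := fun x => g (umul x))); last by have Lu := umul_lin
    HE; lin.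
  transitivity (tw2 rV2 rcop om' (fun t a => kf t *: a) t a).
    by apply: eq_tw2 => t' a'; exact: (metric_umul HA HE Lg gr gI).
  exact: kform_twistl.
have Co := @compatibleP _ _ Eo HEo N' so go Jo (fun t => kf (theta t)) umuloK JoK Lgo
  metric_iota_deform guo LPo.
split=> [/Co H|/C H].
  apply/C => t; rewrite -[t]thVK.
  apply: etrans (esym (Pi0_deform _)) _; exact: H.
apply/Co => t; apply: etrans (Pi0_deform t) _; exact: H.
Qed.
End DeformedCompatibility.

(** * Transport of Levi-Civita connections in both directions *)

Section LeviCivita.
Context {K : fieldType} {A : @bialg_data K} {E : calculus_data A}.
Hypothesis HA : hopf_algebra A.
Hypothesis HC : bicovariant_calculus E.
Hypothesis fdE : findim (is_linv E).
Variables om om' : A -> A -> K.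
Hypothesis Hom : dual_2cocycle om om'.
Variable g : tensA E -> A.
Hypotheses (Lg : lin g) (gr : forall x a, g (ract2 x a) = bmul (g x) a).
Hypothesis gI : bi_invariant g.
Local Notation Eo := (deform_calculus om om' E).
Local Notation xi := (xi (E := E) om om').
Local Notation xiV := (xi_inv (E := E) om om').
Local Notation go := (deform_metric om om' g).

Let HB : bialgebra A. Proof. by case: HA. Qed.
Let HE : bicovariant_bimodule E. Proof. by case: HC. Qed.
Let dl a : lcoact E (diff E a) = tmap id (diff E) (cop A a). Proof. by case: HC. Qed.
Let dr a : rcoact E (diff E a) = tmap (diff E) id (cop A a). Proof. by case: HC. Qed.
Let LxiV := xi_inv_lin HB HE Hom.
Let xK := xiK HB HE Hom.

Lemma levi_civita_deform (N' : E -> tensA Eo) :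
  bicovariant_levi_civita (fun m => xi (N' m)) g ->
  bicovariant_levi_civita (E := Eo) N' go.
Proof.
have [_ _ _ [S HS]] := HA.
move=> [[sigma [sP cN lN tN kN]] rN].
have LN' : lin N'.
  apply: (eq_lin (g := fun m => xiV (xi (N' m)))); last exact: (lin_comp LxiV cN.1).
  by move=> m; exact: (esym (xK _)).
split; last exact: ((transport_right_covariant HB HE Hom LN').2 rN).
exists (fun x => xiV (sigma (xi x))); split.
- exact: (deform_braiding HB HE HS Hom sP).
- exact: ((transport_connection HB HE dl dr Hom LN' lN rN).2 cN).
- exact: ((transport_left_covariant HB HE Hom LN').2 lN).
- exact: ((transport_torsionless HB HE dl dr Hom LN' sP).2 tN).
exact: ((compatible_deform HB HE HS fdE Hom sP LN' lN rN Lg gr gI).2 kN).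
Qed.

Lemma levi_civita_undeform (sigma : tensA E -> tensA E) (N' : E -> tensA Eo) :
  canonical_braiding sigma ->
  bicovariant_levi_civita (E := Eo) N' go ->
  bicovariant_levi_civita (fun m => xi (N' m)) g.
Proof.
have [_ _ _ [S HS]] := HA.
move=> sP [[so [soP cN lN tN kN]] rN]; have LN' : lin N' := cN.1.
have soE : so = fun x => xiV (sigma (xi x)).
  apply/funext => x.
  exact: (deform_braiding_unique HB HE HS Hom soP (deform_braiding HB HE HS Hom sP)).
rewrite {}soE {soP} in tN kN.
have rN0 := (transport_right_covariant HB HE Hom LN').1 rN.
have lN0 := (transport_left_covariant HB HE Hom LN').1 lN.
split; last exact: rN0.
exists sigma; split.
- exact: sP.
- exact: ((transport_connection HB HE dl dr Hom LN' lN0 rN0).1 cN).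
- exact: lN0.
- exact: ((transport_torsionless HB HE dl dr Hom LN' sP).1 tN).
exact: ((compatible_deform HB HE HS fdE Hom sP LN' lN0 rN0 Lg gr gI).1 kN).
Qed.

End LeviCivita.

Theorem theorem8p9 (R : realType) (A : @bialg_data R[i]%C) (E : calculus_data A)
    (sigma : tensA E -> tensA E) (om om' : A -> A -> R[i]%C)
    (g : tensA E -> A) :
  hopf_algebra A ->
  bicovariant_calculus E ->
  findim (is_linv E) -> findim (is_rinv E) ->
  canonical_braiding sigma ->
  dual_2cocycle om om' ->
  diagonalisable (sigma0 sigma) ->
  pseudo_riemannian_metric sigma g ->
  bi_invariant g ->
  forall nabla : E -> tensA E,
    bicovariant_levi_civita nabla g ->
    bicovariant_levi_civita (deform_connection om om' nabla)
                            (deform_metric om om' g)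
    /\
    ((forall nabla' : E -> tensA E, levi_civita nabla' g -> nabla' =1 nabla) ->
     forall nabla' : deform_calculus om om' E -> tensA (deform_calculus om om' E),
       bicovariant_levi_civita nabla' (deform_metric om om' g) ->
       nabla' =1 deform_connection om om' nabla).
Proof.
move=> HA HC fdE _ sP Hom _ [Lg gr _ _] gI nabla nablaP.
have HB : bialgebra A by case: HA.
have HE : bicovariant_bimodule E by case: HC.
have xiVE := finv_xi HB HE Hom.
split=> [|uniq nabla' nabla'P m].
  apply: (levi_civita_deform HA HC fdE Hom Lg gr gI).
  suff -> : (fun m => xi om om' (deform_connection om om' nabla m)) = nabla by [].
  apply/funext => m; apply: etrans (congr1 (xi om om') (xiVE _)) _.
  exact: (xi_invK HB HE Hom).
(* The uniqueness assumption concerns E, so the competitor is compared there, as [xi] after nabla',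
   and the equality is pulled back along the inverse of [xi]. *)
have [LC _] := levi_civita_undeform HA HC fdE Hom Lg gr gI sP nabla'P.
apply: etrans (esym (xiK HB HE Hom (nabla' m))) _.
apply: etrans (esym (xiVE _)) _.
exact: (congr1 (Defs.finv (xi om om')) (uniq _ LC m)).
Qed.
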